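(* For each conjugacy class $\mathcal O$ of $\tilde W$ choose a minimal length representative $\tilde w_{\mathcal O}\in\mathcal O$. Then the images of $(T_{\tilde w_{\mathcal O}})_{\mathcal O}$, with $\mathcal O$ ranging over all conjugacy classes of $\tilde W$, form an $\mathcal A$-basis of the cocenter $\tilde H/[\tilde H,\tilde H]$. In particular, the polynomials $f_{\tilde w,\mathcal O}$ with $T_{\tilde w}\equiv\sum_{\mathcal O}f_{\tilde w,\mathcal O}T_{\tilde w_{\mathcal O}}\mod[\tilde H,\tilde H]$ are uniquely determined by $\tilde w$.
   Context: Setting: $W=Q\rtimes W_0$ affine Weyl group with simple reflections $S$; $\tilde W=P\rtimes(W_0\rtimes\Omega')=W\rtimes\Omega$ for a connected complex reductive group with coweight lattice $P$ and finite group $\Omega'$ of diagram automorphisms; $\ell$ the length on $\tilde W$ (number of affine root hyperplanes separating the fundamental alcove from its image). $\mathcal A=\mathbb Z[v,v^{-1}]$; $\tilde H$ is the $\mathcal A$-algebra with basis $\{T_w\}_{w\in\tilde W}$, $T_xT_y=T_{xy}$ when $\ell(xy)=\ell(x)+\ell(y)$, $(T_s-v)(T_s+v^{-1})=0$ for $s\in S$; $[\tilde H,\tilde H]$ is the $\mathcal A$-span of all commutators. *)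

(* Defs.v *)
From HB Require Import structures.
From mathcomp Require Import all_boot all_order all_algebra.
Set Implicit Arguments. Unset Strict Implicit. Unset Printing Implicit Defensive.
Import Order.TTheory GRing.Theory Num.Theory.
Local Open Scope ring_scope.

(* ---------- Root datum (X^*, Phi, X_*, Phi^v) with X^* = Z^n (row vectors),
   X_* = P = Z^n (column vectors); pairing <alpha, lambda> = alpha *m lambda. *)
Definition pairing n (a : 'rV[int]_n) (l : 'cV[int]_n) : int := (a *m l) 0 0.

(* a root together with its coroot *)
Definition rootpair n := ('rV[int]_n * 'cV[int]_n)%type.

(* the reflection s_alpha: acts on X_* by left multiplication
   (lambda |-> lambda - <alpha,lambda> alpha^v) and on X^* by right
   multiplication (mu |-> mu - <mu,alpha^v> alpha). *)
Definition reflM n (r : rootpair n) : 'M[int]_n := 1%:M - r.2 *m r.1.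

(* reduced root datum (= root datum of a connected complex reductive group) *)
Definition is_root_datum n (Phi : seq (rootpair n)) : Prop :=
  [/\ uniq (unzip1 Phi), uniq (unzip2 Phi)
    & forall r, r \in Phi -> pairing r.1 r.2 = 2] /\
  [/\
      forall r s, r \in Phi -> s \in Phi -> s.1 *m reflM r \in unzip1 Phi,
      forall r s, r \in Phi -> s \in Phi -> reflM r *m s.2 \in unzip2 Phi &
      forall r, r \in Phi -> (r.1 + r.1) \notin unzip1 Phi].

Definition regular n (Phi : seq (rootpair n)) (f : 'cV[int]_n) : Prop :=
  forall r, r \in Phi -> pairing r.1 f != 0.
Definition pos n (f : 'cV[int]_n) (a : 'rV[int]_n) : bool := 0 < pairing a f.

Inductive inW0 n (Phi : seq (rootpair n)) : 'M[int]_n -> Prop :=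
  | W0_one : inW0 Phi 1%:M
  | W0_mul r w : r \in Phi -> inW0 Phi w -> inW0 Phi (reflM r *m w).

(* automorphism of the based root datum (acting on X_* by sg, on X^* by the
   contragredient mu |-> mu *m sg^-1) *)
Definition diagram_aut n (Phi : seq (rootpair n)) (f : 'cV[int]_n)
    (sg : 'M[int]_n) : Prop :=
  exists sg' : 'M[int]_n,
    [/\ sg *m sg' = 1%:M, sg' *m sg = 1%:M,
        forall r, r \in Phi -> (r.1 *m sg', sg *m r.2) \in Phi &
        forall r, r \in Phi -> pos f r.1 -> pos f (r.1 *m sg')].

Definition diagram_group n (Phi : seq (rootpair n)) (f : 'cV[int]_n)
    (Om : 'M[int]_n -> Prop) : Prop :=
  [/\ Om 1%:M,
      forall a b, Om a -> Om b -> Om (a *m b),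
      forall a, Om a -> exists2 b, Om b & a *m b = 1%:M,
      (exists s : seq 'M[int]_n, forall a, Om a -> a \in s) &
      forall a, Om a -> diagram_aut Phi f a].

(* ---------- Extended affine Weyl group  P x| (W_0 x| Omega'):
   element (lambda, g) = t^lambda g, acting on X_* (x) R by x |-> g x + lambda *)
Definition elt n := ('cV[int]_n * 'M[int]_n)%type.

Definition inWt n (Phi : seq (rootpair n)) (Om : 'M[int]_n -> Prop)
    (x : elt n) : Prop :=
  exists w sg, [/\ inW0 Phi w, Om sg & x.2 = w *m sg].

Definition emul n (x y : elt n) : elt n := (x.1 + x.2 *m y.1, x.2 *m y.2).

Definition wconj n (Phi : seq (rootpair n)) (Om : 'M[int]_n -> Prop)
    (x y : elt n) : Prop :=
  exists z, inWt Phi Om z /\ emul z x = emul y z.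

(* Length = number of affine root hyperplanes H_{alpha,k} separating the
   fundamental alcove C = {0 < <x,alpha> < 1, alpha > 0} from its image.
   For alpha > 0 the alcove C lies in the strip k in (0,1) and its image
   under t^lambda g lies in the strip (m, m+1) with
   m = <alpha,lambda> if g^-1 alpha > 0 and m = <alpha,lambda> - 1 otherwise,
   (g^-1 alpha = alpha *m g in the contragredient action); the number of
   separating hyperplanes H_{alpha,k} is |m|. *)
Definition alen n (Phi : seq (rootpair n)) (f : 'cV[int]_n) (x : elt n) : nat :=
  (\sum_(r <- Phi | pos f r.1)
     `|pairing r.1 x.1 - (if pos f (r.1 *m x.2) then 0 else 1)|)%N.

(* simple reflections S: affine reflections s_{alpha,k} (x |-> s_alpha x + k alpha^v)
   whose hyperplane is a wall of the fundamental alcove, i.e. of length 1 *)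
Definition is_simple_refl n (Phi : seq (rootpair n)) (f : 'cV[int]_n)
    (x : elt n) : Prop :=
  exists r (k : int), [/\ r \in Phi, x = (k *: r.2, reflM r) & alen Phi f x = 1%N].

(* ---------- Laurent polynomials A = Z[v,v^-1]: (k, p) stands for v^-k p(v) *)
Definition laur := (nat * {poly int})%type.

(* An A-algebra structure on a ring H is a central unit v (with inverse vi);
   lev evaluates a Laurent polynomial in H *)
Definition A_alg (H : nzRingType) (v vi : H) : Prop :=
  [/\ v * vi = 1, vi * v = 1 & forall x, v * x = x * v].

Definition lev (H : nzRingType) (v vi : H) (a : laur) : H :=
  vi ^+ a.1 * \sum_(i < size a.2) ((a.2)`_i)%:~R * v ^+ i.

Definition comm_span (H : nzRingType) (v vi : H) (h : H) : Prop :=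
  exists s : seq (laur * H * H),
    h = \sum_(p <- s) lev v vi p.1.1 * (p.1.2 * p.2 - p.2 * p.1.2).

Definition is_IH n (Phi : seq (rootpair n)) (f : 'cV[int]_n)
    (Om : 'M[int]_n -> Prop) (H : nzRingType) (v vi : H) (T : elt n -> H) : Prop :=
  [/\
      forall h : H, exists (s : seq (elt n)) (a : elt n -> laur),
        (forall w, w \in s -> inWt Phi Om w) /\
        h = \sum_(w <- s) lev v vi (a w) * T w,
      forall (s : seq (elt n)) (a : elt n -> laur), uniq s ->
        (forall w, w \in s -> inWt Phi Om w) ->
        \sum_(w <- s) lev v vi (a w) * T w = 0 ->
        forall w, w \in s -> (a w).2 = 0,
      forall x y, inWt Phi Om x -> inWt Phi Om y ->
        alen Phi f (emul x y) = (alen Phi f x + alen Phi f y)%N ->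
        T x * T y = T (emul x y) &
      forall s, is_simple_refl Phi f s -> (T s - v) * (T s + vi) = 0].

(* Main.v *)
From HB Require Import structures.
From mathcomp Require Import all_boot all_order all_algebra.
From mathcomp Require Import complex realalg.
From mathcomp Require Import boolp.
From mathcomp Require Import zify ring lra.
Require Import Defs.
Set Implicit Arguments. Unset Strict Implicit. Unset Printing Implicit Defensive.
Import Order.TTheory GRing.Theory Num.Theory.
Local Open Scope ring_scope.

(* For [w] in the extended affine Weyl group and an alcove [zC], the length of [w^z = z^-1 w z] is the
   number of hyperplanes between [zC] and [wzC], so a conjugacy class is explored by moving alcoves.
   Let [S = w + w^-1], a symmetric operator on directions.  Starting from any alcove, cross walls
   without increasing [len (w^z)] until its closure contains a point of least displacement
   ([w p + w^-1 p = 2 p]), and then, infinitesimally near [p], generic vectors of the eigenspaces of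
   [S] taken by decreasing eigenvalue.  Any two such good alcoves [zC], [z'C] are linked by moves
   lifting to the Hecke algebra: [T] of the two conjugates are intertwined by [T_x n], where
   [x = z^-1 z'] and conjugation by [n] is trivial modulo [(v - v^-1) [H,H]].

   Spanning: along a strict decrease, [T_w = T_{sws} + (v - v^-1) T_{sw}] modulo [[H,H]].
   Independence: put [e_w = T_z^-1 T_r T_z] where [r] is the chosen representative and [w = r^z].
   The moves show that every [y] centralizing [r] lifts to some [T_y n] commuting with [T_r], so every
   commutator is a combination of differences [e_w - e_w'] inside classes, plus an element of
   [(v - v^-1) [H,H]].  Hence the coefficients of a relation [sum a_r T_r in [H,H]] are divisible by
   [v - v^-1], and the quotient is again a relation; iterating, they are divisible by all powers. *)

(** * Euclidean geometry over a real closed field *)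

Section DotProduct.
Variables (R : rcfType) (N : nat).
Implicit Types (x y l : 'rV[R]_N) (U B Q : 'M[R]_N).

Definition dot x y : R := (x *m y^T) 0 0.

Lemma dotE x y : dot x y = \sum_i x 0 i * y 0 i.
Proof. by rewrite /dot mxE; apply: eq_bigr => i _; rewrite mxE. Qed.

Lemma dotC x y : dot x y = dot y x.
Proof. by rewrite !dotE; apply: eq_bigr => i _; rewrite mulrC. Qed.

Lemma dotDl x y l : dot (x + y) l = dot x l + dot y l.
Proof. by rewrite /dot mulmxDl mxE. Qed.

Lemma dotZl a x l : dot (a *: x) l = a * dot x l.
Proof. by rewrite /dot -scalemxAl mxE. Qed.

Lemma dotNl x l : dot (- x) l = - dot x l.
Proof. by rewrite /dot mulNmx mxE. Qed.

Lemma dotBl x y l : dot (x - y) l = dot x l - dot y l.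
Proof. by rewrite dotDl dotNl. Qed.

Lemma dotDr x y l : dot l (x + y) = dot l x + dot l y.
Proof. by rewrite dotC dotDl !(dotC l). Qed.

Lemma dotZr a x l : dot l (a *: x) = a * dot l x.
Proof. by rewrite dotC dotZl (dotC l). Qed.

Lemma dotNr x l : dot l (- x) = - dot l x.
Proof. by rewrite dotC dotNl (dotC l). Qed.

Lemma dotBr x y l : dot l (x - y) = dot l x - dot l y.
Proof. by rewrite dotDr dotNr. Qed.

Lemma dot0l l : dot 0 l = 0.
Proof. by rewrite /dot mul0mx mxE. Qed.

Lemma dot_ge0 x : 0 <= dot x x.
Proof. by rewrite dotE sumr_ge0 // => i _; rewrite -expr2 sqr_ge0. Qed.

Lemma dot_eq0 x : dot x x = 0 -> x = 0.
Proof.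
move=> h; apply/rowP => i; rewrite mxE.
have := h; rewrite dotE => /eqP; rewrite psumr_eq0; last first.
  by move=> j _; rewrite -expr2 sqr_ge0.
by move=> /allP /(_ i (mem_index_enum _)) /implyP /(_ isT); rewrite mulf_eq0 orbb => /eqP.
Qed.

Lemma dot_gt0 x : x != 0 -> 0 < dot x x.
Proof.
by move=> nz; rewrite lt0r dot_ge0 andbT; apply: contra nz => /eqP/dot_eq0 ->.
Qed.

Lemma mulmx_dot x y M : dot (x *m M) y = dot x (y *m M^T).
Proof. by rewrite /dot trmx_mul trmxK mulmxA. Qed.

(** Replaces every appeal to a sufficiently small number. Applied to squares, it also preserves
    nonvanishing. *)
Lemma small_eps (T : eqType) (s : seq T) (f g : T -> R) :
  exists2 e, 0 < e & forall t, t \in s -> 0 < f t -> 0 < f t + e * g t.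
Proof.
(* Validity for all [e' <= e] is what survives taking minima in the induction. *)
suff [e e0 he] : exists2 e, 0 < e & forall e', 0 < e' -> e' <= e ->
    forall t, t \in s -> 0 < f t -> 0 < f t + e' * g t.
  by exists e => // t; apply: he.
elim: s => [|a s [e e0 he]]; first by exists 1.
case: (leP (f a) 0) => [fa|fa].
  exists e => // e' p q t; rewrite inE => /orP[/eqP->|]; last exact: he.
  by rewrite ltNge fa.
have d0 : 0 < f a / (`|g a| + 1) by rewrite divr_gt0 // ltr_wpDl.
exists (Num.min e (f a / (`|g a| + 1))); first by rewrite lt_min e0.
move=> e' p; rewrite le_min => /andP[q1 q2] t; rewrite inE => /orP[/eqP-> _|]; last exact: he.
have h1 : e' * (`|g a| + 1) <= f a by rewrite -ler_pdivlMr // ltr_wpDl.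
have h2 : - `|g a| <= g a by rewrite lerNl -normrN ler_norm.
have : e' * - `|g a| <= e' * g a by rewrite ler_wpM2l // ltW.
rewrite mulrDr mulr1 in h1; rewrite mulrN; lra.
Qed.

(** Hyperplanes are avoided one at a time: a multiple of a vector of [U] off the new one is added,
    too small to reach those already avoided. *)
Lemma generic_dir U (ls : seq 'rV[R]_N) :
  exists2 e, (e <= U)%MS &
    forall l, l \in ls -> dot e l = 0 -> forall x, (x <= U)%MS -> dot x l = 0.
Proof.
elim: ls => [|l ls [e eU he]]; first by exists 0; rewrite ?sub0mx.
have [h|/existsNP[x /not_implyP[xU /eqP lx]]] :=
  pselect (forall x, (x <= U)%MS -> dot x l = 0).
  by exists e => // l'; rewrite inE => /orP[/eqP-> _ //|]; exact: he.
have [d d0 hd] := small_eps ls (fun t => dot e t * dot e t) (fun t => dot e t * dot x t).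
have [/eqP el|el] := boolP (dot e l == 0); last first.
  by exists e => // l'; rewrite inE => /orP[/eqP-> h|]; [rewrite h eqxx in el|exact: he].
exists (e + d *: x); first by rewrite addmx_sub ?scalemx_sub.
move=> l'; rewrite inE => /orP[/eqP->|l'ls].
  rewrite dotDl dotZl el add0r => /eqP; rewrite mulf_eq0 (negPf lx) orbF => /eqP h.
  by rewrite h ltxx in d0.
have [/eqP h _|h] := boolP (dot e l' == 0); first exact: he.
move: (hd _ l'ls); rewrite dotDl dotZl mulrCA -mulrDr => /(_ _)/lt0r_neq0 + e0.
by rewrite e0 mulr0 eqxx => /(_ _) => /implyP; rewrite lt0r -expr2 sqr_ge0 expf_neq0.
Qed.

Lemma perturb U y0 (ps ls : seq 'rV[R]_N) :
  exists y, [/\ (y - y0 <= U)%MS,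
    forall l, l \in ps -> 0 < dot y0 l -> 0 < dot y l &
    forall l, l \in ls -> dot y l = 0 -> forall x, (x <= U)%MS -> dot x l = 0].
Proof.
have [e eU he] := generic_dir U ls.
pose F (p : 'rV[R]_N * bool) := if p.2 then dot y0 p.1 else dot y0 p.1 * dot y0 p.1.
pose G (p : 'rV[R]_N * bool) := if p.2 then dot e p.1 else dot y0 p.1 * dot e p.1.
have [d d0 hd] := small_eps ([seq (l, true) | l <- ps] ++ [seq (l, false) | l <- ls]) F G.
exists (y0 + d *: e); split; first by rewrite addrC addKr scalemx_sub.
  move=> l lps l0; have := hd (l, true); rewrite mem_cat map_f //= /F /G /= dotDl dotZl.
  exact.
move=> l lls; rewrite dotDl dotZl => h0.
apply: he => //; have [/eqP h|h] := boolP (dot y0 l == 0).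
  by move: h0; rewrite h add0r => /eqP; rewrite mulf_eq0 gt_eqF //= => /eqP.
have /= := hd (l, false); rewrite mem_cat map_f // ?orbT /F /G //= mulrCA -mulrDr h0 mulr0 ltxx.
by move=> /(_ isT) /implyP; rewrite lt0r -expr2 sqr_ge0 expf_neq0.
Qed.

Lemma submx_diff m (B : 'M[R]_(m, N)) x y z : (x - z <= B)%MS -> (y - z <= B)%MS -> (x - y <= B)%MS.
Proof. by move=> h1 h2; rewrite -(subrKA z) addmx_sub // -opprB eqmx_opp. Qed.

Lemma submxBC m (B : 'M[R]_(m, N)) x y : (x - y <= B)%MS = (y - x <= B)%MS.
Proof. by rewrite -opprB eqmx_opp. Qed.

(** * Minimising a semidefinite quadratic form over a polyhedron *)

Section QuadraticProgram.
Variables (Q U : 'M[R]_N).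
Hypothesis Qsym : Q^T = Q.
Hypothesis Qpsd : forall x, (x <= U)%MS -> 0 <= dot (x *m Q) x.

Definition qf x y := dot (x *m Q) y.

Lemma qfC x y : qf x y = qf y x.
Proof. by rewrite /qf mulmx_dot Qsym dotC. Qed.

Lemma qfD a x b : qf (x + a *: b) (x + a *: b) = qf x x + a * (2 * qf x b) + a ^+ 2 * qf b b.
Proof.
have E : qf b x = qf x b by apply: qfC.
rewrite /qf mulmxDl -scalemxAl !(dotDl, dotDr, dotZl, dotZr) -!/(qf _ _) E; ring.
Qed.

(** Along [b] the form is affine and bounded below, hence constant; the chosen [a] would give the
    value [-1]. *)
Lemma qf_isotropic x b : (x <= U)%MS -> (b <= U)%MS -> qf b b = 0 -> qf x b = 0.
Proof.
move=> xU bU b0; apply/eqP; apply: contraT => nz.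
pose a := - (qf x x + 1) / (2 * qf x b).
have := Qpsd (addmx_sub xU (scalemx_sub a bU)).
rewrite -/(qf _ _) qfD b0 /a mulfVK ?mulf_neq0 ?pnatr_eq0 // mulr0 addr0; lra.
Qed.

(** The linear system has the possibly singular matrix [B Q B^T]. It is solvable by duality: a
    vector killed by this matrix is isotropic, hence orthogonal to [x0] by [qf_isotropic]. *)
Lemma qf_stationary x0 B : (x0 <= U)%MS -> (B <= U)%MS ->
  exists2 x, (x - x0 <= B)%MS & forall b, (b <= B)%MS -> qf x b = 0.
Proof.
move=> x0U BU.
have /submxP[t ht] : (- (x0 *m Q *m B^T) <= B *m Q *m B^T)%MS.
  rewrite submxE mulNmx oppr_eq0; apply/eqP/rowP => j; rewrite [RHS]mxE.
  set C := cokermx _; pose z := (col j C)^T *m B.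
  have Mc : B *m Q *m B^T *m col j C = 0 by rewrite colE mulmxA mulmx_coker mul0mx.
  have zU : (z <= U)%MS by rewrite (submx_trans (submxMl _ _)).
  have zz : qf z z = 0.
    by rewrite /qf /dot /z !trmx_mul trmxK -!mulmxA !(mulmxA B) !(mulmxA (B *m Q)) Mc mulmx0 mxE.
  have := qf_isotropic x0U zU zz.
  by rewrite /qf /dot /z trmx_mul trmxK colE !mulmxA -colE [LHS]mxE.
exists (x0 + t *m B) => [|b /submxP[t' ->]]; first by rewrite addrC addKr submxMl.
rewrite /qf /dot trmx_mul mulmxA mulmxDl mulmxDl -(mulmxA t) -(mulmxA t) -ht.
by rewrite addrN mul0mx mxE.
Qed.

Lemma qf_min_affine x0 B : (x0 <= U)%MS -> (B <= U)%MS ->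
  exists x, (x - x0 <= B)%MS /\ forall x', (x' - x0 <= B)%MS -> qf x x <= qf x' x'.
Proof.
move=> x0U BU; have [x hx h0] := qf_stationary x0U BU.
exists x; split=> // x' hx'; have h := submx_diff hx' hx.
have -> : x' = x + 1 *: (x' - x) by rewrite scale1r addrC subrK.
by rewrite qfD (h0 _ h) !mulr0 addr0 expr1n mul1r lerDl Qpsd // (submx_trans h).
Qed.

Lemma qf_convex x y a : (x <= U)%MS -> (y <= U)%MS -> qf y y <= qf x x ->
  0 <= a <= 1 -> qf (x + a *: (y - x)) (x + a *: (y - x)) <= qf x x.
Proof.
move=> xU yU yx /andP[a0 a1].
have bU : (y - x <= U)%MS by rewrite addmx_sub ?eqmx_opp.
have := Qpsd bU; rewrite -/(qf _ _); set b := y - x => b0.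
have E : y = x + 1 *: b by rewrite scale1r addrC subrK.
move: yx; rewrite {1 2}E !qfD => h.
have h1 : a * (2 * qf x b + qf b b) <= 0 by rewrite mulr_ge0_le0 //; lra.
have h2 : 0 <= a * (1 - a) * qf b b by rewrite !mulr_ge0 //; lra.
lra.
Qed.

(** Induction on the constraints. If the minimiser [m] for the others violates [c], the segment from
    any feasible point to [m] meets the face [dot _ c = 0] at a feasible point of no larger value,
    by convexity; the search continues in this face. *)
Lemma qf_min_polyhedron (cs : seq 'rV[R]_N) x0 B : (x0 <= U)%MS -> (B <= U)%MS ->
  (forall c, c \in cs -> 0 <= dot x0 c) ->
  exists x, [/\ (x - x0 <= B)%MS, forall c, c \in cs -> 0 <= dot x c &
   forall x', (x' - x0 <= B)%MS -> (forall c, c \in cs -> 0 <= dot x' c) ->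
   qf x x <= qf x' x'].
Proof.
elim: cs x0 B => [|c cs IH] x0 B x0U BU h0.
  have [x [h1 h2]] := qf_min_affine x0U BU; exists x; split=> // x' h _; exact: h2.
have [|m [m1 m2 m3]] := IH x0 B x0U BU.
  by move=> d dcs; apply: h0; rewrite inE dcs orbT.
have inU x : (x - x0 <= B)%MS -> (x <= U)%MS.
  by move=> h; rewrite -(subrK x0 x) addmx_sub // (submx_trans h).
have [mc|mc] := leP 0 (dot m c).
  exists m; split=> //.
    by move=> d; rewrite inE => /orP[/eqP->|/m2].
  by move=> x' h1 h2; apply: m3 => // d dcs; apply: h2; rewrite inE dcs orbT.
have cross x' : (x' - x0 <= B)%MS -> (forall d, d \in c :: cs -> 0 <= dot x' d) ->
    exists y, [/\ (y - x0 <= B)%MS, dot y c = 0, forall d, d \in cs -> 0 <= dot y d &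
       qf y y <= qf x' x'].
  move=> h1 h2; have c0 : 0 <= dot x' c by rewrite h2 ?mem_head.
  pose a := dot x' c / (dot x' c - dot m c).
  have a01 : 0 <= a <= 1.
    by rewrite /a divr_ge0 ?subr_ge0 ?(ltW (lt_le_trans mc c0)) //= ler_pdivrMr ?mul1r; lra.
  exists (x' + a *: (m - x')); split.
  - rewrite addrAC addmx_sub // scalemx_sub //.
    exact: submx_diff m1 h1.
  - by rewrite dotDl dotZl dotBl /a; field; lra.
  - move=> d dcs; have p1 := m2 d dcs.
    have p2 : 0 <= dot x' d by apply: h2; rewrite inE dcs orbT.
    by rewrite dotDl dotZl dotBl; nra.
  - apply: qf_convex => //; try exact: inU.
    by apply: m3 => // d dcs; apply: h2; rewrite inE dcs orbT.
have [y0 [y1 y2 y3 _]] : exists y, [/\ (y - x0 <= B)%MS, dot y c = 0, forall d,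
  d \in cs -> 0 <= dot y d &
       qf y y <= qf x0 x0] by apply: cross => //; rewrite subrr sub0mx.
have BU' : (B :&: kermx c^T <= U)%MS by rewrite (submx_trans (capmxSl _ _)).
have [z [z1 z2 z3]] := IH y0 (B :&: kermx c^T)%MS (inU _ y1) BU' y3.
have zc : dot z c = 0.
  move: z1; rewrite sub_capmx => /andP[_ /sub_kermxP /matrixP/(_ 0 0)].
  by rewrite -/(dot _ _) dotBl y2 subr0 mxE.
exists z; split.
- rewrite -(subrKA y0) addmx_sub //.
  by move: z1; rewrite sub_capmx => /andP[].
- by move=> d; rewrite inE => /orP[/eqP->|/z2 //]; rewrite zc.
- move=> x' h1 h2; have [y [p1 p2 p3 p4]] := cross x' h1 h2.
  apply: le_trans p4; apply: z3 => //.
  rewrite sub_capmx (submx_diff p1 y1) /=.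
  apply/sub_kermxP/matrixP => i j; rewrite !ord1 -/(dot _ _).
  by rewrite dotBl p2 y2 subr0 mxE.
Qed.

End QuadraticProgram.

Lemma orth_proj m (F : 'M[R]_(m, N)) x : exists2 f, (f <= F)%MS & forall g,
  (g <= F)%MS -> dot (x - f) g = 0.
Proof.
have [y _|y y1 y2] := @qf_stationary 1%:M 1%:M (tr_scalar_mx _ _) _ x <<F>>%MS (submx1 _) (submx1 _).
  by rewrite mulmx1 dot_ge0.
exists (x - y) => [|g gF]; first by rewrite submxBC -(genmxE F).
by rewrite opprB addrC subrK; have := y2 g; rewrite genmxE /qf mulmx1; apply.
Qed.

Definition orth m (F : 'M[R]_(m, N)) := kermx F^T.

Lemma orthP m (F : 'M[R]_(m, N)) x : reflect (forall g, (g <= F)%MS -> dot x g = 0) (x <= orth F)%MS.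
Proof.
apply: (iffP sub_kermxP) => [h g /submxP[t ->]|h].
  by rewrite /dot trmx_mul mulmxA h mul0mx mxE.
apply/rowP => j; rewrite [RHS]mxE -(h (row j F) (row_sub _ _)) /dot tr_row.
by rewrite colE mulmxA -colE !mxE.
Qed.

Lemma Re_sum (I : finType) (u : I -> R[i]) (w : I -> R) :
  complex.Re (\sum_i u i * real_complex R (w i)) = \sum_i complex.Re (u i) * w i.
Proof.
elim/big_rec2: _ => // i a b _ <-; case: (u i) => p q; case: b => r s /=.
by rewrite mulr0 subr0.
Qed.

Lemma Im_sum (I : finType) (u : I -> R[i]) (w : I -> R) :
  complex.Im (\sum_i u i * real_complex R (w i)) = \sum_i complex.Im (u i) * w i.
Proof.
elim/big_rec2: _ => // i a b _ <-; case: (u i) => p q; case: b => r s /=.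
by rewrite mulr0 add0r.
Qed.

(** * Real eigenvalues of symmetric operators *)

Section MaxEigenvalue.
Variable S : 'M[R]_N.
Hypothesis Ssym : S^T = S.

(** On a basis of [U] there is an eigenvalue [p + iq] over the algebraically closed [R[i]].
    Symmetry, applied to the real and imaginary parts [X] and [Y] of an eigenvector, gives
    [q (|X|^2 + |Y|^2) = 0]. *)
Lemma eigenvector_exists U : (U *m S <= U)%MS -> U != 0 ->
  exists (l : R) x, [/\ (x <= U)%MS, x != 0 & x *m S = l *: x].
Proof.
move=> US U0; pose B := row_base U.
have r0 : (0 < \rank U)%N by rewrite lt0n mxrank_eq0.
have /submxP[M hM] : (B *m S <= B)%MS.
  by rewrite eq_row_base (submx_trans _ US) // submxMr // eq_row_base.
have [a /eigenvalueP[v hv v0]] := eigenvalue_closed (map_mx (real_complex R) M) r0.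
pose x := map_mx (@complex.Re R) v; pose y := map_mx (@complex.Im R) v.
case: a hv => p q hv.
have hvj j : \sum_k v 0 k * real_complex R (M k j) = (p +i* q)%C * v 0 j.
  by have /rowP/(_ j) := hv; rewrite !mxE => <-; apply: eq_bigr => k _; rewrite mxE.
have xM : x *m M = p *: x - q *: y.
  apply/rowP => j; have := congr1 (@complex.Re R) (hvj j); rewrite Re_sum !mxE.
  by case: (v 0 j) => c d /= <-; apply: eq_bigr => k _; rewrite mxE.
have yM : y *m M = q *: x + p *: y.
  apply/rowP => j; have := congr1 (@complex.Im R) (hvj j); rewrite Im_sum !mxE.
  by case: (v 0 j) => c d /=; rewrite addrC => <-; apply: eq_bigr => k _; rewrite mxE.
pose X := x *m B; pose Y := y *m B.
have XS : X *m S = p *: X - q *: Y by rewrite -mulmxA hM mulmxA xM mulmxBl -!scalemxAl.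
have YS : Y *m S = q *: X + p *: Y by rewrite -mulmxA hM mulmxA yM mulmxDl -!scalemxAl.
have BU : (B <= U)%MS by rewrite eq_row_base.
have XU : (X <= U)%MS by rewrite (submx_trans (submxMl _ _)).
have YU : (Y <= U)%MS by rewrite (submx_trans (submxMl _ _)).
have inj z : z *m B = 0 -> z = 0.
  by move=> h; apply: (row_free_inj (row_base_free U)); rewrite mul0mx.
have nz : (X != 0) || (Y != 0).
  apply: contraNT v0; rewrite negb_or !negbK => /andP[/eqP/inj hx /eqP/inj hy].
  apply/eqP/rowP => j; rewrite mxE; apply/eqP; rewrite eq_complex.
  by have /rowP/(_ j) := hx; have /rowP/(_ j) := hy; rewrite !mxE /= => -> ->; rewrite eqxx.
have q0 : q = 0.
  have := mulmx_dot X Y S; rewrite Ssym XS YS dotBl dotDr !dotZl !dotZr => h.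
  have pos : 0 < dot X X + dot Y Y.
    by case/orP: nz => /dot_gt0 h'; [rewrite ltr_wpDr ?dot_ge0|rewrite ltr_wpDl ?dot_ge0].
  have /eqP : q * (dot X X + dot Y Y) = 0 by rewrite mulrDr; lra.
  by rewrite mulf_eq0 (gt_eqF pos) orbF => /eqP.
rewrite q0 !scale0r subr0 in XS; rewrite q0 !scale0r add0r in YS.
by case/orP: nz => ?; [exists p, X|exists p, Y].
Qed.

(** Splits off one eigenvector: its orthogonal complement is stable, no mixed term appears, and the
    larger of the two eigenvalues bounds the form. *)
Lemma max_eigenvalue U : (U *m S <= U)%MS -> U != 0 ->
  exists (l : R) x, [/\ (x <= U)%MS, x != 0, x *m S = l *: x &
    forall y, (y <= U)%MS -> dot (y *m S) y <= l * dot y y].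
Proof.
have [n] := ubnP (\rank U); elim: n U => // n IH U; rewrite ltnS => rU US U0.
have [a [e [eU e0 eS]]] := eigenvector_exists US U0.
pose U' := (U :&: orth e)%MS.
have U'U : (U' <= U)%MS by apply: capmxSl.
have U'e y : (y <= U')%MS -> dot y e = 0.
  by rewrite sub_capmx => /andP[_ /orthP]; apply.
have dec y : (y <= U)%MS -> exists c y', (y' <= U')%MS /\ y = c *: e + y'.
  move=> yU; have [f /sub_rVP[c ->] hf] := orth_proj e y.
  exists c, (y - c *: e); split; last by rewrite addrC subrK.
  rewrite sub_capmx addmx_sub ?eqmx_opp ?scalemx_sub //=.
  exact/orthP.
have U'S : (U' *m S <= U')%MS.
  rewrite sub_capmx (submx_trans (submxMr _ U'U)) //=.
  apply/row_subP => i; apply/orthP => _ /sub_rVP[c ->].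
  by rewrite row_mul mulmx_dot Ssym -scalemxAl eS !dotZr U'e ?row_sub // !mulr0.
have rk : (\rank U' < n)%N.
  apply: leq_trans rU; rewrite ltn_neqAle mxrankS // andbT.
  apply: contra e0 => h; apply/eqP/dot_eq0/U'e.
  have /eqmxP -> // : (U' == U)%MS by rewrite -(mxrank_leqif_eq U'U).
have expand c y' m : (y' <= U')%MS -> dot (y' *m S) y' <= m * dot y' y' -> a <= m ->
    dot ((c *: e + y') *m S) (c *: e + y') <= m * dot (c *: e + y') (c *: e + y').
  move=> h1 h2 am; rewrite mulmxDl -scalemxAl eS !(dotDl, dotDr, dotZl, dotZr).
  rewrite mulmx_dot Ssym eS !dotZr !(dotC e) (U'e _ h1) !mulr0 !addr0 !add0r.
  have := mulr_ge0 (sqr_ge0 c) (dot_ge0 e); nra.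
have [/eqP U'0|U'0] := boolP (U' == 0).
  exists a, e; split=> // y /dec[c [y' [h ->]]]; apply: expand => //.
  by move: h; rewrite U'0 submx0 => /eqP->; rewrite mul0mx !dot0l mulr0.
have [b [x [h1 h2 h3 h4]]] := IH U' rk U'S U'0.
have [ab|ba] := leP a b.
  exists b, x; split=> //; first exact: submx_trans U'U.
  by move=> y /dec[c [y' [h ->]]]; apply: expand => //; apply: h4.
exists a, e; split=> // y /dec[c [y' [h ->]]]; apply: expand => //.
by apply: le_trans (h4 _ h) _; rewrite ler_wpM2r ?dot_ge0 // ltW.
Qed.

End MaxEigenvalue.

End DotProduct.

(** * Points infinitely near to each other *)

Section Lexicographic.
Variables (R : realDomainType) (T : eqType).
Implicit Types (p q : T -> R) (Y : seq T).

(* A sequence [Y = [:: p0; p1; p2; ...]] stands for the point [p0 + eps p1 + eps^2 p2 + ...] with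
   infinitesimal [eps]. *)
Fixpoint lexgt p Y : bool :=
  if Y is y :: Y' then (0 < p y) || ((p y == 0) && lexgt p Y') else false.

(** The infinitesimal point [Y] lies on the hyperplane [p = 0] to every order. *)
Definition kills p Y := all (fun y => p y == 0) Y.

Definition lexge p Y := lexgt p Y || kills p Y.

Lemma kills_cat p Y1 Y2 : kills p (Y1 ++ Y2) = kills p Y1 && kills p Y2.
Proof. exact: all_cat. Qed.

Lemma kills_rcons p Y y : kills p (rcons Y y) = kills p Y && (p y == 0).
Proof. by rewrite -cats1 kills_cat /= andbT. Qed.

Lemma lexgt_cat p Y1 Y2 : lexgt p (Y1 ++ Y2) = lexgt p Y1 || (kills p Y1 && lexgt p Y2).
Proof.
elim: Y1 => //= y Y1 ->; rewrite -orbA; case: (ltgtP (p y) 0) => //=.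
Qed.

Lemma lexgt_rcons p Y y : lexgt p (rcons Y y) = lexgt p Y || (kills p Y && (0 < p y)).
Proof. by rewrite -cats1 lexgt_cat /= andbF orbF. Qed.

Lemma lexge_cat p Y1 Y2 : lexge p (Y1 ++ Y2) = lexgt p Y1 || (kills p Y1 && lexge p Y2).
Proof. by rewrite /lexge lexgt_cat kills_cat andb_orr orbA. Qed.

Lemma lexge_rcons p Y y : lexge p (rcons Y y) = lexgt p Y || (kills p Y && (0 <= p y)).
Proof. by rewrite -cats1 lexge_cat /lexge /= andbF orbF andbT le_eqVlt (orbC (0 < _)) eq_sym. Qed.

Lemma lexgtW p Y : lexgt p Y -> lexge p Y.
Proof. by rewrite /lexge => ->. Qed.

Lemma eq_lexgt p q Y : {in Y, p =1 q} -> lexgt p Y = lexgt q Y.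
Proof.
elim: Y => //= y Y IH h; rewrite (h _ (mem_head _ _)) IH // => x xY.
by apply: h; rewrite inE xY orbT.
Qed.

Lemma eq_kills p q Y : {in Y, p =1 q} -> kills p Y = kills q Y.
Proof. by move=> h; apply: eq_in_all => y yY; rewrite h. Qed.

Lemma eq_lexge p q Y : {in Y, p =1 q} -> lexge p Y = lexge q Y.
Proof. by move=> h; rewrite /lexge (eq_lexgt h) (eq_kills h). Qed.

Lemma lexgt_kills p Y : lexgt p Y -> ~~ kills p Y.
Proof. by elim: Y => //= y Y IH; case: (ltgtP (p y) 0) => //=. Qed.

Lemma lexgt_add p q Y : lexgt p Y -> lexge q Y -> lexgt (fun y => p y + q y) Y.
Proof.
elim: Y => //= y Y IH; rewrite /lexge /= => /orP[p0|/andP[/eqP p0 pY]].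
  case/orP=> [/orP[q0|/andP[/eqP q0 _]]|/andP[/eqP q0 _]].
  - by rewrite addr_gt0.
  - by rewrite q0 addr0 p0.
  - by rewrite q0 addr0 p0.
rewrite p0 add0r; case/orP=> [/orP[-> //|/andP[-> qY]]|/andP[-> qY]] /=.
  by rewrite IH ?orbT // /lexge qY.
by rewrite IH ?orbT // /lexge qY orbT.
Qed.

Lemma lexgt_scale c p Y : 0 < c -> lexgt (fun y => c * p y) Y = lexgt p Y.
Proof.
by move=> c0; elim: Y => //= y Y ->; rewrite pmulr_rgt0 // mulf_eq0 (gt_eqF c0).
Qed.

Lemma lexgt_opp p Y : lexgt p Y -> lexge (fun y => - p y) Y = false.
Proof.
move=> h; apply/negP => h'; have := lexgt_add h h'.
by elim: Y {h h'} => //= y Y IH; rewrite subrr ltxx eqxx.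
Qed.

End Lexicographic.

Section LexicographicMap.
Variables (R : realDomainType) (T U : eqType).

Lemma lexgt_map (h : U -> T) (p : T -> R) (Y : seq U) :
  lexgt p (map h Y) = lexgt (p \o h) Y.
Proof. by elim: Y => //= y Y ->. Qed.

Lemma kills_map (h : U -> T) (p : T -> R) (Y : seq U) :
  kills p (map h Y) = kills (p \o h) Y.
Proof. by rewrite /kills all_map. Qed.

Lemma lexge_map (h : U -> T) (p : T -> R) (Y : seq U) :
  lexge p (map h Y) = lexge (p \o h) Y.
Proof. by rewrite /lexge lexgt_map kills_map. Qed.

End LexicographicMap.

(* Points of the apartment are written [(wt, values of the roots)], in homogeneous coordinates: [wt]
   is [1] on points and [0] on directions, and [fn i n] is the affine root [alpha_i - n]. *)
Section Points.
Variables (R : rcfType) (m : nat).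
Implicit Types (x y : 'rV[R]_m.+1) (i : 'I_m) (n : int).

Definition wt y : R := y 0 ord0.
Definition co y i : R := y 0 (lift ord0 i).
Definition fn i n y : R := co y i - n%:~R * wt y.

Definition fnv i n : 'rV[R]_m.+1 := delta_mx 0 (lift ord0 i) - n%:~R *: delta_mx 0 ord0.

Lemma dot_delta y j : dot y (delta_mx 0 j) = y 0 j.
Proof. by rewrite /dot trmx_delta -colE mxE. Qed.

Lemma dot_fnv y i n : dot y (fnv i n) = fn i n y.
Proof. by rewrite dotBr dotZr !dot_delta. Qed.

Lemma fnD i n x y : fn i n (x + y) = fn i n x + fn i n y.
Proof. by rewrite -!dot_fnv dotDl. Qed.

Lemma fnZ i n a y : fn i n (a *: y) = a * fn i n y.
Proof. by rewrite -!dot_fnv dotZl. Qed.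

Lemma fnN i n y : fn i n (- y) = - fn i n y.
Proof. by rewrite -!dot_fnv dotNl. Qed.

Lemma wtD x y : wt (x + y) = wt x + wt y.
Proof. by rewrite /wt mxE. Qed.

Lemma wtZ a y : wt (a *: y) = a * wt y.
Proof. by rewrite /wt mxE. Qed.

Lemma wtN y : wt (- y) = - wt y.
Proof. by rewrite /wt mxE. Qed.

Lemma fn_wt0 i n y : wt y = 0 -> fn i n y = co y i.
Proof. by move=> h; rewrite /fn h mulr0 subr0. Qed.

Lemma fn_shift i n n' y : fn i n' y = fn i n y + (n - n')%:~R * wt y.
Proof. rewrite /fn rmorphB /=; ring. Qed.

Lemma point_eq x y : wt x = wt y -> (forall i, co x i = co y i) -> x = y.
Proof.
move=> h1 h2; apply/rowP => j; case: (unliftP ord0 j) => [i ->|->]; last exact: h1.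
exact: h2.
Qed.

Lemma dot_points x y : dot x y = wt x * wt y + \sum_i co x i * co y i.
Proof. by rewrite dotE big_ord_recl. Qed.

Definition amx (s : 'I_m -> 'I_m) (t : 'I_m -> int) : 'M[R]_m.+1 :=
  \matrix_(p, q) if unlift ord0 q is Some i
    then (p == lift ord0 (s i))%:R + (p == ord0)%:R * (t i)%:~R
    else (p == ord0)%:R.

Lemma wt_amx s t y : wt (y *m amx s t) = wt y.
Proof.
rewrite /wt mxE big_ord_recl mxE unlift_none eqxx mulr1 big1 ?addr0 // => i _.
by rewrite mxE unlift_none /= mulr0.
Qed.

Lemma co_amx s t y i : co (y *m amx s t) i = co y (s i) + (t i)%:~R * wt y.
Proof.
rewrite /co mxE big_ord_recl mxE liftK eqxx mul1r add0r mulrC addrC; congr (_ + _).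
rewrite (bigD1 (s i)) //= mxE liftK eqxx mul0r addr0 mulr1 big1 ?addr0 // => j h.
by rewrite mxE liftK (inj_eq lift_inj) (negPf h) mul0r addr0 mulr0.
Qed.

(** This is why points are recorded by root values: the group permutes the coordinates up to
    translation, so the standard product of directions is invariant. *)
Lemma row_amx_isometry s t x y : injective s -> wt x = 0 -> wt y = 0 ->
  dot (x *m amx s t) (y *m amx s t) = dot x y.
Proof.
move=> sI hx hy; rewrite !dot_points !wt_amx hx hy; congr (_ + _).
rewrite [RHS](reindex_inj sI); apply: eq_bigr => i _.
by rewrite !co_amx hx hy !mulr0 !addr0.
Qed.

End Points.

Arguments wt {R m} y.
Arguments co {R m} y i.
Arguments fn {R m} i n y.

(** * Alcoves *)

Section AffineSystem.
Bind Scope group_scope with Group.sort.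
Local Open Scope ring_scope.

(* The extended affine Weyl group seen through its action on affine roots: [sg z i] is the index of
   [z^-1 alpha_i], [tr z i] the value of [alpha_i] on the translation part of [z], [rf i n] the
   reflection in [alpha_i = n], and [Vhat] the space of genuine points among all root values. *)
Record affine_system (R : rcfType) (m : nat) (G : groupType) := AffineSystem {
  sg : G -> 'I_m -> 'I_m;
  tr : G -> 'I_m -> int;
  ps : pred 'I_m;
  negr : 'I_m -> 'I_m;
  rf : 'I_m -> int -> G;
  Vhat : 'M[R]_m.+1;
  c0 : 'rV[R]_m.+1;
  sg1 : forall i, sg 1%g i = i;
  tr1 : forall i, tr 1%g i = 0;
  sgM : forall x y i, sg (x * y)%g i = sg y (sg x i);
  trM : forall x y i, tr (x * y)%g i = tr x i + tr y (sg x i);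
  ngK : involutive negr;
  ps_ng : forall i, ps (negr i) = ~~ ps i;
  sg_ng : forall x i, sg x (negr i) = negr (sg x i);
  tr_ng : forall x i, tr x (negr i) = - tr x i;
  Vh_ng : forall y i, (y <= Vhat)%MS -> co y (negr i) = - co y i;
  Vh_act : forall x (y : 'rV[R]_m.+1), (y <= Vhat)%MS -> (y *m amx R (sg x) (tr x) <= Vhat)%MS;
  sg_rf : forall i n, sg (rf i n) i = negr i;
  tr_rf : forall i n, tr (rf i n) i = n + n;
  rf_fix : forall i n (y : 'rV[R]_m.+1), (y <= Vhat)%MS -> fn i n y = 0 ->
    y *m amx R (sg (rf i n)) (tr (rf i n)) = y;
  rfJ : forall i n z, (rf i n * z = z * rf (sg z i) (n - tr z i))%g;
  rfV : forall i n, (rf i n * rf i n = 1)%g;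
  c0_Vh : (c0 <= Vhat)%MS;
  c0_wt : wt c0 = 1;
  c0_gt0 : forall i, 0 < fn i (if ps i then 0 else -1) c0;
  roots_nonproportional : forall i j (a : R), 0 < a ->
    (forall y : 'rV[R]_m.+1, (y <= Vhat)%MS -> wt y = 0 -> co y j = a * co y i) -> i = j;
  root_neq0 : forall i, exists y : 'rV[R]_m.+1, [/\ (y <= Vhat)%MS, wt y = 0 & co y i != 0]
}.

Variables (R : rcfType) (m : nat) (G : groupType) (A : affine_system R m G).
Implicit Types (x y z w : G) (i j : 'I_m) (p q u : 'rV[R]_m.+1) (Y : seq 'rV[R]_m.+1).

(* The alcove [zC] lies in the strip [strip z i < alpha_i < strip z i + 1]. *)
Definition strip z i : int := tr A z i - (if ps A (sg A z i) then 0 else 1).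
Definition act z p := p *m amx R (sg A z) (tr A z).
(** Nonnegative on the closure of [zC]. *)
Definition wall z i p := fn i (strip z i) p.
Local Notation Vh := (Vhat A).
Local Notation ng := (negr A).

Lemma stripM x z i : strip (x * z)%g i = tr A x i + strip z (sg A x i).
Proof. by rewrite /strip trM sgM addrA. Qed.

Lemma strip1 i : strip 1%g i = if ps A i then 0 else -1.
Proof. by rewrite /strip tr1 sg1; case: ifP. Qed.

Lemma strip_ng z i : strip z (ng i) = - strip z i - 1.
Proof. by rewrite /strip tr_ng sg_ng ps_ng; case: (ps A _) => /=; lia. Qed.

Lemma ng_inj : injective ng. Proof. exact: inv_inj (ngK A). Qed.

Lemma ng_neq i : ng i != i.
Proof. by apply/eqP => h; have := ps_ng A i; rewrite h; case: (ps A i). Qed.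

Lemma sg_inj z : injective (sg A z).
Proof. by apply: (can_inj (g := sg A z^-1)) => i; rewrite -sgM mulgV sg1. Qed.

Lemma co_act z p i : co (act z p) i = co p (sg A z i) + (tr A z i)%:~R * wt p.
Proof. exact: co_amx. Qed.

Lemma wt_act z p : wt (act z p) = wt p.
Proof. exact: wt_amx. Qed.

Lemma actM x y p : act x (act y p) = act (x * y) p.
Proof.
apply: point_eq => [|i]; first by rewrite !wt_act.
rewrite !co_act !wt_act sgM trM rmorphD /=; ring.
Qed.

Lemma act1 p : act 1 p = p.
Proof.
by apply: point_eq => [|i]; rewrite ?wt_act // co_act sg1 tr1 mul0r addr0.
Qed.

Lemma actK z : cancel (act z) (act z^-1).
Proof. by move=> p; rewrite actM mulVg act1. Qed.

Lemma actVK z : cancel (act z^-1) (act z).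
Proof. by move=> p; rewrite actM mulgV act1. Qed.

Lemma act_Vh z p : (p <= Vh)%MS -> (act z p <= Vh)%MS.
Proof. exact: Vh_act. Qed.

Lemma actD z p q : act z (p + q) = act z p + act z q.
Proof. exact: mulmxDl. Qed.

Lemma actB z p q : act z (p - q) = act z p - act z q.
Proof. exact: mulmxBl. Qed.

Lemma actN z p : act z (- p) = - act z p.
Proof. exact: mulNmx. Qed.

Lemma actZ z a p : act z (a *: p) = a *: act z p.
Proof. by rewrite /act scalemxAl. Qed.

Lemma act_isometry z p q : wt p = 0 -> wt q = 0 -> dot (act z p) (act z q) = dot p q.
Proof. exact: (row_amx_isometry _ (@sg_inj z)). Qed.

Lemma act_adjoint z p q : wt p = 0 -> wt q = 0 -> dot (act z p) q = dot p (act z^-1 q).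
Proof. by move=> hp hq; rewrite -{1}(actVK z q) act_isometry ?wt_act. Qed.

Lemma fn_act z i n p : fn i n (act z p) = fn (sg A z i) (n - tr A z i) p.
Proof. rewrite /fn co_act wt_act rmorphB /=; ring. Qed.

Lemma wall_act x z i p : wall (x * z) i (act x p) = wall z (sg A x i) p.
Proof. by rewrite /wall fn_act stripM addrAC subrr add0r. Qed.

Lemma fn_ng i n p : (p <= Vh)%MS -> fn (ng i) (- n) p = - fn i n p.
Proof. by move=> h; rewrite /fn Vh_ng // rmorphN /=; ring. Qed.

Lemma wall_ng z i p : (p <= Vh)%MS -> wall z (ng i) p = wt p - wall z i p.
Proof.
move=> h; rewrite /wall strip_ng (fn_shift _ (- strip z i)) fn_ng //.
have -> : (- strip z i - (- strip z i - 1)) = 1 by lia.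
rewrite mul1r; ring.
Qed.

Definition inVh Y := all (fun p => (p <= Vh)%MS && (0 <= wt p)) Y.

(* The infinitesimal point [Y] lies in the closure of [zC]. *)
Definition compat z Y := [forall i, lexge (wall z i) Y].

Lemma compatP z Y : reflect (forall i, lexge (wall z i) Y) (compat z Y).
Proof. exact: forallP. Qed.

Lemma inVh_wt Y : inVh Y -> lexge wt Y.
Proof.
elim: Y => //= p Y IH /andP[/andP[_ h1] /IH]; rewrite /lexge /=.
by case: ltgtP h1 => //=.
Qed.

Lemma inVh_cat Y1 Y2 : inVh (Y1 ++ Y2) = inVh Y1 && inVh Y2.
Proof. exact: all_cat. Qed.

Lemma inVh_rcons Y p : inVh (rcons Y p) = inVh Y && ((p <= Vh)%MS && (0 <= wt p)).
Proof. by rewrite -cats1 inVh_cat /= andbT. Qed.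

Lemma inVh_act z Y : inVh Y -> inVh (map (act z) Y).
Proof.
by move=> /allP h; apply/allP => _ /mapP[p /h/andP[h1 h2] ->]; rewrite act_Vh // wt_act.
Qed.

Lemma compat_act x z Y : compat z Y -> compat (x * z) (map (act x) Y).
Proof.
move=> /compatP h; apply/compatP => i; rewrite lexge_map.
by rewrite (@eq_lexge _ _ _ (wall z (sg A x i))) // => p _ /=; rewrite wall_act.
Qed.

Lemma compat_catl z Y1 Y2 : compat z (Y1 ++ Y2) -> compat z Y1.
Proof.
move=> /compatP h; apply/compatP => i; have := h i; rewrite lexge_cat /lexge.
by case/orP=> [-> //|/andP[-> _]]; rewrite orbT.
Qed.

Lemma compat_rconsl z Y p : compat z (rcons Y p) -> compat z Y.
Proof. by rewrite -cats1; apply: compat_catl. Qed.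

Lemma lexge_scale_wt (a : int) Y : inVh Y -> 0 <= a -> lexge (fun p => a%:~R * wt p) Y.
Proof.
move=> hY; rewrite le_eqVlt => /orP[/eqP <-|a0].
  by rewrite /lexge; apply/orP; right; apply/allP => p _; rewrite mul0r.
have /orP[h|h] := inVh_wt hY; rewrite /lexge.
  by rewrite lexgt_scale ?ltr0z // h.
by apply/orP; right; apply/allP => p /(allP h)/eqP->; rewrite mulr0.
Qed.

(** The main way to read off strips. If the strip were lower, [fn i n] and the nonnegative
    [wall z (ng i)] would add up to a nonpositive multiple of the weight. *)
Lemma compat_gt_le z Y i n : inVh Y -> compat z Y -> lexgt (fn i n) Y -> n <= strip z i.
Proof.
move=> hY /compatP hc h; rewrite leNgt; apply/negP => lt.
have hn : 0 <= n - strip z i - 1 by lia.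
have := lexgt_opp (lexgt_add h (hc (ng i))).
rewrite (@eq_lexge _ _ _ (fun p => (n - strip z i - 1)%:~R * wt p)) ?lexge_scale_wt // => p pY.
have /andP[pV _] := allP hY p pY.
by rewrite wall_ng // /wall /fn !rmorphB /=; ring.
Qed.

Lemma compat_lt_gt z Y i n : inVh Y -> compat z Y -> lexgt (fun p => - fn i n p) Y -> strip z i < n.
Proof.
move=> hY hc h; have : lexgt (fn (ng i) (- n)) Y.
  by rewrite (@eq_lexgt _ _ _ (fun p => - fn i n p)) // => p /(allP hY)/andP[pV _]; rewrite fn_ng.
by move/(compat_gt_le hY hc); rewrite strip_ng; lia.
Qed.

(* Both [alpha] and [- alpha] contribute, so this is twice the number of separating hyperplanes. *)
Definition dist z z' := (\sum_i `|strip z i - strip z' i|)%N.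
Definition len z := (\sum_(i | ps A i) `|strip z i|)%N.

Lemma distC z z' : dist z z' = dist z' z.
Proof. by apply: eq_bigr => i _; lia. Qed.

Lemma dist_triangle z z' z'' : (dist z z'' <= dist z z' + dist z' z'')%N.
Proof. rewrite -big_split; apply: leq_sum => i _ /=; lia. Qed.

Lemma dist_refl z : dist z z = 0%N.
Proof. by apply: big1 => i _; rewrite subrr. Qed.

Lemma distM x z z' : dist (x * z) (x * z') = dist z z'.
Proof.
rewrite /dist [RHS](reindex_inj (@sg_inj x)); apply: eq_bigr => i _.
by rewrite !stripM; congr `|_|%N; lia.
Qed.

Lemma dist_half z z' : dist z z' = (\sum_(i | ps A i) `|strip z i - strip z' i|)%N.*2.
Proof.
rewrite /dist (bigID (ps A)) /= -addnn; congr addn.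
rewrite (reindex_inj ng_inj) /=; apply: eq_big => i; first by rewrite ps_ng negbK.
by move=> _; rewrite !strip_ng; lia.
Qed.

Lemma dist1 z : dist 1 z = (len z).*2.
Proof.
by rewrite dist_half; congr _.*2; apply: eq_bigr => i h; rewrite strip1 h sub0r abszN.
Qed.

Lemma dist_len z z' : dist z z' = (len (z^-1 * z')).*2.
Proof. by rewrite -dist1 -[RHS](distM z) mulg1 mulVKg. Qed.

Lemma lenV z : len z^-1 = len z.
Proof. by apply: double_inj; rewrite -!dist1 -[LHS](distM z) mulg1 mulgV distC. Qed.

Lemma len_conj w z : (len (w ^ z)).*2 = dist z (w * z).
Proof. by rewrite dist_len /conjg. Qed.

Definition between (a b c : int) := ((a <= b <= c) || (c <= b <= a))%R.

Lemma dist_between z z' z'' : (forall i, between (strip z i) (strip z' i) (strip z'' i)) ->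
  (dist z z'' = dist z z' + dist z' z'')%N.
Proof.
by move=> h; rewrite -big_split; apply: eq_bigr => i _ /=; move: (h i); rewrite /between; lia.
Qed.

Definition simple_refl s := exists i n, s = rf A i n /\ len s = 1%N.

(** The wall is [alpha_i = strip z i], crossed in the direction of decreasing [alpha_i]; all strips
    other than those of [alpha_i] and its opposite are shared. *)
Definition crosses z i z' := exists2 s, simple_refl s & z' = (z * s)%g /\
  forall j, strip z' j = strip z j - (j == i)%:R + (j == ng i)%:R.

Lemma dist_crossing z i z' :
  (forall j, strip z' j = strip z j - (j == i)%:R + (j == ng i)%:R) -> dist z z' = 2%N.
Proof.
move=> h; rewrite /dist (bigD1 i) //= (bigD1 (ng i)) ?ng_neq //= big1.
  rewrite !h !eqxx (negPf (ng_neq i)) eq_sym (negPf (ng_neq i)); lia.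
move=> j /andP[/negPf h1 /negPf h2]; rewrite h h1 h2; lia.
Qed.

Lemma crosses_dist z i z' : crosses z i z' -> dist z z' = 2%N.
Proof. by case=> s _ [_ h]; apply: dist_crossing h. Qed.

Definition V0 := (Vh :&: orth (delta_mx 0 ord0 : 'rV[R]_m.+1))%MS.

Lemma V0P p : reflect ((p <= Vh)%MS /\ wt p = 0) (p <= V0)%MS.
Proof.
rewrite sub_capmx; apply: (iffP andP) => -[h1 h2]; split=> //.
  by move/orthP: h2 => /(_ _ (submx_refl _)); rewrite dot_delta.
by apply/orthP => _ /sub_rVP[c ->]; rewrite dotZr dot_delta -/(wt p) h2 mulr0.
Qed.

Lemma alcove_point z (ls : seq 'rV[R]_m.+1) : exists c, [/\ (c <= Vh)%MS, wt c = 1,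
  forall i, 0 < wall z i c &
  forall l, l \in ls -> dot c l = 0 -> forall p, (p <= V0)%MS -> dot p l = 0].
Proof.
have h0 i : 0 < wall z i (act z (c0 A)).
  by rewrite -[z in wall z]mulg1 wall_act /wall strip1 c0_gt0.
have [c [h1 h2 h3]] := perturb V0 (act z (c0 A)) [seq fnv R i (strip z i) | i <- enum 'I_m] ls.
have /V0P[h4 h5] := h1; exists c; split=> //.
- by rewrite -(subrK (act z (c0 A)) c) addmx_sub // act_Vh // c0_Vh.
- by move: h5; rewrite wtD wtN wt_act c0_wt => /eqP; rewrite subr_eq0 => /eqP.
- move=> i; have ie : i \in enum 'I_m by rewrite mem_enum.
  have := h2 _ (map_f (fun i => fnv R i (strip z i)) ie); rewrite !dot_fnv.
  by apply; apply: h0.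
Qed.

(** A generic point [c] of [zC] moves along [u] until it meets the first wall through [Y].
    Genericity makes this wall unique, and the reflection in it leads to the adjacent alcove. *)
Lemma wall_exists z Y u : inVh Y -> compat z Y -> (u <= Vh)%MS -> 0 <= wt u ->
  (exists i, kills (wall z i) Y && (wall z i u < 0)) ->
  exists i z', [/\ kills (wall z i) Y, wall z i u < 0 & crosses z i z'].
Proof.
have ar (a : int) : - (a - 1) - 1 = - a - 1 - 0 + 1 by lia.
move=> hY hc uV u0 [i0 hi0].
pose f i : 'rV[R]_m.+1 := fnv R i (strip z i).
(* Equal hitting times for [i] and [j] make [c] a zero of this form. By the choice of [c] the form
   then vanishes on all directions, so the two roots are proportional and equal. *)
pose L (ij : 'I_m * 'I_m) := wall z ij.1 u *: f ij.2 - wall z ij.2 u *: f ij.1.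
have [c [cV c1 cpos cgen]] := alcove_point z [seq L ij | ij <- enum {: 'I_m * 'I_m}].
pose X i := kills (wall z i) Y && (wall z i u < 0).
pose t i := wall z i c / - wall z i u.
have [i Xi tmin] : exists2 i, X i & forall j, X j -> t i <= t j.
  have Xi0 : X i0 := hi0; by case: (Order.TotalTheory.arg_minP t Xi0) => i Xi h; exists i.
have [ki ui] := andP Xi.
have tpos j : X j -> 0 < t j by case/andP=> _ h; rewrite divr_gt0 // oppr_gt0.
have tlt j : X j -> j != i -> t i < t j.
  move=> Xj ji; rewrite lt_neqAle tmin // andbT; apply: contra ji => /eqP tt.
  have [_ uj] := andP Xj.
  apply/eqP/esym/(@roots_nonproportional _ _ _ A i j (wall z j u / wall z i u)).
    by rewrite -mulrNN -invrN divr_gt0 // oppr_gt0.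
  move=> y yV y0.
  have ije : (i, j) \in enum {: 'I_m * 'I_m} by rewrite mem_enum.
  have nz : wall z i u != 0 by rewrite lt_eqF.
  have Lc : dot c (L (i, j)) = 0.
    rewrite dotBr !dotZr !dot_fnv /= -!/(wall _ _ _).
    move: tt; rewrite /t => /eqP; rewrite eqr_div ?oppr_eq0 ?(lt_eqF uj) // => /eqP; lra.
  have := cgen _ (map_f L ije) Lc y; rewrite dotBr !dotZr !dot_fnv !(fn_wt0 _ _ y0) /=.
  move=> /(_ (introT (V0P _) (conj yV y0))) h.
  by apply: (mulfI nz); rewrite [RHS]mulrA [_ * (_ / _)]mulrC divfK //; lra.
(* Infinitely near [Y], the point [qs] lies on no hyperplane bounding a strip of [zC] except that of
   [i]. The reflection [r] fixes it, so [z] and [r z] both touch it, which forces their other strips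
   to agree. *)
pose q := c + t i *: u; pose qs := rcons Y q.
have hqs : inVh qs.
  rewrite inVh_rcons hY addmx_sub ?scalemx_sub //= wtD wtZ c1.
  by rewrite addr_ge0 // mulr_ge0 // ltW // tpos.
have bq j : wall z j q = wall z j c + t i * wall z j u by rewrite /wall fnD fnZ.
have kq : kills (wall z i) qs.
  by rewrite kills_rcons ki bq /t invrN mulrN mulNr divfK ?subrr ?eqxx // lt_eqF.
have gq j : j != i -> lexgt (wall z j) qs.
  move=> ji; rewrite lexgt_rcons; have /orP[-> //|kj] := compatP _ _ hc j.
  rewrite kj /=; apply/orP; right; rewrite bq.
  have [uj|uj] := leP 0 (wall z j u).
    by rewrite ltr_wpDr // mulr_ge0 // ltW // tpos.
  have Xj : X j by rewrite /X kj.
  have := tlt j Xj ji; rewrite [in X in _ < X]/t ltr_pdivlMr ?oppr_gt0 //; lra.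
pose r := rf A i (strip z i).
have rq p : p \in qs -> act r p = p.
  by move=> pq; have /andP[pV _] := allP hqs p pq; apply: rf_fix => //; apply/eqP/(allP kq).
have brz j : {in qs, wall (r * z) j =1 wall z (sg A r j)}.
  by move=> p pq; rewrite -{1}(rq p pq) wall_act.
have czq : compat z qs.
  apply/compatP => j; have [->|/gq/lexgtW //] := eqVneq j i.
  by rewrite /lexge kq orbT.
have crq : compat (r * z) qs.
  by apply/compatP => j; rewrite (eq_lexge (brz j)); apply: (compatP _ _ czq).
have sri : sg A r i = ng i by rewrite sg_rf.
have srn : sg A r (ng i) = i by rewrite sg_ng sri ngK.
have kr j : strip (r * z) j = strip z j - (j == i)%:R + (j == ng i)%:R.
  have ki' : strip (r * z) i = strip z i - 1 by rewrite stripM tr_rf sri strip_ng addrA addrK.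
  have [->|ji] := eqVneq j i; first by rewrite eq_sym (negPf (ng_neq i)) ki' addr0.
  have [->|jn] := eqVneq j (ng i); first by rewrite !strip_ng ki' ar.
  rewrite subr0 addr0; apply/eqP; rewrite eq_le; apply/andP; split.
    apply: (compat_gt_le hqs czq); rewrite (eq_lexgt (brz j)) gq //.
    by rewrite -srn (inj_eq (@sg_inj r)).
  by apply: (compat_gt_le hqs crq); apply: gq.
exists i, (r * z)%g; split=> //.
exists (rf A (sg A z i) (strip z i - tr A z i)); last by rewrite -rfJ.
exists (sg A z i), (strip z i - tr A z i); split=> //.
by apply: double_inj; rewrite -[RHS](dist_crossing kr) dist_len rfJ mulKg.
Qed.

Lemma len_simple s : simple_refl s -> len s = 1%N.
Proof. by case=> i [n []]. Qed.

Lemma simple_reflV s : simple_refl s -> (s * s = 1)%g.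
Proof. by case=> i [n [-> _]]; rewrite rfV. Qed.

(** The half distance from [x] to [x * s] is 1, so the length changes by at most 1; it does change
    because each [|a| + |b| + |a - b|] is even. *)
Lemma len_mul_simple x s : simple_refl s ->
  len (x * s) = (len x).+1 \/ (len (x * s)).+1 = len x.
Proof.
move=> /len_simple s1; have hd : dist x (x * s) = 2%N by rewrite dist_len mulKg s1.
have h1 : ((len (x * s)).*2 <= (len x).*2 + 2)%N.
  by rewrite -!dist1 -hd dist_triangle.
have h2 : ((len x).*2 <= (len (x * s)).*2 + 2)%N.
  by rewrite -!dist1 -hd (distC x) dist_triangle.
have h3 : (2 %| len x + len (x * s) + 1)%N.
  have e1 : (\sum_(i | ps A i) `|strip x i - strip (x * s)%g i| = 1)%N.
    by apply: double_inj; rewrite -dist_half hd.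
  rewrite -[X in (_ %| _ + X)%N]e1 -!big_split; apply: dvdn_sum => i _ /=.
  by move: (strip x i) (strip (x * s)%g i) => a b; clear; lia.
by move: h1 h2 h3; move: (len (x * s)) (len x) => a b; clear; lia.
Qed.

Lemma wall1_c0 i : 0 < wall 1 i (c0 A).
Proof. by rewrite /wall strip1 c0_gt0. Qed.

(** Uses [wall_exists] with empty [Y] and the base point as [u]: in homogeneous coordinates
    [c + t c0] runs along the segment from [c] to the base point, so the wall met separates [x] from
    [1]. *)
Lemma descent_exists x : (0 < len x)%N -> exists2 s, simple_refl s & (len (x * s)).+1 = len x.
Proof.
move=> x0.
have [i ki] : exists i, strip 1 i < strip x i.
  apply: contrapT => /forallNP h; move: x0; rewrite -double_gt0 -dist1 /dist big1 // => i _.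
  by have := h i; have := h (ng i); rewrite !strip_ng; lia.
have c1 : 0 <= wt (c0 A) by rewrite c0_wt ler01.
have hc : compat x [::] by apply/compatP.
have hex : exists i, kills (wall x i) [::] && (wall x i (c0 A) < 0).
  exists i => /=; have h := wall1_c0 (ng i).
  have e : wall x i (c0 A) + wall 1 (ng i) (c0 A) = (1 + strip 1 i - strip x i)%:~R.
    rewrite wall_ng ?c0_Vh // /wall /fn !(rmorphD, rmorphN) /= c0_wt; ring.
  have : (1 + strip 1 i - strip x i)%:~R <= 0 :> R by rewrite lerz0; lia.
  lra.
have [i' [x' [_ h [s ss [ex hk]]]]] := @wall_exists x [::] (c0 A) isT hc (c0_Vh A) c1 hex.
have ki' : strip 1 i' < strip x i'.
  rewrite ltNge; apply/negP => le; have h' := wall1_c0 i'.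
  have e : wall x i' (c0 A) = wall 1 i' (c0 A) + (strip 1 i' - strip x i')%:~R.
    rewrite /wall /fn !(rmorphD, rmorphN) /= c0_wt; ring.
  have : 0 <= (strip 1 i' - strip x i')%:~R :> R by rewrite ler0z; lia.
  lra.
exists s => //; rewrite -ex.
have hb : dist 1 x = (dist 1 x' + dist x' x)%N.
  apply: dist_between => j; rewrite hk /between.
  have [->|ji] := eqVneq j i'; first by rewrite eq_sym (negPf (ng_neq i')) /=; lia.
  have [->|jn] := eqVneq j (ng i'); first by rewrite !strip_ng /=; lia.
  by rewrite subr0 addr0 lexx; lia.
by move: hb; rewrite (distC x') (dist_crossing hk) !dist1; lia.
Qed.

(** * Walks across the walls through an infinitesimal point *)

Definition crossing_set z Y u := [set i | kills (wall z i) Y && (wall z i u < 0)].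

Inductive walk Y u : G -> G -> Prop :=
| walk_refl z : walk Y u z z
| walk_step z i z' z'' : compat z Y -> kills (wall z i) Y -> wall z i u < 0 ->
    crosses z i z' -> walk Y u z' z'' -> walk Y u z z''.

Lemma kills_bf_ng z Y i : inVh Y -> lexgt wt Y -> kills (wall z i) Y ->
  ~~ kills (wall z (ng i)) Y.
Proof.
move=> hY hw hk; apply: lexgt_kills; rewrite (@eq_lexgt _ _ _ wt) // => p pY.
have /andP[pV _] := allP hY p pY.
by rewrite wall_ng // (eqP (allP hk p pY)) subr0.
Qed.

Lemma wall_crossing z i z' j p : (forall j, strip z' j = strip z j - (j == i)%:R + (j == ng i)%:R) ->
  wall z' j p = wall z j p + ((j == i)%:R - (j == ng i)%:R) * wt p.
Proof.
move=> h; rewrite /wall h /fn.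
by rewrite !(rmorphD, rmorphN, rmorph_nat) /=; do 2!case: (_ == _) => /=; ring.
Qed.

Lemma compat_crossing z i z' Y : inVh Y -> compat z Y -> kills (wall z i) Y ->
  crosses z i z' -> compat z' Y.
Proof.
move=> hY /compatP hc hk [_ _ [_ h]]; apply/compatP => j.
have [->|ji] := eqVneq j i.
  rewrite (@eq_lexge _ _ _ wt) ?inVh_wt // => p pY.
  by rewrite (wall_crossing _ _ h) (eqP (allP hk p pY)) eqxx eq_sym (negPf (ng_neq i)) subr0 mul1r
    add0r.
have [->|jn] := eqVneq j (ng i).
  apply/orP; right; apply/allP => p pY; rewrite (wall_crossing _ _ h) eqxx (negPf (ng_neq i)).
  have /andP[pV _] := allP hY p pY.
  by rewrite wall_ng // (eqP (allP hk p pY)) subr0 sub0r mulN1r subrr.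
rewrite (@eq_lexge _ _ _ (wall z j)) // => p pY.
by rewrite (wall_crossing _ _ h) (negPf ji) (negPf jn) subr0 mul0r addr0.
Qed.

Lemma crossing_set_crossing z i z' Y u : inVh Y -> lexgt wt Y -> (u <= Vh)%MS -> 0 <= wt u ->
  i \in crossing_set z Y u -> crosses z i z' -> crossing_set z' Y u = crossing_set z Y u :\ i.
Proof.
move=> hY hw uV u0; rewrite inE => /andP[hk hu] [_ _ [_ h]]; apply/setP => j; rewrite !inE.
have [->|ji] := eqVneq j i => /=.
  apply/negP => /andP[/negP h1 _]; apply: h1; apply/negP/lexgt_kills.
  rewrite (@eq_lexgt _ _ _ wt) // => p pY.
  by rewrite (wall_crossing _ _ h) (eqP (allP hk p pY)) eqxx eq_sym (negPf (ng_neq i)) subr0 mul1r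
    add0r.
have [->|jn] := eqVneq j (ng i).
  rewrite (negPf (kills_bf_ng hY hw hk)) /=; apply/negP => /andP[_].
  by rewrite (wall_crossing _ _ h) eqxx (negPf (ng_neq i)) wall_ng // sub0r mulN1r; lra.
congr (_ && _).
  by apply: eq_kills => p pY; rewrite (wall_crossing _ _ h) (negPf ji) (negPf jn) subr0 mul0r addr0.
by rewrite (wall_crossing _ _ h) (negPf ji) (negPf jn) subr0 mul0r addr0.
Qed.

(** Each crossing removes exactly one root from [crossing_set], so the walk ends, at an alcove
    touching [Y] moved infinitesimally along [u]. The strips show that only the hyperplanes of the
    initial set were crossed. *)
Lemma walk_exists z Y u : inVh Y -> lexgt wt Y -> (u <= Vh)%MS -> 0 <= wt u -> compat z Y ->
  exists z', [/\ walk Y u z z', compat z' (rcons Y u) &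
    forall j, strip z' j = strip z j - (j \in crossing_set z Y u)%:R + (ng j \in crossing_set z Y
      u)%:R].
Proof.
move=> hY hw uV u0; have [n] := ubnP #|crossing_set z Y u|; elim: n z => // n IH z.
rewrite ltnS => hn hc.
have [/eqP X0|/set0Pn[i0]] := boolP (crossing_set z Y u == set0).
  exists z; split; first exact: walk_refl.
    apply/compatP => j; rewrite lexge_rcons.
    have /orP[-> //|kj] := compatP _ _ hc j; rewrite kj leNgt.
    by have /setP/(_ j) := X0; rewrite !inE kj /= => ->; rewrite orbT.
  by move=> j; rewrite X0 !inE subr0 addr0.
rewrite inE => hi0.
have [i [z1 [k1 u1 c1]]] := wall_exists hY hc uV u0 (ex_intro _ i0 hi0).
have Xi : i \in crossing_set z Y u by rewrite inE k1.
have X1 := crossing_set_crossing hY hw uV u0 Xi c1.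
have [|z' [h1 h2 h3]] := IH z1 _ (compat_crossing hY hc k1 c1).
  by rewrite X1; apply: leq_trans hn; rewrite [leqRHS](cardsD1 i) Xi.
exists z'; split=> //; first exact: (walk_step hc k1 u1 c1 h1).
move=> j; rewrite h3 X1 !in_setD1; case: c1 => _ _ [_ ->].
have <- : (ng j == i) = (j == ng i) by rewrite -(inj_eq ng_inj) ngK.
have [->|_] := eqVneq j i.
  have [e|_] /= := eqVneq (ng i) i; first by have := ng_neq i; rewrite e eqxx.
  by rewrite Xi; case: (_ \in _) => /=; clear; lia.
have [->|_] /= := eqVneq (ng j) i; rewrite ?Xi; do ?case: (_ \in _) => /=; clear; lia.
Qed.

End AffineSystem.

(** * Linking good alcoves *)

Section Conjugation.
Variables (R : rcfType) (m : nat) (G : groupType) (A : affine_system R m G) (w : G).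
Implicit Types (x y z : G) (i j : 'I_m) (p q u : 'rV[R]_m.+1) (Y : seq 'rV[R]_m.+1).
Implicit Types (U F : 'M[R]_m.+1) (Fs : seq 'M[R]_m.+1).
Local Notation Vh := (Vhat A).
Local Notation ng := (negr A).
Local Notation strip := (strip A).
Local Notation wall := (wall A).
Local Notation act := (act A).
Local Notation compat := (compat A).
Local Notation dist := (dist A).
Local Notation inVh := (inVh A).
Local Notation V0 := (V0 A).
Local Notation crossing_set := (crossing_set A).

Inductive red : G -> G -> Prop :=
| red_refl z : red z z
| red_step z s z' : simple_refl A s -> (len A (w ^ (z * s)) <= len A (w ^ z))%N ->
    red (z * s)%g z' -> red z z'.

(** With [x = z^-1 z'], [eqv_shift] says that [w ^ z = x y] and [w ^ z' = y x] with lengths adding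
    up, a cyclic shift; [eqv_strong] says that lengths add up on both sides of
    [(w ^ z) x = x (w ^ z')]. *)
Inductive eqv : G -> G -> Prop :=
| eqv_shift z z' : (dist z (w * z) = dist z z' + dist z' (w * z))%N ->
    (dist z' (w * z') = dist z' (w * z) + dist (w * z) (w * z'))%N -> eqv z z'
| eqv_strong z z' : (dist z (w * z') = dist z (w * z) + dist (w * z) (w * z'))%N ->
    (dist z (w * z') = dist z z' + dist z' (w * z'))%N -> eqv z z'
| eqv_sym z z' : eqv z z' -> eqv z' z
| eqv_trans z z' z'' : eqv z z' -> eqv z' z'' -> eqv z z''.

Section Crossing.
Variables (X : {set 'I_m}) (z z' : G).
Hypothesis hz' : forall j, strip z' j = strip z j - (j \in X)%:R + (ng j \in X)%:R.

(** All hyperplanes of [X] separate [z] from [t], so crossing them begins a shortest gallery to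
    [t]. *)
Lemma dist_before t : (forall i, i \in X -> strip t i < strip z i) ->
  (dist z t = dist z z' + dist z' t)%N.
Proof.
move=> h; apply: dist_between => j; rewrite hz' /between.
have h1 := h j; have h2 := h (ng j); rewrite !strip_ng in h2.
by case: (j \in X) h1 => h1; case: (ng j \in X) h2 => h2 /=; try have {}h1 := h1 isT;
  try have {}h2 := h2 isT; lia.
Qed.

Lemma dist_after t : (forall i, i \in X -> strip z i <= strip t i) ->
  (dist t z' = dist t z + dist z z')%N.
Proof.
move=> h; apply: dist_between => j; rewrite hz' /between.
have h1 := h j; have h2 := h (ng j); rewrite !strip_ng in h2.
by case: (j \in X) h1 => h1; case: (ng j \in X) h2 => h2 /=; try have {}h1 := h1 isT;
  try have {}h2 := h2 isT; lia.
Qed.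

Lemma distMr t t' : dist t (w * t') = dist (w^-1 * t) t'.
Proof. by rewrite -(distM A w (w^-1 * t)) mulVKg. Qed.

Lemma eqv_forward : (forall i, i \in X -> strip (w * z)%g i < strip z i) ->
  (forall i, i \in X -> strip z i <= strip (w^-1 * z')%g i) -> eqv z z'.
Proof.
move=> h1 h2; apply: eqv_shift; first exact: dist_before.
by rewrite distM !distMr (dist_after h2).
Qed.

Lemma eqv_backward : (forall i, i \in X -> strip (w^-1 * z)%g i < strip z i) ->
  (forall i, i \in X -> strip z i <= strip (w * z')%g i) -> eqv z z'.
Proof.
move=> h1 h2; apply/eqv_sym/eqv_shift.
  by rewrite distC (dist_after h2) addnC; congr addn; apply: distC.
by rewrite distM !distMr distC (dist_before h1) addnC; congr addn; apply: distC.
Qed.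

(** Here [w] respects the sides of the walls of [X]: [w^-1 z] stays on the side of [z], and [w z']
    on that of [z']. *)
Lemma eqv_parallel : (forall i, i \in X -> strip z i <= strip (w^-1 * z)%g i) ->
  (forall i, i \in X -> strip (w * z')%g i < strip z i) -> eqv z z'.
Proof.
move=> h1 h2; apply: eqv_strong; last exact: dist_before.
by rewrite distM !distMr (dist_after h1).
Qed.

(** If [w z] lies beyond the wall, [z'] is on a shortest gallery from [z] to [w z], and the detour
    from [w z] to [w z'] costs no more than the gain from [z] to [z']. *)
Lemma len_conj_crossing : dist z z' = 2%N ->
  (forall i, i \in X -> strip (w * z)%g i < strip z i) \/
  (forall i, i \in X -> strip (w^-1 * z)%g i < strip z i) ->
  (len A (w ^ z') <= len A (w ^ z))%N.
Proof.
move=> d2 h; rewrite -leq_double !len_conj; case: h => h.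
  rewrite (dist_before h) addnC; apply: leq_trans (dist_triangle A _ (w * z) _) _.
  by rewrite distM.
rewrite !distMr (distC A _ z) (dist_before h).
apply: leq_trans (dist_triangle A _ (w^-1 * z) _) _.
by rewrite distM (distC A z') (distC A z') leqnn.
Qed.

End Crossing.

Lemma len_conj_crosses z i z' : crosses A z i z' ->
  strip (w * z)%g i < strip z i \/ strip (w^-1 * z)%g i < strip z i ->
  (len A (w ^ z') <= len A (w ^ z))%N.
Proof.
move=> c h; apply: (@len_conj_crossing [set i]) (crosses_dist c) _.
  by case: c => _ _ [_ c] j; rewrite c !inE -[ng j == i](inj_eq (@ng_inj _ _ _ A)) ngK.
by case: h => h; [left|right] => j; rewrite inE => /eqP->.
Qed.

Lemma strip_act_ge x z Y i n : inVh Y -> compat z Y -> lexgt (fun p => fn i n (act x p)) Y ->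
  n <= strip (x * z)%g i.
Proof.
move=> hY hc h; apply: (compat_gt_le (inVh_act x hY) (compat_act x hc)).
by rewrite lexgt_map.
Qed.

Lemma strip_act_lt x z Y i n : inVh Y -> compat z Y -> lexgt (fun p => - fn i n (act x p)) Y ->
  strip (x * z)%g i < n.
Proof.
move=> hY hc h; apply: (compat_lt_gt (inVh_act x hY) (compat_act x hc)).
by rewrite lexgt_map.
Qed.

Lemma dist_eq0 z z' : dist z z' = 0%N -> strip z =1 strip z'.
Proof.
move=> /eqP; rewrite sum_nat_eq0 => /forallP h i; have := h i; rewrite absz_eq0 subr_eq0.
by move/eqP.
Qed.

(** A parallel hyperplane that does not bound the strip stays at positive distance from the closure
    of [zC]. *)
Lemma kills_tight z Y i n : inVh Y -> lexgt wt Y -> compat z Y -> kills (fn i n) Y ->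
  n = strip z i \/ n = strip z i + 1.
Proof.
move=> hY hw hc hk.
have nk (g : 'rV[R]_m.+1 -> R) (h : lexgt g Y) : {in Y, g =1 fn i n} -> False.
  by move=> e; move: (lexgt_kills h); rewrite (eq_kills e) hk.
have nk' (g : 'rV[R]_m.+1 -> R) (h : lexgt g Y) : {in Y, g =1 fun p => - fn i n p} -> False.
  move=> e; move: (lexgt_kills h); rewrite (eq_kills e) => /negP; apply.
  by apply/allP => p pY; rewrite (eqP (allP hk p pY)) oppr0.
have h1 : strip z i <= n.
  rewrite leNgt; apply/negP => lt.
  have pos : (0 : R) < (strip z i - n)%:~R by rewrite ltr0z subr_gt0.
  have := lexgt_add (_ : lexgt (fun p => (strip z i - n)%:~R * wt p) Y) (compatP _ _ _ hc i).
  rewrite lexgt_scale // => /(_ hw) /nk; apply => p _.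
  by rewrite (fn_shift _ (strip z i)) addrC.
have h2 : n <= strip z i + 1.
  rewrite leNgt; apply/negP => lt.
  have pos : (0 : R) < (n - strip z i - 1)%:~R by rewrite ltr0z; lia.
  have := lexgt_add (_ : lexgt (fun p => (n - strip z i - 1)%:~R * wt p) Y) (compatP _ _ _ hc (ng i)).
  rewrite lexgt_scale // => /(_ hw) /nk'; apply => p /(allP hY)/andP[pV _].
  rewrite wall_ng // /wall /fn !rmorphB /=; ring.
lia.
Qed.

Definition generic Y F p := forall i n, kills (fn i n) Y -> fn i n p = 0 ->
  forall f, (f <= F)%MS -> fn i n f = 0.

(* The closure of [zC] contains an infinitesimal point that extends [Y] by one vector of each space of
   [Fs], chosen off every wall that does not contain this space. *)
Fixpoint good Y Fs z : Prop :=
  if Fs is F :: Fs' then exists p, [/\ (p <= F)%MS, wt p = (nilp Y)%:R, generic Y F p &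
    good (rcons Y p) Fs' z]
  else compat z Y.

Lemma good_compat Y Fs z : good Y Fs z -> compat z Y.
Proof.
by elim: Fs Y => //= F Fs IH Y [p [_ _ _ /IH]]; apply: compat_rconsl.
Qed.

(** Goodness depends only on which hyperplanes contain the infinitesimal point and on which side of
    these the alcove lies; the same later vectors serve for both. *)
Lemma good_change Fs Y1 Y2 z1 z2 : good Y1 Fs z1 -> nilp Y1 = nilp Y2 ->
  (forall i n, kills (fn i n) Y1 = kills (fn i n) Y2) -> compat z2 Y2 ->
  (forall i, kills (wall z2 i) Y2 -> strip z2 i = strip z1 i) -> good Y2 Fs z2.
Proof.
elim: Fs Y1 Y2 => //= F Fs IH Y1 Y2 [p [h1 h2 h3 h4]] e0 e1 c2 e2.
exists p; split=> //; first by rewrite -e0.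
  by move=> i n; rewrite -e1; apply: h3.
apply: (IH (rcons Y1 p) (rcons Y2 p) h4).
- by rewrite /nilp !size_rcons.
- by move=> i n; rewrite !kills_rcons e1.
- apply/compatP => i; rewrite lexge_rcons.
  have /orP[-> //|ki] := compatP _ _ _ c2 i; rewrite ki /=.
  have := compatP _ _ _ (good_compat h4) i; rewrite lexge_rcons /wall -(e2 _ ki) e1.
  rewrite -/(wall z2 i p) [kills _ Y2]ki /= => /orP[/lexgt_kills|->]; last by rewrite orbT.
  by rewrite e1 [kills _ Y2]ki.
- by move=> i; rewrite kills_rcons => /andP[/e2].
Qed.

(** On a hyperplane through [Y], all orders recorded so far then leave the sides of [w z] and
    [w^-1 z] undecided, and the next vector decides. *)
Definition nice Y := forall i n, kills (fn i n) Y -> forall p, p \in Y ->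
  fn i n (act w p) = 0 /\ fn i n (act w^-1 p) = 0.

(** Level [false] is meant for the span of the points of least displacement, level [true] for an
    eigenspace of directions. *)
Definition level (b : bool) F (lam : R) :=
  [/\ (F <= Vh)%MS, forall f, (f <= F)%MS -> (act w f <= F)%MS /\ (act w^-1 f <= F)%MS,
      forall f, (f <= F)%MS -> act w f + act w^-1 f = lam *: f &
      if b then lam < 2 /\ (F <= V0)%MS else lam = 2].

Lemma vanish_affine F p (l : 'rV[R]_m.+1) : (F <= Vh)%MS -> (F <= V0)%MS \/ wt p = 1 ->
  (p <= F)%MS -> dot p l = 0 -> (forall q, (q <= F :&: V0)%MS -> dot q l = 0) ->
  forall f, (f <= F)%MS -> dot f l = 0.
Proof.
move=> FV h pF pl hl f fF; case: h => h.
  by apply: hl; rewrite sub_capmx fF (submx_trans fF).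
have -> : f = (f - wt f *: p) + wt f *: p by rewrite subrK.
rewrite dotDl dotZl pl mulr0 addr0; apply: hl.
have fpF : (f - wt f *: p <= F)%MS by rewrite addmx_sub // eqmx_opp scalemx_sub.
rewrite sub_capmx fpF; apply/V0P; split; first exact: submx_trans FV.
by rewrite wtD wtN wtZ h mulr1 subrr.
Qed.

(** [|w p - p|^2 = 2 |p|^2 - <w p + w^-1 p, p>]. *)
Lemma act_fixed p : wt p = 0 -> act w p + act w^-1 p = 2 *: p ->
  act w p = p /\ act w^-1 p = p.
Proof.
move=> p0 h.
have hw : act w p = p.
  apply/eqP; rewrite -subr_eq0; apply/eqP/dot_eq0.
  have := congr1 (fun v => dot v p) h; rewrite dotDl dotZl (act_adjoint _ w^-1) // invgK.
  rewrite (dotC p (act w p)) => h'.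
  by rewrite dotBl !dotBr act_isometry // (dotC p (act w p)); lra.
by split=> //; rewrite -{1}hw actK.
Qed.

Lemma lexgt_last (g : 'rV[R]_m.+1 -> R) Y p : kills g Y -> 0 < g p -> lexgt g (rcons Y p).
Proof. by rewrite lexgt_rcons => -> ->; rewrite orbT. Qed.

Lemma kills_opp (g : 'rV[R]_m.+1 -> R) Y : kills (fun p => - g p) Y = kills g Y.
Proof. by apply: eq_all => p; rewrite oppr_eq0. Qed.

(** * One crossing on the way from one good alcove to another *)

Section CrossStep.
Variables (Y : seq 'rV[R]_m.+1) (F : 'M[R]_m.+1) (lam : R).
Hypothesis hY : inVh Y.
Hypothesis hwt : nilp Y \/ lexgt wt Y.
Hypothesis hnice : nice Y.
Hypothesis hF : level (~~ nilp Y) F lam.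

Lemma F_Vh : (F <= Vh)%MS. Proof. by case: hF. Qed.

Lemma F_full p : wt p = (nilp Y)%:R -> (F <= V0)%MS \/ wt p = 1.
Proof. by case: hF => _ _ _; case: nilp => /=; [right|case; left]. Qed.

Lemma inVh_rcons_F p : (p <= F)%MS -> 0 <= wt p -> inVh (rcons Y p).
Proof. by move=> pF p0; rewrite inVh_rcons hY p0 (submx_trans pF F_Vh). Qed.

Lemma lexgt_wt_rcons p : wt p = (nilp Y)%:R -> lexgt wt (rcons Y p).
Proof.
rewrite lexgt_rcons => ->; case: hwt => h; last by rewrite h.
by rewrite h ltr01 (nilP h) orbT.
Qed.

Variables (z z' : G) (y y' : 'rV[R]_m.+1).
Hypotheses (yF : (y <= F)%MS) (y'F : (y' <= F)%MS).
Hypotheses (wty : wt y = (nilp Y)%:R) (wty' : wt y' = (nilp Y)%:R).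
Hypotheses (geny : generic Y F y) (geny' : generic Y F y').
Hypotheses (cy : compat z (rcons Y y)) (cy' : compat z' (rcons Y y')).
Hypothesis hex : exists i, kills (wall z i) Y && (wall z i y' < 0).

(** These forms and the [Dw i] vanish at [y]. A further zero on a segment from [y] expresses that
    two walls, or a wall and its image under [w], meet the segment at the same place. For a generic
    target this happens only when the functions are proportional on all of [F]. *)
Let D (ij : 'I_m * 'I_m) : 'rV[R]_m.+1 :=
  wall z ij.1 y *: fnv R ij.2 (strip z ij.2) - wall z ij.2 y *: fnv R ij.1 (strip z ij.1).

Let Dw i : 'rV[R]_m.+1 :=
  wall z i y *: fnv R (sg A w i) (strip z i - tr A w i) - wall z i (act w y) *: fnv R i (strip z i).

Lemma dot_D ij p : dot p (D ij) = wall z ij.1 y * wall z ij.2 p - wall z ij.2 y * wall z ij.1 p.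
Proof. by rewrite dotBr !dotZr !dot_fnv. Qed.

Lemma dot_Dw i p : dot p (Dw i) = wall z i y * wall z i (act w p) - wall z i (act w y) * wall z i p.
Proof. by rewrite dotBr !dotZr !dot_fnv -fn_act. Qed.

(** [y'] moves so little within [F] that [z'] still touches it and some wall is still crossed: a
    wall through [Y] and [y'] contains [F], since [y'] is generic. *)
Lemma perturb_target : exists p2, [/\ (p2 <= F)%MS, wt p2 = (nilp Y)%:R,
  compat z' (rcons Y p2), exists i, kills (wall z i) Y && (wall z i p2 < 0) &
  forall l, l \in [seq D ij | ij <- enum {: 'I_m * 'I_m}] ++ [seq Dw i | i <- enum 'I_m] ->
    dot p2 l = 0 -> forall f, (f <= F)%MS -> dot f l = 0].
Proof.
have [i0 /andP[k0 n0]] := hex.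
have [p2 [h1 h2 h3]] := perturb (F :&: V0)%MS y'
  (- fnv R i0 (strip z i0) :: [seq fnv R i (strip z' i) | i <- enum 'I_m])
  ([seq D ij | ij <- enum {: 'I_m * 'I_m}] ++ [seq Dw i | i <- enum 'I_m]).
move: h1; rewrite sub_capmx => /andP[dF /V0P[_ d0]].
have y2F : (p2 <= F)%MS by rewrite -(subrK y' p2) addmx_sub.
have wt2 : wt p2 = (nilp Y)%:R.
  by move/eqP: d0; rewrite wtD wtN subr_eq0 => /eqP->.
exists p2; split=> //.
- apply/compatP => i; rewrite lexge_rcons.
  have := compatP _ _ _ cy' i; rewrite lexge_rcons => /orP[-> //|/andP[ki]].
  rewrite ki /= le_eqVlt => /orP[/eqP e|p0]; apply/orP; right.
    by rewrite /wall (geny' ki (esym e)).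
  have ie : i \in enum 'I_m by rewrite mem_enum.
  have := h2 (fnv R i (strip z' i)); rewrite inE (map_f (fun i => fnv R i (strip z' i)) ie) orbT.
  by rewrite !dot_fnv => /(_ isT p0)/ltW.
- exists i0; rewrite k0 /=; have := h2 _ (mem_head _ _).
  by rewrite !dotNr !dot_fnv !oppr_gt0; apply.
- move=> l lls l0 f fF; apply: (vanish_affine F_Vh (F_full wt2) y2F l0) => // q qF.
  exact: h3.
Qed.

(** The segment from [y] to [p2] is followed to the first point [q] on a wall that it crosses, and
    the walls of [X] are crossed there. They are proportional on [F], so one of them decides for
    all: the sign of its value [c] at [w q] selects the kind of move. *)
Lemma cross_step Fs : good (rcons Y y) Fs z -> exists z1 p1,
  [/\ (p1 <= F)%MS, wt p1 = (nilp Y)%:R, generic Y F p1, good (rcons Y p1) Fs z1 &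
   eqv z z1 /\ (dist z1 z' < dist z z')%N].
Proof.
move=> gy; have [p2 [y2F wt2 cy2 [i0 hi0] hD]] := perturb_target.
pose e := p2 - y.
have eF : (e <= F)%MS by rewrite addmx_sub // eqmx_opp.
have wte : wt e = 0 by rewrite wtD wtN wt2 wty subrr.
have eV : (e <= Vh)%MS := submx_trans eF F_Vh.
have ypos j : kills (wall z j) Y -> 0 <= wall z j y.
  move=> kj; have := compatP _ _ _ cy j; rewrite lexge_rcons => /orP[/lexgt_kills|/andP[]//].
  by rewrite kj.
have ygt j : kills (wall z j) Y -> wall z j p2 < 0 -> 0 < wall z j y.
  move=> kj n2; rewrite lt0r ypos // andbT; apply: contraTneq n2 => e0.
  by rewrite -leNgt /wall (geny kj e0).
pose t j := wall z j y / (wall z j y - wall z j p2).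
pose J j := kills (wall z j) Y && (wall z j p2 < 0).
have [i1 Ji1 tmin] : exists2 i, J i & forall j, J j -> t i <= t j.
  have Ji0 : J i0 := hi0.
  by case: (Order.TotalTheory.arg_minP t Ji0) => i Xi h; exists i.
have tt j : J j -> 0 < t j < 1.
  case/andP=> kj n2; have := ygt j kj n2 => p0; rewrite /t divr_gt0 ?ltr_pdivrMr; lra.
have /andP[t0 t1] := tt _ Ji1; set t1' := t i1 in tmin t0 t1.
pose q := y + t1' *: e.
have qF : (q <= F)%MS by rewrite addmx_sub ?scalemx_sub.
have wtq : wt q = (nilp Y)%:R by rewrite wtD wtZ wte mulr0 addr0.
have bq j : wall z j q = wall z j y + t1' * wall z j e by rewrite /wall fnD fnZ.
have be j : wall z j e = wall z j p2 - wall z j y by rewrite /wall fnD fnN.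
have qpos j : kills (wall z j) Y -> 0 <= wall z j q.
  move=> kj; rewrite bq be; have y0 := ypos j kj.
  have [pp2|n2] := leP 0 (wall z j p2).
    have := mulr_ge0 (ltW t0) pp2; have := mulr_ge0 (_ : 0 <= 1 - t1') y0; rewrite subr_ge0.
    by move=> /(_ (ltW t1)); lra.
  have Jj : J j by rewrite /J kj.
  have := tmin j Jj; rewrite /t ler_pdivlMr; last by lra.
  lra.
have cq : compat z (rcons Y q).
  apply/compatP => j; rewrite lexge_rcons.
  by have := compatP _ _ _ cy j; rewrite lexge_rcons => /orP[->//|/andP[kj _]]; rewrite kj qpos ?orbT.
have iq : inVh (rcons Y q) by apply: inVh_rcons_F; rewrite // wtq ler0n.
have wq := lexgt_wt_rcons wtq.
have wte0 : 0 <= wt e by rewrite wte.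
have [z1 [_ c1 k1]] := walk_exists iq wq eV wte0 cq.
set X := crossing_set z (rcons Y q) e in k1.
have XP j : j \in X -> [/\ kills (wall z j) Y, wall z j q = 0 & wall z j e < 0].
  by rewrite inE kills_rcons => /andP[/andP[h1 /eqP h2] h3].
have [ki1 n1] := andP Ji1.
have Xi1 : i1 \in X.
  have y1 := ygt _ ki1 n1; rewrite inE kills_rcons ki1 be subr_lt0 (lt_trans n1) // andbT /=.
  by rewrite bq be /t1' /t; apply/eqP; field; lra.
have Xy j : j \in X -> wall z j y = - (t1' * wall z j e).
  by move=> /XP[_ h _]; move: h; rewrite bq; lra.
have Xp2 j : j \in X -> wall z j p2 = (1 - t1') * wall z j e.
  by move=> jX; have := Xy j jX; have := be j; lra.
have dlt : (dist z1 z' < dist z z')%N.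
  rewrite (dist_before k1 (t := z')); last first.
    move=> j jX; have [kj _ ej] := XP j jX.
    apply: (compat_lt_gt (inVh_rcons_F y2F _) cy2); first by rewrite wt2 ler0n.
    apply: lexgt_last; first by rewrite kills_opp.
    by rewrite -/(wall z j p2) (Xp2 j jX) -mulrN mulr_gt0 ?subr_gt0 ?oppr_gt0.
  rewrite -[ltnLHS]add0n ltn_add2r lt0n; apply/negP => /eqP/dist_eq0/(_ i1).
  have nX : ng i1 \notin X.
    have [kY /eqP q0 _] := XP _ Xi1.
    have kX : kills (wall z i1) (rcons Y q) by rewrite kills_rcons kY.
    by rewrite /X inE negb_and (kills_bf_ng iq wq kX).
  by rewrite k1 Xi1 (negPf nX); move: (strip z i1) => a; clear; lia.
have prop j : j \in X -> exists2 r, 0 < r & forall f, (f <= F)%MS -> wall z j f = r * wall z i1 f.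
  move=> jX; have [kj _ ej] := XP j jX; have [_ _ e1] := XP _ Xi1.
  have y1 : 0 < wall z i1 y by exact: ygt.
  have yj : 0 < wall z j y by rewrite Xy // oppr_gt0 pmulr_rlt0.
  exists (wall z j y / wall z i1 y); first exact: divr_gt0.
  move=> f fF; have ije : (i1, j) \in enum {: 'I_m * 'I_m} by rewrite mem_enum.
  have mD : D (i1, j) \in [seq D ij | ij <- enum {: 'I_m * 'I_m}] ++ [seq Dw i | i <- enum 'I_m].
    by rewrite mem_cat (map_f D ije).
  have D0 : dot p2 (D (i1, j)) = 0.
    by rewrite dot_D /= (Xp2 j) // (Xp2 i1) // (Xy j) // (Xy i1) //; ring.
  have := hD _ mD D0 f fF; rewrite dot_D /= => h.
  apply: (mulfI (lt0r_neq0 y1)); rewrite [RHS]mulrA [_ * (_ / _)]mulrC divfK ?lt0r_neq0 //; lra.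
have [_ winv wlam lamP] := hF.
have [wqF wVqF] := winv _ qF; have [weF wVeF] := winv _ eF.
have [k1' q1' e1'] := XP _ Xi1.
pose c := wall z i1 (act w q).
(* [w q + w^-1 q] is a multiple of [q], where the wall function is zero. *)
have cV : wall z i1 (act w^-1 q) = - c.
  have := congr1 (wall z i1) (wlam _ qF); rewrite /wall fnD fnZ -!/(wall _ _ _) q1' mulr0 /c; lra.
have kw j : kills (wall z j) Y -> kills (fun p => fn j (strip z j) (act w p)) Y.
  by move=> kj; apply/allP => p pY; have [-> _] := hnice kj pY.
have kwV j : kills (wall z j) Y -> kills (fun p => fn j (strip z j) (act w^-1 p)) Y.
  by move=> kj; apply/allP => p pY; have [_ ->] := hnice kj pY.
have c1q := compat_rconsl c1.
(* [- e] and [e] give the infinitesimal points just before and just after [q]; the first is in the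
   closure of [z], the second in that of [z1]. *)
have im : inVh (rcons (rcons Y q) (- e)).
  by rewrite inVh_rcons iq eqmx_opp eV wtN wte oppr0 lexx.
have ie : inVh (rcons (rcons Y q) e) by rewrite inVh_rcons iq eV wte lexx.
have cm : compat z (rcons (rcons Y q) (- e)).
  apply/compatP => j; rewrite lexge_rcons.
  have /orP[-> //|kj] := compatP _ _ _ cq j; rewrite kj /=.
  move: kj; rewrite kills_rcons bq => /andP[kj /eqP qj]; have y0 := ypos j kj.
  apply/orP; right; rewrite /wall fnN -/(wall z j e) oppr_ge0 -(pmulr_rle0 _ t0).
  by rewrite -[X in X <= _](addKr (wall z j y)) qj addr0 oppr_le0.
have ez : eqv z z1.
  case: (ltrgt0P c) => c0.
  - apply: (eqv_backward k1) => j jX; have [r r0 pr] := prop j jX; have [kj qj ej] := XP j jX.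
      apply: (strip_act_lt iq cq); apply: lexgt_last; first by rewrite kills_opp kwV.
      by rewrite -/(wall z j _) pr // cV mulrN opprK mulr_gt0.
    apply: (strip_act_ge iq c1q); apply: lexgt_last; first exact: kw.
    by rewrite -/(wall z j _) pr // mulr_gt0.
  - apply: (eqv_forward k1) => j jX; have [r r0 pr] := prop j jX; have [kj qj ej] := XP j jX.
      apply: (strip_act_lt iq cq); apply: lexgt_last; first by rewrite kills_opp kw.
      by rewrite -/(wall z j _) pr // -mulrN mulr_gt0 ?oppr_gt0.
    apply: (strip_act_ge iq c1q); apply: lexgt_last; first exact: kwV.
    by rewrite -/(wall z j _) pr // cV mulr_gt0 ?oppr_gt0.
  have kwq j : j \in X -> kills (fun p => fn j (strip z j) (act w p)) (rcons Y q).
    move=> jX; have [r r0 pr] := prop j jX; have [kj qj ej] := XP j jX.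
    by rewrite kills_rcons kw //= -/(wall z j _) pr // -/c c0 mulr0.
  have kwVq j : j \in X -> kills (fun p => fn j (strip z j) (act w^-1 p)) (rcons Y q).
    move=> jX; have [r r0 pr] := prop j jX; have [kj qj ej] := XP j jX.
    by rewrite kills_rcons kwV //= -/(wall z j _) pr // cV c0 oppr0 mulr0.
  (* At the level of points, [w] fixes [e], so the two sides move in parallel. *)
  have [b|b] := boolP (nilp Y).
    move: lamP; rewrite b /= => lam2.
    have [we wVe] : act w e = e /\ act w^-1 e = e.
      by apply: act_fixed => //; rewrite wlam // lam2.
    apply: (eqv_parallel k1) => j jX; have [r r0 pr] := prop j jX; have [kj qj ej] := XP j jX.
      apply: (strip_act_ge im cm); apply: lexgt_last; first exact: kwVq.
      by rewrite actN wVe fnN oppr_gt0.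
    apply: (strip_act_lt ie c1); apply: lexgt_last; first by rewrite kills_opp kwq.
    by rewrite we oppr_gt0.
  move: lamP; rewrite b => -[lam2 FV].
  pose a f := wall z i1 f.
  have y1 : 0 < a y by exact: ygt.
  have prw f : (f <= F)%MS -> a y * a (act w f) = a (act w y) * a f.
    move=> fF; have mD : Dw i1 \in [seq D ij | ij <- enum {: 'I_m * 'I_m}] ++ [seq Dw i | i <- enum
      'I_m].
      by rewrite mem_cat (map_f Dw) ?orbT // mem_enum.
    have Dq : dot q (Dw i1) = 0 by rewrite dot_Dw q1' -/c c0 !mulr0 subrr.
    have Dy : dot y (Dw i1) = 0 by rewrite dot_Dw; ring.
    have D0 : dot p2 (Dw i1) = 0.
      have := Dq; rewrite dotDl Dy add0r dotZl => /eqP; rewrite mulf_eq0 gt_eqF //=.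
      by rewrite dotBl Dy subr0 => /eqP.
    have := hD _ mD D0 f fF; rewrite dot_Dw /a; lra.
  (* On [F], [w] multiplies the wall function by [s] and [w^-1] by [lam - s], with product 1;
     [s > 0] would give [lam = s + 1/s >= 2]. So [w] exchanges the sides of the wall. *)
  pose s := a (act w y) / a y.
  have sw f : (f <= F)%MS -> a (act w f) = s * a f.
    move=> fF; apply: (mulfI (lt0r_neq0 y1)); rewrite prw // /s; field; exact: lt0r_neq0.
  have lamw f : (f <= F)%MS -> a (act w^-1 f) = (lam - s) * a f.
    move=> fF; have := congr1 a (wlam _ fF);
      rewrite /a /wall fnD fnZ -!/(wall _ _ _) -!/(a _) sw //; lra.
  have ss : s * (lam - s) = 1.
    have := sw _ (proj2 (winv _ yF)); rewrite actVK lamw // => h.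
    by apply: (mulIf (lt0r_neq0 y1)); rewrite mul1r -mulrA -h.
  have s0 : s < 0.
    rewrite ltNge; apply/negP; rewrite le_eqVlt => /orP[/eqP s0|s0].
      by move/eqP: ss; rewrite -s0 mul0r eq_sym oner_eq0.
    have h2 : 0 < (2 - lam) * s by rewrite mulr_gt0 // subr_gt0.
    by have h1 := sqr_ge0 (s - 1); lra.
  have ls0 : lam - s < 0 by rewrite -(nmulr_rgt0 _ s0) ss ltr01.
  apply: (eqv_forward k1) => j jX; have [r r0 pr] := prop j jX; have [kj qj ej] := XP j jX.
    apply: (strip_act_lt im cm); apply: lexgt_last; first by rewrite kills_opp kwq.
    rewrite actN fnN opprK -/(wall z j _) pr // mulr_gt0 // -/(a _) sw //.
    by rewrite nmulr_rgt0.
  apply: (strip_act_ge ie c1); apply: lexgt_last; first exact: kwVq.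
  by rewrite -/(wall z j _) pr // mulr_gt0 // -/(a _) lamw // nmulr_rgt0.
(* Slightly beyond [q] the segment is generic again, and [good_change] passes the later vectors of
   [z] on to [z1]. *)
have [eta eta0 heta] := small_eps (enum 'I_m) (fun j => wall z1 j q) (fun j => wall z1 j e).
pose p1 := q + eta *: e.
have p1F : (p1 <= F)%MS by rewrite addmx_sub ?scalemx_sub.
have wt1 : wt p1 = (nilp Y)%:R by rewrite wtD wtZ wte mulr0 addr0.
have bp1 j : wall z1 j p1 = wall z1 j q + eta * wall z1 j e by rewrite /wall fnD fnZ.
have p1gt j : 0 < wall z1 j q -> 0 < wall z1 j p1.
  by move=> h; rewrite bp1; apply: heta; rewrite ?mem_enum.
have q1ge j : kills (wall z1 j) Y -> 0 <= wall z1 j q.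
  move=> kj; have := compatP _ _ _ c1q j; rewrite lexge_rcons => /orP[/lexgt_kills|/andP[]//].
  by rewrite kj.
have e1ge j : kills (wall z1 j) Y -> wall z1 j q = 0 -> 0 <= wall z1 j e.
  move=> kj qj; have := compatP _ _ _ c1 j; rewrite lexge_rcons => /orP[/lexgt_kills|/andP[]//].
  by rewrite kills_rcons kj qj eqxx.
have cp1 : compat z1 (rcons Y p1).
  apply/compatP => j; rewrite lexge_rcons.
  have := compatP _ _ _ c1q j; rewrite lexge_rcons => /orP[-> //|/andP[kj]].
  rewrite kj le_eqVlt => /orP[/eqP qj|/p1gt/ltW->]; rewrite ?orbT //=.
  by rewrite bp1 -qj add0r mulr_ge0 ?orbT ?(ltW eta0) // e1ge.
have gen1' j : kills (wall z1 j) Y -> wall z1 j p1 = 0 -> forall f, (f <= F)%MS -> wall z1 j f = 0.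
  move=> kj pj; have qj : wall z1 j q = 0.
    apply/eqP; apply: contraTT (eqxx (0 : R)) => nq; rewrite -{1}pj gt_eqF // p1gt //.
    by rewrite lt0r nq q1ge.
  have ej : wall z1 j e = 0.
    by move/eqP: pj; rewrite bp1 qj add0r mulf_eq0 gt_eqF //= => /eqP.
  apply: geny => //; rewrite -/(wall z1 j y).
  by move: qj; rewrite /q /wall fnD fnZ -!/(wall z1 j _) ej mulr0 addr0.
have ip1 : inVh (rcons Y p1) by apply: inVh_rcons_F; rewrite // wt1 ler0n.
have gen1 : generic Y F p1.
  move=> i n kn pn f fF.
  have kp : kills (fn i n) (rcons Y p1) by rewrite kills_rcons kn pn eqxx.
  have [en|en] := kills_tight ip1 (lexgt_wt_rcons wt1) cp1 kp.
    by rewrite en; apply: gen1' => //; rewrite /wall -en.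
  have e2 : - n = strip z1 (ng i) by rewrite strip_ng en opprD.
  apply/eqP; rewrite -oppr_eq0 -(fn_ng (A := A)) ?(submx_trans fF F_Vh) // e2; apply/eqP.
  apply: gen1' => //; rewrite /wall -e2.
    rewrite (@eq_kills _ _ _ (fun p => - fn i n p)) ?kills_opp // => p /(allP hY)/andP[pV _].
    by rewrite fn_ng.
  by rewrite fn_ng ?pn ?oppr0 // (submx_trans p1F F_Vh).
exists z1, p1; split=> //.
apply: (good_change gy) => //.
- by rewrite /nilp !size_rcons.
- move=> i n; rewrite !kills_rcons; case kn: (kills _ Y) => //=.
  by apply/eqP/eqP => h; [apply: geny|apply: gen1].
move=> i; rewrite kills_rcons => /andP[kn /eqP pn].
have van := gen1' _ kn pn.
have kq1 : kills (wall z1 i) (rcons Y q) by rewrite kills_rcons kn van ?eqxx.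
rewrite k1; case iX: (i \in X); case nX: (ng i \in X) => /=; rewrite ?subr0 ?addr0 ?subrK //.
- have [ki qi _] := XP _ iX.
  have ki' : kills (wall z i) (rcons Y q) by rewrite kills_rcons ki qi eqxx.
  move: (lexgt_kills wq); rewrite (@eq_kills _ _ _ (wall z1 i)) ?kq1 // => p pq.
  have h0 := eqP (allP ki' p pq).
  by rewrite /wall k1 iX nX /= addr0 (fn_shift _ (strip z i)) -/(wall z i p) h0 add0r subKr mul1r.
- have [_ _] := XP _ nX.
  have -> : wall z (ng i) e = - wall z1 i e.
    by rewrite wall_ng // wte sub0r /wall !(fn_wt0 _ _ wte).
  by rewrite van // oppr0 ltxx.
Qed.

End CrossStep.

Fixpoint flag (b : bool) U Fs : Prop :=
  if Fs is F :: Fs' then exists lam U', [/\ level b F lam, (U' <= V0)%MS,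
    forall p, (p <= U)%MS -> exists f u, [/\ (f <= F)%MS, (u <= U')%MS & p = f + u] &
    flag true U' Fs']
  else forall x : 'rV[R]_m.+1, (x <= U)%MS -> x = 0.

(** At each level [cross_step] decreases the distance until no wall through [Y] separates [z] from
    [y']. Then [z] is good with [y'] instead of [y], and both alcoves extend the same infinitesimal
    point. *)
Lemma good_eqv Fs Y U z z' : flag (~~ nilp Y) U Fs -> inVh Y ->
  nilp Y \/ lexgt wt Y -> nice Y ->
  (forall i n, kills (fn i n) Y -> exists p, [/\ (p <= U)%MS, wt p = 0 & co p i != 0]) ->
  good Y Fs z -> good Y Fs z' -> eqv z z'.
Proof.
elim: Fs Y U z z' => [|F Fs IH] Y U z z' /=.
  (* With [U = 0] no hyperplane contains [Y], so all strips agree; [z] and [z'] may still differ by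
     an element of length 0, which [eqv_strong] absorbs. *)
  move=> U0 hY _ _ hU c c'.
  have nk i n : ~~ kills (fn i n) Y.
    by apply/negP => /hU[p [/U0-> _]]; rewrite /co mxE eqxx.
  have le t t' i : compat t Y -> compat t' Y -> strip t i <= strip t' i.
    move=> ct ct'; apply: (compat_gt_le hY ct').
    by have := compatP _ _ _ ct i; rewrite /lexge (negPf (nk _ _)) orbF.
  apply: (@eqv_parallel set0) => [j|j|j]; rewrite !inE //.
  by rewrite subr0 addr0; apply/eqP; rewrite eq_le !le.
move=> [lam [U' [lev U'V dec fl]]] hY hwt hn hU [y [yF wty geny gy]] [y' [y'F wty' geny' gy']].
have [n] := ubnP (dist z z'); elim: n => // n IHn in z y yF wty geny gy *.
rewrite ltnS => hd.
have [hex|hex] := pselect (exists i, kills (wall z i) Y && (wall z i y' < 0)).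
  have [z1 [p1 [h1 h2 h3 h4 [h5 h6]]]] := cross_step hY hwt hn lev yF y'F wty wty' geny geny'
    (good_compat gy) (good_compat gy') hex gy.
  apply: (eqv_trans h5); apply: (IHn z1 p1) => //; exact: leq_trans hd.
have FV : (F <= Vh)%MS by case: lev.
have y'V := submx_trans y'F FV.
have gzy' : good (rcons Y y') Fs z.
  apply: (good_change gy) => //.
  - by rewrite /nilp !size_rcons.
  - move=> i k; rewrite !kills_rcons; case kn: (kills _ Y) => //=.
    by apply/eqP/eqP => h; [apply: geny|apply: geny'].
  - apply/compatP => i; rewrite lexge_rcons.
    have /orP[-> //|ki] := compatP _ _ _ (compat_rconsl (good_compat gy)) i.
    rewrite ki leNgt; apply/orP; right; apply/negP => lt; apply: hex.
    by exists i; rewrite ki.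
apply: (IH (rcons Y y') U') => //.
- by rewrite /nilp size_rcons.
- by rewrite inVh_rcons hY y'V wty' ler0n.
- right; exact: lexgt_wt_rcons.
- move=> i k; rewrite kills_rcons => /andP[kY /eqP ky] p; rewrite mem_rcons inE.
  case/orP=> [/eqP->|pY]; last exact: hn.
  have [_ /(_ _ y'F)[a1 a2] _ _] := lev.
  by split; apply: geny'.
- move=> i k; rewrite kills_rcons => /andP[kY /eqP ky].
  have [p [pU p0 pi]] := hU i k kY.
  have [f [u [fF uU' e]]] := dec p pU.
  have u0 : wt u = 0 by have /V0P[] := submx_trans uU' U'V.
  have f0 : wt f = 0 by move: p0; rewrite e wtD u0 addr0.
  exists u; split=> //; move: pi; rewrite -(fn_wt0 i k p0) e fnD (geny' i k) // add0r.
  by rewrite (fn_wt0 i k u0).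
Qed.

End Conjugation.

(** * Descent to a point of least displacement *)

Lemma finite_min (R : realDomainType) (T : finType) (X : Type) (P : T -> X -> Prop) (g : T -> X -> R) :
  (forall t, (exists x, P t x) -> exists2 x, P t x & forall x', P t x' -> g t x <= g t x') ->
  (exists t x, P t x) ->
  exists t x, P t x /\ forall t' x', P t' x' -> g t x <= g t' x'.
Proof.
move=> hmin [t0 [x0 h0]].
suff H (s : seq T) : (exists2 t, t \in s & exists x, P t x) ->
    exists t x, P t x /\ forall t' x', t' \in s -> P t' x' -> g t x <= g t' x'.
  have [|t [x [h1 h2]]] := H (enum T); first by exists t0; [rewrite mem_enum|exists x0].
  by exists t, x; split=> // t' x'; apply: h2; rewrite mem_enum.
elim: s => [[]//|a s IH] _.
have [sP|sN] := pselect (exists2 t, t \in s & exists x, P t x).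
  have [t [x [h1 h2]]] := IH sP.
  have [aP|aN] := pselect (exists x, P a x).
    have [y h3 h4] := hmin a aP.
    have [le|/ltW le] := leP (g t x) (g a y).
      exists t, x; split=> // t' x'; rewrite inE => /orP[/eqP-> h|t's h]; last exact: h2.
      exact: le_trans le (h4 _ h).
    exists a, y; split=> // t' x'; rewrite inE => /orP[/eqP-> h|t's h]; first exact: h4.
    exact: le_trans le (h2 _ _ t's h).
  exists t, x; split=> // t' x'; rewrite inE => /orP[/eqP->|t's] h; last exact: h2.
  by case: aN; exists x'.
have [aP|aN] := pselect (exists x, P a x).
  have [x h1 h2] := hmin a aP; exists a, x; split=> // t' x'; rewrite inE.
  by case/orP=> [/eqP-> /h2 //|t's h]; case: sN; exists t' => //; exists x'.
exists t0, x0; split=> // t' x'; rewrite inE => /orP[/eqP->|t's] h.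
  by case: aN; exists x'.
by case: sN; exists t' => //; exists x'.
Qed.

Section Flow.
Variables (R : rcfType) (m : nat) (G : groupType) (A : affine_system R m G) (w : G).
Implicit Types (z : G) (i j : 'I_m) (p q u : 'rV[R]_m.+1) (Y : seq 'rV[R]_m.+1).
Implicit Types (U F : 'M[R]_m.+1) (Fs : seq 'M[R]_m.+1).
Local Notation Vh := (Vhat A).
Local Notation ng := (negr A).
Local Notation strip := (strip A).
Local Notation wall := (wall A).
Local Notation act := (act A).
Local Notation compat := (compat A).
Local Notation dist := (dist A).
Local Notation inVh := (inVh A).
Local Notation V0 := (V0 A).
Local Notation red := (red A w).

Lemma red_trans z z' z'' : red z z' -> red z' z'' -> red z z''.
Proof. by elim=> // {}z s {}z' hs hl _ IH /IH; apply: red_step. Qed.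

Lemma red_len z z' : red z z' -> (len A (w ^ z') <= len A (w ^ z))%N.
Proof. by elim=> // {}z s {}z' _ hl _ IH; apply: leq_trans hl. Qed.

Lemma walk_red Y u z z' : inVh Y ->
  (forall x i, compat x Y -> kills (wall x i) Y -> wall x i u < 0 ->
    strip (w * x)%g i < strip x i \/ strip (w^-1 * x)%g i < strip x i) ->
  walk A Y u z z' -> red z z'.
Proof.
move=> hY h; elim=> {z z'} [z|z i z' z'' c k n cr _ IH]; first exact: red_refl.
have le := len_conj_crosses cr (h _ _ c k n).
by case: cr => s ss [e _]; rewrite e in le IH; apply: red_step IH.
Qed.

Lemma strip_bound x i : (`|strip x i| <= (len A x).*2 + 1)%N.
Proof.
rewrite -dist1.
have h : (`|strip 1 i - strip x i| <= dist 1 x)%N by rewrite /dist (bigD1 i) //= leq_addr.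
have : (`|strip 1 i| <= 1)%N by rewrite strip1; case: (ps A i).
by move: h; move: (strip 1 i) (strip x i) (dist 1 x) => a b c; clear; lia.
Qed.

Lemma tr_bound x i : (`|tr A x i| <= (len A x).*2 + 2)%N.
Proof.
have := strip_bound x i; rewrite /strip; move: (tr A x i) ((len A x).*2) => a b.
by case: (ps _ _); clear; lia.
Qed.

Section Code.
Variable B : nat.
(** The possible actions on the apartment of elements of bounded length form a finite set, even if
    infinitely many elements share an action. Translations lie between [-B] and [B], hence [B.*2.+1]
    values. *)
Definition code := {ffun 'I_m -> 'I_m * 'I_(B.*2.+1)}.
Definition code_sg (t : code) i := (t i).1.
Definition code_tr (t : code) i : int := ((t i).2 : nat)%:Z - B%:Z.

Lemma code_exists x : ((len A x).*2 + 2 <= B)%N ->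
  exists t : code, code_sg t =1 sg A x /\ code_tr t =1 tr A x.
Proof.
move=> hB; exists [ffun i => (sg A x i, inord `|tr A x i + B%:Z|)]; split=> i.
  by rewrite /code_sg ffunE.
rewrite /code_tr ffunE /= inordK; have := tr_bound x i; move: (tr A x i) hB;
  move: ((len A x).*2) => b a; clear; lia.
Qed.

End Code.

Lemma eq_amx s s' t t' : s =1 s' -> t =1 t' -> amx R s t = amx R s' t' :> 'M_m.+1.
Proof.
move=> h1 h2; apply/matrixP => i j; rewrite !mxE; case: unlift => // k.
by rewrite h1 h2.
Qed.

Lemma compat1 z p : compat z [:: p] = [forall i, 0 <= wall z i p].
Proof.
by apply: eq_forallb => i; rewrite /lexge /= andbF orbF andbT le_eqVlt orbC eq_sym.
Qed.

(* Half the derivative of [|p - w p|^2] in the direction [u]: the displacement is not minimal at [p]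
   unless [u = 0]. *)
Lemma displacement_descent p : wt p = 1 -> (p <= Vh)%MS ->
  let u := act w p + act w^-1 p - 2 *: p in
  dot (p - act w p) (u - act w u) = - dot u u.
Proof.
move=> p1 pV u.
have u0 : wt u = 0 by rewrite !(wtD, wtN, wtZ) !wt_act p1; ring.
have v0 : wt (p - act w p) = 0 by rewrite wtD wtN wt_act subrr.
have e : dot (p - act w p) (act w u) = dot (act w^-1 (p - act w p)) u.
  by rewrite -{1}(actVK A w (p - act w p)) act_isometry ?wt_act.
rewrite dotBr e -dotBl -dotNl; congr dot.
rewrite /u actB actM mulVg act1; apply/rowP => i; rewrite !mxE; ring.
Qed.

(** The displacement is minimised over the closed fundamental alcove and the finitely many actions
    of [w ^ z'] with [z'] reachable by [red]. At the minimum [u = 0]. Otherwise the walls through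
    [p] that block [u] could be crossed by [red]: the values of [wall] at [w p] and [w^-1 p] add up
    to a negative one at [u], so one image lies beyond. A reachable alcove would then contain a
    point of smaller displacement. *)
Lemma red_min_displacement z : exists z' p, [/\ red z z', (p <= Vh)%MS, wt p = 1,
  compat z' [:: p] & act w p + act w^-1 p = 2 *: p].
Proof.
pose B := ((len A (w ^ z)).*2 + 2)%N.
pose M (t : code B) := amx R (code_sg t) (code_tr t).
pose C c := [/\ (c <= Vh)%MS, wt c = 1 & forall i, 0 <= wall 1 i c].
pose P (t : code B) c := (exists z', [/\ red z z', code_sg t =1 sg A (w ^ z') &
  code_tr t =1 tr A (w ^ z')]) /\ C c.
pose g t c := dot (c - c *m M t) (c - c *m M t).
have codeR z' : red z z' -> exists t : code B, code_sg t =1 sg A (w ^ z') /\ code_tr t =1 tr A (w ^ z').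
  by move/red_len => h; apply: code_exists; rewrite leq_add2r leq_double.
have Cc0 : C (c0 A).
  by split; rewrite ?c0_Vh ?c0_wt // => i; rewrite ltW // wall1_c0.
have [||t [c [[[z' [rz h1 h2]] [cV c1 cpos]] cmin]]] := @finite_min R (code B) _ P g.
- move=> t [_ [hz _]].
  pose Q := (1%:M - M t) *m (1%:M - M t)^T.
  have qE x : qf Q x x = dot (x - x *m M t) (x - x *m M t).
    by rewrite /qf /Q mulmxA mulmx_dot trmxK mulmxBr mulmx1.
  have [|||x [h1 h2 h3]] := @qf_min_polyhedron R _ Q 1%:M _ _ [seq fnv R i (strip 1 i) | i <- enum 'I_m]
    (c0 A) V0 (submx1 _) (submx1 _).
  + by rewrite /Q trmx_mul trmxK.
  + by move=> x _; rewrite -/(qf Q x x) qE dot_ge0.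
  + by move=> _ /mapP[i _ ->]; rewrite dot_fnv -/(wall 1 i _) ltW // wall1_c0.
  have CE v : C v <-> (v - c0 A <= V0)%MS /\ forall l,
    l \in [seq fnv R i (strip 1 i) | i <- enum 'I_m] -> 0 <= dot v l.
    split=> [[xV x1 xp]|[xV xp]].
      split; first by apply/V0P; rewrite addmx_sub ?eqmx_opp ?c0_Vh // wtD wtN x1 c0_wt subrr.
      by move=> _ /mapP[i _ ->]; rewrite dot_fnv; apply: xp.
    have /V0P[a b] := xV; split.
    - by rewrite -(subrK (c0 A) v) addmx_sub ?c0_Vh.
    - by move: b; rewrite wtD wtN c0_wt => /eqP; rewrite subr_eq0 => /eqP.
    - move=> i; have ie : i \in enum 'I_m by rewrite mem_enum.
      by have := xp _ (map_f (fun i => fnv R i (strip 1 i)) ie); rewrite dot_fnv.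
  exists x; first by split=> //; apply/CE.
  by move=> x' [_ /CE[a b]]; rewrite /g -!qE; apply: h3.
- have [t [h1 h2]] := codeR z (red_refl _ _ z).
  by exists t, (c0 A); split=> //; exists z; split=> //; apply: red_refl.
pose p := act z' c.
have gE x v (t' : code B) : code_sg t' =1 sg A (w ^ x) -> code_tr t' =1 tr A (w ^ x) ->
    g t' (act x^-1 v) = dot (v - act w v) (v - act w v).
  move=> e1 e2; rewrite /g /M (eq_amx e1 e2) -/(act (w ^ x) _) actM.
  have -> : (w ^ x * x^-1 = x^-1 * w)%g by rewrite /conjg -!mulgA mulgV mulg1.
  by rewrite -actM -actB act_isometry // wtD wtN wt_act subrr.
exists z', p; split=> //.
- exact: act_Vh.
- by rewrite wt_act.
- by rewrite compat1; apply/forallP => i; rewrite -[z' in wall z']mulg1 wall_act.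
apply/eqP; rewrite -subr_eq0; apply: contraT => u0.
set u := act w p + act w^-1 p - 2 *: p in u0.
have pV : (p <= Vh)%MS := act_Vh _ cV.
have p1 : wt p = 1 by rewrite wt_act.
have wtu : wt u = 0 by rewrite !(wtD, wtN, wtZ) !wt_act c1; ring.
have uV : (u <= Vh)%MS by rewrite !addmx_sub ?eqmx_opp ?scalemx_sub ?act_Vh.
have cp : compat z' [:: p].
  by rewrite compat1; apply/forallP => i; rewrite -[z' in wall z']mulg1 wall_act.
have desc := displacement_descent p1 pV.
have uE : act w p + act w^-1 p - 2 *: p = u by [].
have pK : c = act z'^-1 p by rewrite /p actK.
rewrite /= uE in desc.
have [v vE] : exists v, v = u - act w u by exists (u - act w u).
have [a aE] : exists a, a = p - act w p by exists (p - act w p).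
rewrite -vE -aE in desc; clearbody u p.
have ip : inVh [:: p] by rewrite /= pV p1 ler01.
have wp : lexgt wt [:: p] by rewrite /= p1 ltr01.
have wtu0 : 0 <= wt u by rewrite wtu.
have [z2 [wk c2 _]] := walk_exists ip wp uV wtu0 cp.
have rz2 : red z z2.
  apply: (red_trans rz); apply: (walk_red ip _ wk) => x i cx; rewrite /= andbT => /eqP kx nx.
  have e : wall x i (act w p) + wall x i (act w^-1 p) = wall x i u.
    by move: kx; rewrite -uE /wall !fnD fnN fnZ => ->; rewrite mulr0 subr0.
  have [a0|a0] := ltP (wall x i (act w p)) 0.
    by left; apply: (strip_act_lt ip cx); rewrite /= oppr_gt0 a0.
  right; apply: (strip_act_lt ip cx); rewrite /= oppr_gt0 -/(wall x i _); apply/orP; left; lra.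
(* The [Some i] entries keep [p + eta u] in the closure of [z2]; the [None] entry makes the change
   [- eta (2 |u|^2 - eta |v|^2)] of the squared displacement negative. *)
have [eta eta0 heta] := small_eps (enum {: option 'I_m})
  (fun o : option 'I_m => if o is Some i then wall z2 i p else 2 * dot u u)
  (fun o : option 'I_m => if o is Some i then wall z2 i u else - dot v v).
pose p' := p + eta *: u.
have p'V : (p' <= Vh)%MS by rewrite addmx_sub ?scalemx_sub.
have wtp' : wt p' = 1 by rewrite wtD wtZ wtu p1 mulr0 addr0.
have p'pos i : 0 <= wall z2 i p'.
  have := heta (Some i); rewrite mem_enum => /(_ isT).
  have -> : wall z2 i p' = wall z2 i p + eta * wall z2 i u by rewrite /wall fnD fnZ.
  have := compatP _ _ _ c2 i; rewrite lexge_rcons /= andbF orbF andbT.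
  case/orP => [h /(_ h)/ltW //|/andP[/eqP-> h] _]; by rewrite add0r mulr_ge0 // ltW.
have [t2 [e1 e2]] := codeR _ rz2.
have := cmin t2 (act z2^-1 p') _; rewrite (gE z2) //.
rewrite pK (gE z') //.
rewrite -aE; have -> : p' - act w p' = a + eta *: v.
  by rewrite /p' aE vE actD actZ scalerBr opprD addrACA.
rewrite !(dotDl, dotDr, dotZl, dotZr) (dotC v) desc => h.
have {h} h : P t2 (act z2^-1 p') -> 2 * dot u u - eta * dot v v <= 0.
  move=> /h h'; rewrite -(pmulr_rle0 _ eta0); lra.
have := heta None; rewrite mem_enum => /(_ isT) /(_ _).
have uu := dot_gt0 u0; rewrite mulrN => h'; have {}h' : 0 < 2 * dot u u - eta * dot v v.
  by apply: h'; rewrite mulr_gt0.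
have /h : P t2 (act z2^-1 p').
  split; first by exists z2.
  split; rewrite ?act_Vh ?wt_act // => i.
  by rewrite -(mulVg z2) wall_act.
lra.
Qed.

(** * Descent inside the eigenspaces *)

Definition lin z : 'M[R]_m.+1 := amx R (sg A z) (fun=> 0).
Definition sym_lin := lin w + lin w^-1.

Lemma lin_act z p : wt p = 0 -> p *m lin z = act z p.
Proof.
move=> p0; apply: point_eq => [|i]; first by rewrite !wt_amx.
by rewrite !co_amx p0 !mulr0.
Qed.

Lemma sym_lin_act p : wt p = 0 -> p *m sym_lin = act w p + act w^-1 p.
Proof. by move=> p0; rewrite mulmxDr !lin_act. Qed.

Lemma lin_tr z : (lin z)^T = lin z^-1.
Proof.
apply/matrixP => i j; rewrite !mxE.
case: (unliftP ord0 i) => [i' ->|->]; case: (unliftP ord0 j) => [j' ->|->];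
  rewrite ?liftK ?unlift_none ?mulr0 ?addr0 //.
rewrite !(inj_eq lift_inj); congr ((nat_of_bool _)%:R); apply/eqP/eqP => ->.
  by rewrite -sgM mulgV sg1.
by rewrite -sgM mulVg sg1.
Qed.

Lemma sym_lin_sym : sym_lin^T = sym_lin.
Proof. by rewrite raddfD /= !lin_tr invgK addrC. Qed.

Lemma V0_wt p : (p <= V0)%MS -> wt p = 0. Proof. by case/V0P. Qed.
Lemma V0_Vh p : (p <= V0)%MS -> (p <= Vh)%MS. Proof. by case/V0P. Qed.

Definition stable U := forall u, (u <= U)%MS -> (act w u <= U)%MS /\ (act w^-1 u <= U)%MS.

Definition eigenspace_of (lam : R) U F := forall f, (f <= F)%MS <->
  (f <= U)%MS /\ act w f + act w^-1 f = lam *: f.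

Definition bounded_by (lam : R) U := forall u, (u <= U)%MS ->
  dot (act w u + act w^-1 u) u <= lam * dot u u.

(** Either the images of [p0] lie strictly on opposite sides, so one of them is beyond the
    hyperplane, or [Y] leaves the question to the next order. *)
Definition crossable p0 Y := forall i n, kills (fn i n) Y ->
  (fn i n (act w p0) != 0 /\ fn i n (act w p0) + fn i n (act w^-1 p0) = 0) \/
  (forall p, p \in Y -> fn i n (act w p) = 0 /\ fn i n (act w^-1 p) = 0).

(** The roots vanishing on [Y] cannot tell [V0] from [U], so a direction into an alcove can be
    sought in [U]. *)
Definition projects Y U := forall x, (x <= V0)%MS -> exists2 x', (x' <= U)%MS &
  forall i n, kills (fn i n) Y -> co x' i = co x i.

Section FlowLevel.
Variables (Y : seq 'rV[R]_m.+1) (p0 : 'rV[R]_m.+1) (U F : 'M[R]_m.+1) (lam : R).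
Hypothesis hY : inVh (p0 :: Y).
Hypothesis wtp0 : wt p0 = 1.
Hypothesis UV : (U <= V0)%MS.
Hypothesis hst : stable U.
Hypothesis hbd : bounded_by lam U.
Hypothesis hF : eigenspace_of lam U F.
Hypothesis hX : crossable p0 (p0 :: Y).
Hypothesis hP : projects (p0 :: Y) U.

(** A direction from [p0] into the interior of [zC], moved into [U] by [projects], is perturbed
    along [F] to make its projection [d] to [F] generic. *)
Lemma level_start z : compat z (p0 :: Y) -> exists x d, [/\ (x <= U)%MS,
  compat z (rcons (p0 :: Y) x), (d <= F)%MS, (x - d <= orth F)%MS &
  forall i, co d i = 0 -> forall f, (f <= F)%MS -> co f i = 0].
Proof.
move=> hc; have [c [cV c1 cpos _]] := alcove_point A z [::].
have /andP[/andP[p0V _] _] := hY.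
have [|x1 x1U hx1] := hP (_ : (c - p0 <= V0)%MS).
  by apply/V0P; rewrite addmx_sub ?eqmx_opp // wtD wtN c1 wtp0 subrr.
have x1pos i : kills (wall z i) (p0 :: Y) -> 0 < co x1 i.
  move=> ki; rewrite (hx1 _ _ ki) -(fn_wt0 i (strip z i)); last by rewrite wtD wtN c1 wtp0 subrr.
  by rewrite fnD fnN; case/andP: ki => /eqP; rewrite /wall => -> _; rewrite subr0 cpos.
have [f1 f1F hf1] := orth_proj F x1.
have [e eF he] := generic_dir F [seq delta_mx 0 (lift ord0 i) : 'rV[R]_m.+1 | i <- enum 'I_m].
have {}he i : co e i = 0 -> forall f, (f <= F)%MS -> co f i = 0.
  have ie : i \in enum 'I_m by rewrite mem_enum.
  move=> ei f fF; have := he _ (map_f (fun i => delta_mx 0 (lift ord0 i) : 'rV[R]_m.+1) ie).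
  by rewrite dot_delta => /(_ ei f fF); rewrite dot_delta.
have [eta eta0 heta] := small_eps (enum {: bool * 'I_m})
  (fun o : bool * 'I_m => if o.1 then co x1 o.2 else co f1 o.2 * co f1 o.2)
  (fun o : bool * 'I_m => if o.1 then co e o.2 else co f1 o.2 * co e o.2).
have coL p q i : co (p + eta *: q) i = co p i + eta * co q i by rewrite /co !mxE.
have [eU _] := proj1 (hF e) eF.
exists (x1 + eta *: e), (f1 + eta *: e); split.
- by rewrite addmx_sub ?scalemx_sub.
- apply/compatP => i; rewrite lexge_rcons.
  have /orP[-> //|ki] := compatP _ _ _ hc i; rewrite ki /wall fn_wt0; last first.
    by apply: V0_wt; rewrite (submx_trans _ UV) // addmx_sub ?scalemx_sub.
  apply/orP; right; rewrite coL ltW //.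
  by have := heta (true, i); rewrite mem_enum => /(_ isT (x1pos i ki)).
- by rewrite addmx_sub ?scalemx_sub.
- by apply/orthP => g gF; rewrite opprD addrACA subrr addr0 hf1.
move=> i; rewrite coL => h; apply: he.
have [/eqP f0|f0] := boolP (co f1 i == 0).
  by move/eqP: h; rewrite f0 add0r mulf_eq0 gt_eqF //= => /eqP.
have sq : 0 < co f1 i * co f1 i by rewrite lt0r -expr2 sqr_ge0 expf_neq0.
have := heta (false, i); rewrite mem_enum => /(_ isT sq) /=.
by rewrite mulrCA -mulrDr h mulr0 ltxx.
Qed.

(** [lam |x|^2 - <S x, x>] is minimised over the vectors with projection [d] to [F] pointing into
    reachable alcoves. If [u = S x - lam x] were nonzero, moving along [u] would decrease the form
    and cross walls by [red] only. So [x] lies in [F] and equals [d]. *)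
Lemma flow_level z : compat z (p0 :: Y) -> exists z' d, [/\ red z z',
  compat z' (rcons (p0 :: Y) d), (d <= F)%MS &
  forall i, co d i = 0 -> forall f, (f <= F)%MS -> co f i = 0].
Proof.
move=> hc; have [x0 [d [x0U cx0 dF x0d dgen]]] := level_start hc.
have FU (f : 'rV[R]_m.+1) (fF : (f <= F)%MS) : (f <= U)%MS by have [] := proj1 (hF f) fF.
have Uw u : (u <= U)%MS -> wt u = 0 by move=> uU; apply: V0_wt; apply: submx_trans uU UV.
have UVh u : (u <= U)%MS -> (u <= Vh)%MS by move=> uU; apply: V0_Vh; apply: submx_trans uU UV.
pose Q : 'M[R]_m.+1 := lam%:M - sym_lin.
have Qsym : Q^T = Q by rewrite /Q raddfB /= tr_scalar_mx sym_lin_sym.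
have Qpsd u : (u <= U)%MS -> 0 <= dot (u *m Q) u.
  move=> uU; rewrite mulmxBr mul_mx_scalar dotBl dotZl sym_lin_act ?Uw // subr_ge0.
  exact: hbd.
pose D := (U :&: orth F)%MS.
have DU : (D <= U)%MS by apply: capmxSl.
(* Pointing into an alcove depends only on the set [K] of its walls through [p0 :: Y], and such sets
   are finite in number. *)
pose P (K : {set 'I_m}) x := [/\ exists2 z', red z z' & compat z' (p0 :: Y) /\
  (forall i, (i \in K) = kills (wall z' i) (p0 :: Y)), (x - x0 <= D)%MS & forall i,
    i \in K -> 0 <= co x i].
have coE z1 x : (x <= U)%MS -> compat z1 (p0 :: Y) -> (forall i,
  kills (wall z1 i) (p0 :: Y) -> 0 <= co x i) <->
    compat z1 (rcons (p0 :: Y) x).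
  move=> xU c1; split=> [h|c2 i ki].
    apply/compatP => i; rewrite lexge_rcons; have /orP[-> //|ki] := compatP _ _ _ c1 i.
    by rewrite ki /wall fn_wt0 ?Uw // h ?orbT.
  have := compatP _ _ _ c2 i; rewrite lexge_rcons ki /wall fn_wt0 ?Uw //.
  by case/orP => [/lexgt_kills|//]; rewrite ki.
have xUof x : (x - x0 <= D)%MS -> (x <= U)%MS.
  by move=> h; rewrite -(subrK x0 x) addmx_sub // (submx_trans h).
have [||K [x [[[z' rz [c' hK]] xD xpos] xmin]]] := @finite_min R {set 'I_m} _ P (fun=> fun x => qf
  Q x x).
- move=> K [x [hz xD xpos]].
  have x1U := xUof _ xD.
  have [|y [y1 y2 y3]] := @qf_min_polyhedron R _ Q U Qsym Qpsd
      [seq delta_mx 0 (lift ord0 i) : 'rV[R]_m.+1 | i <- enum K] x D x1U DU.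
    by move=> _ /mapP[i iK ->]; rewrite dot_delta; apply: xpos; rewrite mem_enum in iK.
  exists y.
    split=> //; first by rewrite -(subrKA x) addmx_sub.
    move=> i iK; have ie : i \in enum K by rewrite mem_enum.
    by have := y2 _ (map_f (fun i => delta_mx 0 (lift ord0 i) : 'rV[R]_m.+1) ie); rewrite dot_delta.
  move=> x' [_ x'D x'pos]; apply: y3.
    by apply: (submx_diff x'D xD).
  by move=> _ /mapP[i iK ->]; rewrite dot_delta; apply: x'pos; rewrite mem_enum in iK.
- exists [set i | kills (wall z i) (p0 :: Y)], x0; split.
  + by exists z; [apply: red_refl|split=> // i; rewrite inE].
  + by rewrite subrr sub0mx.
  + by move=> i; rewrite inE; apply: (proj2 (coE z x0 x0U hc)).
have xU := xUof _ xD.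
have cx : compat z' (rcons (p0 :: Y) x).
  by apply/coE => // i ki; apply: xpos; rewrite hK.
have [u uE] : exists u, u = x *m sym_lin - lam *: x by exists (x *m sym_lin - lam *: x).
have xQ : x *m Q = - u by rewrite uE mulmxBr mul_mx_scalar opprB.
have uU : (u <= U)%MS.
  by rewrite uE sym_lin_act ?Uw // !addmx_sub ?eqmx_opp ?scalemx_sub //; case: (hst xU).
have uF : (u <= orth F)%MS.
  apply/orthP => f fF; have [fU fl] := proj1 (hF f) fF.
  by rewrite uE dotBl mulmx_dot sym_lin_sym sym_lin_act ?Uw // fl dotZl dotZr subrr.
have u0 : u = 0.
  apply/eqP; apply: contraT => u0; exfalso.
  have ix : inVh (rcons (p0 :: Y) x) by rewrite inVh_rcons hY UVh // Uw // lexx.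
  have wx : lexgt wt (rcons (p0 :: Y) x) by rewrite /= wtp0 ltr01.
  have wu : 0 <= wt u by rewrite Uw // lexx.
  have [z2 [wk c2 _]] := walk_exists ix wx (UVh _ uU) wu cx.
  have rz2 : red z z2.
    apply: (red_trans rz); apply: (walk_red ix _ wk) => z1 i cz1;
      rewrite kills_rcons => /andP[ki /eqP ix0] iu.
    have [[n0 s0]|hw] := hX ki.
      have [a0|a0] := ltP (fn i (strip z1 i) (act w p0)) 0.
        by left; apply: (strip_act_lt ix cz1); rewrite /= oppr_gt0 a0.
      by right; apply: (strip_act_lt ix cz1); rewrite /= oppr_gt0; apply/orP; left; move: n0 a0; lra.
    have e : wall z1 i (act w x) + wall z1 i (act w^-1 x) = wall z1 i u.
      by rewrite uE sym_lin_act ?Uw // /wall !fnD fnN fnZ [fn i _ x]ix0 mulr0 subr0.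
    have [a0|a0] := ltP (wall z1 i (act w x)) 0.
      left; apply: (strip_act_lt ix cz1); apply: lexgt_last; last by rewrite oppr_gt0.
      by rewrite kills_opp; apply/allP => p pY; have [-> _] := hw p pY.
    right; apply: (strip_act_lt ix cz1); apply: lexgt_last;
      last by rewrite oppr_gt0 -/(wall _ _ _); lra.
    by rewrite kills_opp; apply/allP => p pY; have [_ ->] := hw p pY.
  have [eta eta0 heta] := small_eps (enum {: option 'I_m})
    (fun o : option 'I_m => if o is Some i then co x i else 2 * dot u u)
    (fun o : option 'I_m => if o is Some i then co u i else - qf Q u u).
  have cy := compat_rconsl (compat_rconsl c2).
  have : P [set i | kills (wall z2 i) (p0 :: Y)] (x + eta *: u).
    split.
    - by exists z2 => //; split=> // i; rewrite inE.
    - by rewrite addrAC addmx_sub // scalemx_sub // sub_capmx uU uF.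
    - move=> i; rewrite inE => ki.
      have -> : co (x + eta *: u) i = co x i + eta * co u i by rewrite /co !mxE.
      have := proj2 (coE z2 x xU cy) (compat_rconsl c2) i ki.
      rewrite le_eqVlt => /orP[/eqP x0'|xp]; last first.
        by have := heta (Some i); rewrite mem_enum => /(_ isT xp)/ltW.
      rewrite -x0' add0r mulr_ge0 ?(ltW eta0) //.
      have nk : lexgt (wall z2 i) (p0 :: Y) = false.
        by apply/negP => /lexgt_kills; rewrite ki.
      have := compatP _ _ _ c2 i; rewrite lexge_rcons kills_rcons lexgt_rcons nk ki /wall !fn_wt0
        ?Uw //.
      by rewrite -x0' ltxx eqxx.
  have xu : qf Q x u = - dot u u by rewrite /qf xQ dotNl.
  move=> /xmin; rewrite (qfD Qsym) xu => h.
  have uu := dot_gt0 u0.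
  have := heta None; rewrite mem_enum => /(_ isT) /(_ _).
  rewrite mulrN => h'; have {}h' : 0 < 2 * dot u u - eta * qf Q u u by apply: h'; rewrite mulr_gt0.
  have : 0 < eta * (2 * dot u u - eta * qf Q u u) by rewrite mulr_gt0.
  move: h; rewrite expr2; lra.
have xF : (x <= F)%MS.
  apply/hF; split=> //; apply/eqP; rewrite -subr_eq0 -sym_lin_act ?Uw // -uE; exact/eqP.
have xd : x = d.
  apply/eqP; rewrite -subr_eq0; apply/eqP/dot_eq0.
  have xdF : (x - d <= F)%MS by rewrite addmx_sub ?eqmx_opp.
  have /orthP : (x - d <= orth F)%MS.
    by rewrite -(subrKA x0) addmx_sub // (submx_trans xD) // capmxSr.
  exact.
by exists z', d; split=> //; rewrite -xd.
Qed.

End FlowLevel.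

End Flow.

(** * Reaching a good alcove from any alcove *)

Section Reduction.
Variables (R : rcfType) (m : nat) (G : groupType) (A : affine_system R m G) (w : G).
Implicit Types (z : G) (i j : 'I_m) (p q u f : 'rV[R]_m.+1) (Y : seq 'rV[R]_m.+1).
Implicit Types (U F : 'M[R]_m.+1) (Fs : seq 'M[R]_m.+1).
Local Notation Vh := (Vhat A).
Local Notation strip := (strip A).
Local Notation wall := (wall A).
Local Notation act := (act A).
Local Notation compat := (compat A).
Local Notation inVh := (inVh A).
Local Notation V0 := (V0 A).
Local Notation sym_lin := (sym_lin A w).
Local Notation stable := (stable A w).
Local Notation bounded_by := (bounded_by A w).
Local Notation eigenspace_of := (eigenspace_of A w).

Fixpoint eflag U Fs : Prop :=
  if Fs is F :: Fs' then exists lam, [/\ lam < 2, bounded_by lam U, eigenspace_of lam U F &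
    eflag (U :&: orth F)%MS Fs']
  else forall p, (p <= U)%MS -> p = 0.

Lemma eigenspace_ex lam U : (U <= V0)%MS -> eigenspace_of lam U (U :&: kermx (sym_lin - lam%:M))%MS.
Proof.
move=> UV f; rewrite sub_capmx; split=> [/andP[fU /sub_kermxP h]|[fU h]].
  split=> //; rewrite -sym_lin_act; last by apply: (@V0_wt _ _ _ A); apply: submx_trans fU UV.
  by apply/eqP; rewrite -subr_eq0 -mul_mx_scalar -mulmxBr h.
rewrite fU; apply/sub_kermxP.
rewrite mulmxBr mul_mx_scalar sym_lin_act ?h ?subrr //.
by apply: (@V0_wt _ _ _ A); apply: submx_trans fU UV.
Qed.

Lemma eigenspace_stable lam U F : stable U -> eigenspace_of lam U F -> stable F.
Proof.
move=> hU hF f fF; have [fU fl] := proj1 (hF f) fF; have [a b] := hU f fU.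
by split; apply/hF; split=> //; rewrite -actZ -fl actD !actM mulgV mulVg.
Qed.

Lemma orth_stable lam U F : (U <= V0)%MS -> stable U -> eigenspace_of lam U F ->
  stable (U :&: orth F)%MS.
Proof.
move=> UV hU hF u; rewrite sub_capmx => /andP[uU /orthP uF].
have w0 p : (p <= U)%MS -> wt p = 0.
  by move=> h; apply: (@V0_wt _ _ _ A); apply: submx_trans h UV.
have [a b] := hU u uU; have hst := eigenspace_stable hU hF.
split; rewrite sub_capmx ?a ?b; apply/orthP => g gF.
  rewrite act_adjoint ?w0 //; last by have [] := proj1 (hF g) gF.
  by apply: uF; have [] := hst g gF.
rewrite act_adjoint ?w0 ?invgK //; last by have [] := proj1 (hF g) gF.
by apply: uF; have [] := hst g gF.
Qed.

(** [|w u - u|^2 >= 0] for the isometry [w]. *)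
Lemma bounded2 U : (U <= V0)%MS -> bounded_by 2 U.
Proof.
move=> UV u uU; have u0 : wt u = 0 by apply: (@V0_wt _ _ _ A); apply: submx_trans uU UV.
have := dot_ge0 (act w u - u); rewrite dotBl !dotBr act_isometry //.
rewrite (dotC u (act w u)) dotDl (act_adjoint A w^-1) // invgK (dotC u (act w u)); lra.
Qed.

Lemma eflag_exists U : (U <= V0)%MS -> stable U ->
  (forall u, (u <= U)%MS -> act w u + act w^-1 u = 2 *: u -> u = 0) ->
  exists Fs, eflag U Fs.
Proof.
have [n] := ubnP (\rank U); elim: n U => // n IH U; rewrite ltnS => rU UV hst h2.
have w0 p : (p <= U)%MS -> wt p = 0.
  by move=> h; apply: (@V0_wt _ _ _ A); apply: submx_trans h UV.
have [/eqP U0|U0] := boolP (U == 0).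
  by exists [::] => /= p; rewrite U0 submx0 => /eqP.
have US : (U *m sym_lin <= U)%MS.
  apply/row_subP => i; rewrite row_mul sym_lin_act ?w0 ?row_sub //.
  by rewrite addmx_sub //; have [] := hst _ (row_sub i U).
have [lam [x [xU x0 xl xmax]]] := max_eigenvalue (sym_lin_sym A w) US U0.
have xl' : act w x + act w^-1 x = lam *: x by rewrite -sym_lin_act ?w0.
pose F := (U :&: kermx (sym_lin - lam%:M))%MS.
have hF : eigenspace_of lam U F by apply: eigenspace_ex.
have [||||Fs hFs] := IH (U :&: orth F)%MS.
- apply: leq_trans rU; rewrite ltn_neqAle mxrankS ?capmxSl // andbT.
  apply: contra x0 => h; have {}h : (U :&: orth F == U)%MS.
    by rewrite -(mxrank_leqif_eq (capmxSl U (orth F))).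
  have : (x <= U :&: orth F)%MS by rewrite (eqmxP h).
  rewrite sub_capmx => /andP[_ /orthP/(_ x)] hx.
  by apply/eqP/dot_eq0/hx/hF.
- exact: submx_trans (capmxSl _ _) UV.
- exact: orth_stable hF.
- by move=> u; rewrite sub_capmx => /andP[uU _]; apply: h2.
exists (F :: Fs) => /=; exists lam; split=> //.
  rewrite lt_neqAle; apply/andP; split.
    by apply: contra x0 => /eqP l2; rewrite (h2 x xU) // xl' l2.
  have := bounded2 UV xU; rewrite xl' dotZl ler_pM2r //; exact: dot_gt0.
by move=> u uU; rewrite -sym_lin_act ?w0 //; apply: xmax.
Qed.

Lemma eflag_dec U F : forall p, (p <= U)%MS -> (F <= U)%MS ->
  exists f u, [/\ (f <= F)%MS, (u <= U :&: orth F)%MS & p = f + u].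
Proof.
move=> p pU FU; have [f fF hf] := orth_proj F p.
exists f, (p - f); split=> //; last by rewrite addrC subrK.
rewrite sub_capmx addmx_sub ?eqmx_opp ?(submx_trans fF) //=; exact/orthP.
Qed.

Lemma eigenspace_sub lam U F : eigenspace_of lam U F -> (F <= U)%MS.
Proof. by move=> h; apply/row_subP => i; have [] := proj1 (h _) (row_sub i F). Qed.

Lemma eflag_flag U Fs : (U <= V0)%MS -> stable U -> eflag U Fs -> flag A w true U Fs.
Proof.
elim: Fs U => //= F Fs IH U UV hst [lam [l2 hb hF hFs]].
have FU := eigenspace_sub hF.
have FV := submx_trans FU UV.
exists lam, (U :&: orth F)%MS; split.
- split=> //.
  + by apply: submx_trans FV _; apply: capmxSl.
  + exact: eigenspace_stable hF.
  + by move=> f fF; have [] := proj1 (hF f) fF.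
- exact: submx_trans (capmxSl _ _) UV.
- by move=> p pU; apply: eflag_dec.
apply: IH => //; first exact: submx_trans (capmxSl _ _) UV.
exact: orth_stable hF.
Qed.

Lemma eflag_good U Fs p0 Y z : (U <= V0)%MS -> stable U -> eflag U Fs ->
  inVh (p0 :: Y) -> wt p0 = 1 -> nice A w (p0 :: Y) -> projects A (p0 :: Y) U ->
  compat z (p0 :: Y) -> exists2 z', red A w z z' & good A (p0 :: Y) Fs z'.
Proof.
elim: Fs U Y z => [|F Fs IH] U Y z /= UV hst.
  by move=> _ _ _ _ _ c; exists z => //; apply: red_refl.
move=> [lam [l2 hb hF hFs]] hY p1 hn hP hc.
have FU := eigenspace_sub hF; have FV := submx_trans FU UV.
have hX : crossable A w p0 (p0 :: Y) by move=> i n k; right; apply: hn.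
have [z1 [d [r1 c1 dF dgen]]] := flow_level hY p1 UV hst hb hF hX hP hc.
have d0 : wt d = 0 by apply: (@V0_wt _ _ _ A); apply: submx_trans dF FV.
have dV : (d <= Vh)%MS by apply: (@V0_Vh _ _ _ A); apply: submx_trans dF FV.
have gen : generic (p0 :: Y) F d.
  move=> i n _ h f fF; rewrite fn_wt0; last by apply: (@V0_wt _ _ _ A); apply: submx_trans fF FV.
  by apply: dgen fF; rewrite -(fn_wt0 i n d0).
have hstF := eigenspace_stable hst hF.
have [||||||z2 r2 g2] := IH (U :&: orth F)%MS (rcons Y d) z1 _ _ hFs _ p1.
- exact: submx_trans (capmxSl _ _) UV.
- exact: orth_stable hF.
- by rewrite -rcons_cons inVh_rcons dV d0 lexx !andbT; exact: hY.
- move=> i n; rewrite -rcons_cons kills_rcons => /andP[ki /eqP di] p.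
  rewrite mem_rcons inE => /orP[/eqP->|]; last exact: hn.
  by have [a b] := hstF d dF; split; apply: (gen i n).
- move=> x xV; have [x' x'U hx] := hP x xV.
  have [f [u [fF uU e]]] := eflag_dec x'U FU.
  exists u => // i n; rewrite -rcons_cons kills_rcons => /andP[ki /eqP di].
  rewrite -(hx i n ki) e /co [RHS]mxE -/(co f i) -/(co u i).
  have di0 : co d i = 0 by rewrite -(fn_wt0 i n d0).
  by rewrite (dgen i di0 f fF) add0r.
- by rewrite -rcons_cons.
exists z2; first exact: red_trans r1 r2.
by exists d; split=> //; rewrite -rcons_cons in g2.
Qed.

Theorem conj_reduction : exists gd : G -> Prop,
  (forall z, exists2 z', red A w z z' & gd z') /\
  (forall z z', gd z -> gd z' -> eqv A w z z').
Proof.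
pose act_mx z := amx R (sg A z) (tr A z).
(* In homogeneous coordinates: points of least displacement together with the fixed directions,
   which form [F] below. *)
pose F0 := (Vh :&: kermx (act_mx w + act_mx (w^-1)%g - 2%:M))%MS.
have F0P f : (f <= F0)%MS <-> (f <= Vh)%MS /\ act w f + act w^-1 f = 2 *: f.
  rewrite sub_capmx; split=> [/andP[fV /sub_kermxP h]|[fV h]].
    split=> //; apply/eqP; rewrite -subr_eq0 -mul_mx_scalar -[act w f + _]mulmxDr -mulmxBr.
    exact/eqP.
  rewrite fV; apply/sub_kermxP.
  by rewrite mulmxBr mulmxDr mul_mx_scalar -/(act w f) -/(act w^-1 f) h subrr.
have F0st f : (f <= F0)%MS -> (act w f <= F0)%MS /\ (act w^-1 f <= F0)%MS.
  move=> /F0P[fV h]; split; apply/F0P; rewrite act_Vh //; split=> //; rewrite -actZ -h actD !actM.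
    by rewrite mulgV mulVg.
  by rewrite mulgV mulVg.
have V0st : stable V0.
  by move=> u /V0P[uV u0]; split; apply/V0P; rewrite act_Vh ?wt_act.
pose F := (V0 :&: kermx (sym_lin - 2%:M))%MS.
have hF : eigenspace_of 2 V0 F by apply: eigenspace_ex; apply: submx_refl.
have FF0 : (F <= F0)%MS.
  apply/row_subP => i; have [a b] := proj1 (hF _) (row_sub i F).
  by apply/F0P; split=> //; apply: (@V0_Vh _ _ _ A).
have FV := eigenspace_sub hF.
pose U := (V0 :&: orth F)%MS.
have UV : (U <= V0)%MS by apply: capmxSl.
have Ust : stable U by apply: orth_stable hF; [apply: submx_refl|].
have [|Fs hFs] := eflag_exists UV Ust.
  move=> u uU h; apply: dot_eq0.
  have uV : (u <= V0)%MS := submx_trans uU UV.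
  by move: uU; rewrite sub_capmx => /andP[_ /orthP]; apply; apply/hF.
exists (good A [::] (F0 :: Fs)); split=> [z|z z'].
- have [z1 [p [r1 pV p1 c1 hp]]] := red_min_displacement A w z.
  have ip : inVh [:: p] by rewrite /= pV p1 ler01.
  have hX : crossable A w p [:: p].
    move=> i n /=; rewrite andbT => /eqP h.
    have s0 : fn i n (act w p) + fn i n (act w^-1 p) = 0 by rewrite -fnD hp fnZ h mulr0.
    have [/eqP e|ne] := boolP (fn i n (act w p) == 0); last by left.
    by right=> q; rewrite inE => /eqP->; rewrite e in s0 *; move: s0; rewrite add0r.
  have hP : projects A [:: p] V0 by move=> x xV; exists x.
  (* [nice] may fail at [p], which need not be generic among the points of least displacement. A
     flow with eigenvalue 2 finds a generic fixed direction [d], and [q = p + eta d] is generic in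
     [F0]. *)
  have [z2 [d [r2 c2 dF dgen]]] :=
    flow_level ip p1 (submx_refl V0) V0st (bounded2 (submx_refl V0)) hF hX hP c1.
  have dV0 := submx_trans dF FV.
  have /V0P[dV d0] := dV0.
  have [eta eta0 heta] := small_eps (enum 'I_m) (fun i => wall z2 i p) (fun i => wall z2 i d).
  pose q := p + eta *: d.
  have bq i : wall z2 i q = wall z2 i p + eta * wall z2 i d by rewrite /wall fnD fnZ.
  have c2p i : 0 < wall z2 i p \/ wall z2 i p = 0 /\ 0 <= wall z2 i d.
    have := compatP _ _ _ c2 i; rewrite lexge_rcons /= andbF orbF andbT.
    by case/orP=> [->|/andP[/eqP-> ->]]; [left|right].
  have qpos i : 0 < wall z2 i p -> 0 < wall z2 i q.
    by move=> h; rewrite bq; apply: heta; rewrite ?mem_enum.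
  have cq : compat z2 [:: q].
    rewrite compat1; apply/forallP => i; case: (c2p i) => [/qpos/ltW //|[e0 h]].
    by rewrite bq e0 add0r mulr_ge0 // ltW.
  have qV : (q <= Vh)%MS by rewrite addmx_sub ?scalemx_sub.
  have q1 : wt q = 1 by rewrite wtD wtZ d0 p1 mulr0 addr0.
  have iq : inVh [:: q] by rewrite /= qV q1 ler01.
  have wq : lexgt wt [:: q] by rewrite /= q1 ltr01.
  have qF0 : (q <= F0)%MS.
    by rewrite addmx_sub ?scalemx_sub ?(submx_trans dF) //; apply/F0P.
  have van i n : fn i n p = 0 -> fn i n d = 0 -> forall f, (f <= F0)%MS -> fn i n f = 0.
    move=> hp0 hd0 f fF0; have /F0P[fV fl] := fF0.
    have -> : f = (f - wt f *: p) + wt f *: p by rewrite subrK.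
    have e0 : wt (f - wt f *: p) = 0 by rewrite wtD wtN wtZ p1 mulr1 subrr.
    rewrite fnD fnZ hp0 mulr0 addr0 fn_wt0 //; apply: dgen.
      by rewrite -(fn_wt0 i n d0).
    apply/hF; split; first by apply/V0P; rewrite addmx_sub ?eqmx_opp ?scalemx_sub.
    rewrite !actB !actZ scalerBr -fl scalerA mulrC -scalerA -hp scalerDr.
    by rewrite opprD addrACA.
  have genq : generic [::] F0 q.
    move=> i n _ hn0.
    have kq : kills (fn i n) [:: q] by rewrite /= hn0 eqxx.
    have tight j : wall z2 j q = 0 -> wall z2 j p = 0 /\ wall z2 j d = 0.
      move=> h; case: (c2p j) => [/qpos|[e0 _]]; first by rewrite h ltxx.
      by split=> //; move/eqP: h; rewrite bq e0 add0r mulf_eq0 gt_eqF //= => /eqP.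
    have [e|e] := kills_tight iq wq cq kq.
      by have [|a b] := tight i; [rewrite /wall -e|apply: van; rewrite e].
    have e2 : - n = strip z2 (negr A i) by rewrite strip_ng e opprD.
    have [|a b] := tight (negr A i); first by rewrite /wall -e2 fn_ng // hn0 oppr0.
    move: a b; rewrite /wall -e2 !fn_ng // => /eqP; rewrite oppr_eq0 => /eqP a /eqP.
    by rewrite oppr_eq0 => /eqP b; apply: van.
  have nq : nice A w [:: q].
    move=> i n /=; rewrite andbT => /eqP h q'; rewrite inE => /eqP->.
    by have [a b] := F0st q qF0; split; apply: (genq i n).
  have hPq : projects A [:: q] U.
    move=> x xV; have [f [u [fF uU e]]] := eflag_dec xV FV.
    exists u => // i n /=; rewrite andbT => /eqP h.
    have f0 : fn i n f = 0 by apply: (genq i n) => //; apply: submx_trans fF FF0.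
    have wf : wt f = 0 by apply: (@V0_wt _ _ _ A); apply: submx_trans fF FV.
    by rewrite e /co [RHS]mxE -/(co f i) -(fn_wt0 i n wf) f0 add0r.
  have [z3 r3 g3] := eflag_good UV Ust hFs iq q1 nq hPq cq.
  exists z3; first exact: red_trans r1 (red_trans r2 r3).
  by exists q; split.
- apply: (@good_eqv _ _ _ A w (F0 :: Fs) [::] Vh) => //.
  + exists 2, U; split=> //.
    * split=> //; first exact: capmxSl.
      by move=> f /F0P[].
    * move=> x xV; have [z1 [p [_ pV p1 _ hp]]] := red_min_displacement A w 1.
      have xpV : (x - wt x *: p <= V0)%MS.
        by apply/V0P; rewrite addmx_sub ?eqmx_opp ?scalemx_sub // wtD wtN wtZ p1 mulr1 subrr.
      have [f [u [fF uU e]]] := eflag_dec xpV FV.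
      exists (f + wt x *: p), u; split=> //.
        by rewrite addmx_sub ?(submx_trans fF) // scalemx_sub //; apply/F0P.
      by rewrite addrAC -e subrK.
    * exact: eflag_flag.
  + by left.
  + move=> i n _; have [x [xV x0 xi]] := root_neq0 A i; exists x; split=> //.
Qed.

End Reduction.

Lemma sum_extend (V : nmodType) (I : eqType) (l l' : seq I) (F : I -> V) :
  uniq l -> uniq l' -> {subset l <= l'} ->
  \sum_(w <- l) F w = \sum_(w <- l') (if w \in l then F w else 0).
Proof.
move=> ul ul' sub; rewrite -[RHS]big_mkcond /= -[RHS]big_filter; apply: perm_big.
apply: uniq_perm; rewrite ?filter_uniq // => w; rewrite mem_filter.
by case wl: (w \in l) => //=; rewrite sub.
Qed.

(** * The Hecke algebra *)

Section LaurentPolynomials.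
Variables (H : nzRingType) (v vi : H).
Hypothesis HA : A_alg v vi.
Local Notation lev := (lev v vi).

Definition pev (p : {poly int}) : H := (map_poly intr p).[v].

Lemma vvi : v * vi = 1. Proof. by case: HA. Qed.
Lemma viv : vi * v = 1. Proof. by case: HA. Qed.
Lemma v_central h : v * h = h * v. Proof. by case: HA. Qed.
Lemma vi_central h : vi * h = h * vi.
Proof. by rewrite -[vi * h]mulr1 -vvi mulrA -[vi * h * v]mulrA -v_central mulrA viv mul1r. Qed.

Lemma exp_central (x : H) k : (forall h, x * h = h * x) -> forall h, x ^+ k * h = h * x ^+ k.
Proof. by move=> hx h; apply/commr_sym/commrX/commr_sym. Qed.

Lemma levE a : lev a = vi ^+ a.1 * pev a.2.
Proof.
rewrite /lev /pev (@horner_coef_wide _ (size a.2)) ?size_poly //.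
by congr (_ * _); apply: eq_bigr => i _; rewrite coef_map.
Qed.

Lemma pevD p q : pev (p + q) = pev p + pev q.
Proof. by rewrite /pev rmorphD hornerD. Qed.

Lemma pevN p : pev (- p) = - pev p.
Proof. by rewrite /pev rmorphN hornerN. Qed.

Lemma pevM p q : pev (p * q) = pev p * pev q.
Proof. by rewrite /pev rmorphM hornerM_comm // /comm_poly v_central. Qed.

Lemma pev0 : pev 0 = 0. Proof. by rewrite /pev rmorph0 horner0. Qed.
Lemma pev1 : pev 1 = 1. Proof. by rewrite /pev rmorph1 hornerC. Qed.
Lemma pevX : pev 'X = v. Proof. by rewrite /pev map_polyX hornerX. Qed.

Lemma pevXn p n : pev (p ^+ n) = pev p ^+ n.
Proof. by elim: n => [|n IH]; rewrite ?expr0 ?pev1 // !exprS pevM IH. Qed.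

Lemma pev_central p h : pev p * h = h * pev p.
Proof.
rewrite /pev horner_coef mulr_suml mulr_sumr; apply: eq_bigr => i _.
by rewrite coef_map /= -mulrA (exp_central _ v_central) !mulrA; congr (_ * _); rewrite mulrzl mulrzr.
Qed.

Lemma viX_v k : vi ^+ k * v ^+ k = 1.
Proof. by rewrite -exprMn_comm ?viv ?expr1n //; apply/esym/v_central. Qed.

Definition Ascalar (c : H) := exists a, c = lev a.

Lemma Ascalar_central c h : Ascalar c -> c * h = h * c.
Proof.
by case=> a ->; rewrite levE -mulrA pev_central !mulrA (exp_central _ vi_central).
Qed.

Lemma levD k l p q : lev (k, p) + lev (l, q) = lev ((k + l)%N, p * 'X^l + q * 'X^k).
Proof.
rewrite !levE /= pevD !pevM !pevXn pevX exprD mulrDr; congr (_ + _).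
  by rewrite -(exp_central l v_central) -mulrA [vi ^+ l * _]mulrA viX_v mul1r.
rewrite -(exp_central k v_central) (exp_central k vi_central) -mulrA.
by rewrite [vi ^+ k * _]mulrA viX_v mul1r.
Qed.

Lemma levM k l p q : lev (k, p) * lev (l, q) = lev ((k + l)%N, p * q).
Proof.
by rewrite !levE /= pevM exprD -!mulrA; congr (_ * _); rewrite !mulrA pev_central.
Qed.

Lemma levN k p : - lev (k, p) = lev (k, - p).
Proof. by rewrite !levE /= pevN mulrN. Qed.

Lemma lev0 k : lev (k, 0) = 0.
Proof. by rewrite levE /= pev0 mulr0. Qed.

Lemma Ascalar0 : Ascalar 0. Proof. by exists (0%N, 0); rewrite lev0. Qed.
Lemma Ascalar1 : Ascalar 1. Proof. by exists (0%N, 1); rewrite levE /= pev1 mulr1. Qed.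
Lemma AscalarD c d : Ascalar c -> Ascalar d -> Ascalar (c + d).
Proof. by move=> [[k p] ->] [[l q] ->]; rewrite levD; eexists. Qed.
Lemma AscalarN c : Ascalar c -> Ascalar (- c).
Proof. by move=> [[k p] ->]; rewrite levN; eexists. Qed.
Lemma AscalarM c d : Ascalar c -> Ascalar d -> Ascalar (c * d).
Proof. by move=> [[k p] ->] [[l q] ->]; rewrite levM; eexists. Qed.
Lemma AscalarB c d : Ascalar c -> Ascalar d -> Ascalar (c - d).
Proof. by move=> hc hd; apply/AscalarD/AscalarN. Qed.

Lemma Ascalar_sum (I : Type) (l : seq I) (P : pred I) (F : I -> H) :
  (forall i, Ascalar (F i)) -> Ascalar (\sum_(i <- l | P i) F i).
Proof. by move=> h; apply: big_ind => //; [exact: Ascalar0|exact: AscalarD]. Qed.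

Definition xi := v - vi.

Lemma lev_xi : lev (1%N, 'X^2 - 1) = xi.
Proof.
rewrite levE /= pevD pevN pev1 pevXn pevX expr1 mulrBr mulr1 expr2 mulrA viv mul1r //.
Qed.

Lemma Ascalar_xi : Ascalar xi. Proof. by exists (1%N, 'X^2 - 1); rewrite lev_xi. Qed.

Lemma xi_central h : xi * h = h * xi. Proof. exact: Ascalar_central Ascalar_xi. Qed.

Lemma xi_mulA h h' : xi * h * h' = xi * (h * h'). Proof. by rewrite mulrA. Qed.
Lemma xi_mulCA h h' : h * (xi * h') = xi * (h * h'). Proof. by rewrite !mulrA xi_central. Qed.

Notation C := (comm_span v vi).

Lemma C0 : C 0. Proof. by exists [::]; rewrite big_nil. Qed.

Lemma CD x y : C x -> C y -> C (x + y).
Proof. by move=> [s ->] [t ->]; exists (s ++ t); rewrite big_cat. Qed.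

Lemma CM c x : Ascalar c -> C x -> C (c * x).
Proof.
move=> [[k p] ->] [s ->]; exists [seq ((k + q.1.1.1, p * q.1.1.2)%R, q.1.2, q.2) | q <- s].
rewrite big_map mulr_sumr; apply: eq_bigr => -[[[l q] x'] y] _ /=.
by rewrite -levM mulrA.
Qed.

Lemma CN x : C x -> C (- x).
Proof. by move=> h; rewrite -mulN1r; apply: CM => //; apply/AscalarN/Ascalar1. Qed.

Lemma C_comm x y : C (x * y - y * x).
Proof.
exists [:: ((0%N, 1), x, y)]; rewrite big_seq1 /= levE /= pev1 mulr1 mul1r //.
Qed.

Lemma C_sum (I : Type) (l : seq I) (P : pred I) (F : I -> H) :
  (forall i, P i -> C (F i)) -> C (\sum_(i <- l | P i) F i).
Proof. by move=> h; apply: big_ind => //; [exact: C0|exact: CD]. Qed.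

Lemma C_ind (P : H -> Prop) : P 0 -> (forall x y, P x -> P y -> P (x + y)) ->
  (forall c x y, Ascalar c -> P (c * (x * y - y * x))) -> forall x, C x -> P x.
Proof.
move=> h0 hD hc x [s ->]; apply: big_ind => // -[[a x'] y] _ /=.
by apply: hc; exists a.
Qed.

Definition isinv (b bi : H) := b * bi = 1 /\ bi * b = 1.

Lemma isinvC b bi : isinv b bi -> isinv bi b. Proof. by case. Qed.

Lemma isinvM b bi c ci : isinv b bi -> isinv c ci -> isinv (b * c) (ci * bi).
Proof.
move=> [h1 h2] [h3 h4]; split.
  by rewrite mulrA -(mulrA b) h3 mulr1.
by rewrite mulrA -(mulrA ci) h2 mulr1.
Qed.

Lemma isinv_uniq b bi bi' : isinv b bi -> isinv b bi' -> bi = bi'.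
Proof. by move=> [h1 h2] [h3 h4]; rewrite -[bi]mulr1 -h3 mulrA h2 mul1r. Qed.

Lemma C_conj b bi x : isinv b bi -> C (b * x * bi - x).
Proof.
move=> [h1 h2]; have -> : b * x * bi - x = (b * x) * bi - bi * (b * x).
  by rewrite (mulrA bi) h2 mul1r.
exact: C_comm.
Qed.

Lemma C_conj_mem b bi x : isinv b bi -> C x -> C (b * x * bi).
Proof. by move=> h hx; rewrite -(subrK x (b * x * bi)); apply/CD => //; apply: C_conj. Qed.

Definition xi_comm h := exists2 c, C c & h = xi * c.

Lemma xi_comm0 : xi_comm 0. Proof. by exists 0; [exact: C0|rewrite mulr0]. Qed.
Lemma xi_commD x y : xi_comm x -> xi_comm y -> xi_comm (x + y).
Proof. by move=> [c hc ->] [d hd ->]; exists (c + d); [exact: CD|rewrite mulrDr]. Qed.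
Lemma xi_commN x : xi_comm x -> xi_comm (- x).
Proof. by move=> [c hc ->]; exists (- c); [exact: CN|rewrite mulrN]. Qed.
Lemma xi_commB x y : xi_comm x -> xi_comm y -> xi_comm (x - y).
Proof. by move=> hx hy; apply/xi_commD/xi_commN. Qed.
Lemma xi_comm_conj b bi x : isinv b bi -> xi_comm x -> xi_comm (b * x * bi).
Proof.
by move=> h [c hc ->]; exists (b * c * bi); [exact: C_conj_mem h hc|rewrite xi_mulCA xi_mulA].
Qed.

(* Conjugation by [n] is the identity modulo [xi [H,H]]. *)
Definition almost_central n := exists2 ni, isinv n ni & forall h, xi_comm (n * h * ni - h).

Lemma almost_central1 : almost_central 1.
Proof.
by exists 1 => [|h]; [split; rewrite mulr1|rewrite mul1r mulr1 subrr; apply: xi_comm0].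
Qed.

Lemma almost_centralM n n' : almost_central n -> almost_central n' -> almost_central (n * n').
Proof.
move=> [ni h1 h2] [ni' h3 h4]; exists (ni' * ni); first exact: isinvM.
move=> h; have -> : n * n' * h * (ni' * ni) - h =
  (n * (n' * h * ni') * ni - n' * h * ni') + (n' * h * ni' - h).
  by rewrite addrA subrK !mulrA.
by apply: xi_commD; [apply: h2|apply: h4].
Qed.

Lemma almost_centralV n ni : almost_central n -> isinv n ni -> almost_central ni.
Proof.
move=> [ni' h1 h2] h3; rewrite (isinv_uniq h3 h1); exists n; first exact: isinvC.
move=> h; rewrite -opprB; apply: xi_commN.
have [e1 e2] := h1; have := h2 (ni' * h * n).
by rewrite !mulrA e1 mul1r -mulrA e1 mulr1.
Qed.

Lemma almost_centralJ n u ui : isinv u ui -> almost_central n -> almost_central (u * n * ui).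
Proof.
move=> hu [ni h1 h2]; exists (u * ni * ui).
  by rewrite -(mulrA u ni); apply: isinvM; [exact: isinvM|exact: isinvC].
move=> h; have [e1 e2] := hu.
have -> : u * n * ui * h * (u * ni * ui) - h = u * (n * (ui * h * u) * ni - ui * h * u) * ui.
  rewrite mulrBr mulrBl !mulrA e1 mul1r -(mulrA h) e1 mulr1 //.
exact: xi_comm_conj.
Qed.

End LaurentPolynomials.

(** * Lifts of conjugations to units of the Hecke algebra *)

Section Hecke.
Variables (R : rcfType) (m : nat) (G : groupType) (A : affine_system R m G).
Variables (H : nzRingType) (v vi : H).
Hypothesis HA : A_alg v vi.
Variable T : G -> H.
Local Notation lev := (lev v vi).
Local Notation C := (comm_span v vi).
Local Notation Ascalar := (Ascalar v vi).
Local Notation xi := (xi v vi).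
Local Notation xi_comm := (xi_comm v vi).
Local Notation almost_central := (almost_central v vi).
Local Notation len := (len A).
Local Notation simple := (simple_refl A).
Hypothesis Tspan : forall h, exists (s : seq G) (a : G -> laur), h = \sum_(w <- s) lev (a w) * T w.
Hypothesis Tfree : forall (s : seq G) (a : G -> laur), uniq s ->
  \sum_(w <- s) lev (a w) * T w = 0 -> forall w, w \in s -> (a w).2 = 0.
Hypothesis Tmul : forall x y : G, len (x * y) = (len x + len y)%N -> T x * T y = T (x * y)%g.
Hypothesis Tquad : forall s : G, simple s -> (T s - v) * (T s + vi) = 0.

Lemma len1 : len 1 = 0%N.
Proof. by apply: double_inj; rewrite -dist1 dist_refl. Qed.

(** Multiplying the basis expansion of the unit by [T 1] changes no term. *)
Lemma T_1 : T 1%g = 1.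
Proof.
have h w : T 1%g * T w = T w by rewrite Tmul mul1g // len1.
have [s [a e]] := Tspan 1; rewrite -[LHS]mulr1 [in LHS]e mulr_sumr [RHS]e; apply: eq_bigr => w _.
have hc : Ascalar (lev (a w)) by eexists.
by rewrite mulrA -(Ascalar_central HA _ hc) -mulrA h.
Qed.

Lemma T_ss s : simple s -> T s * T s = 1 + xi * T s.
Proof.
move=> hs; apply/eqP; rewrite -subr_eq0 -(Tquad hs) mulrDr !mulrBl (vvi HA) -(vi_central HA).
by apply/eqP; rewrite opprD opprB -addrA; congr (_ + _); rewrite [RHS]addrA addrC (addrC (vi * _)).
Qed.

Lemma isinv_Ts s : simple s -> isinv (T s) (T s - xi).
Proof.
move=> hs; split; first by rewrite mulrBr T_ss // -(xi_central HA) addrK.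
by rewrite mulrBl T_ss // addrK.
Qed.

Lemma T_mul_simple x s : simple s ->
  T x * T s = T (x * s)%g \/ T x * T s = T (x * s)%g + xi * T x.
Proof.
move=> hs; have s1 := len_simple hs.
case: (len_mul_simple x hs) => e; first by left; rewrite Tmul // e s1 addn1.
right; have {1 3}<- : (x * s * s = x)%g by rewrite -mulgA (simple_reflV hs) mulg1.
have e' : T (x * s)%g * T s = T (x * s * s)%g.
  by rewrite Tmul // -mulgA (simple_reflV hs) mulg1 s1 addn1 e.
by rewrite -e' -mulrA T_ss // mulrDr mulr1 (xi_mulCA HA).
Qed.

Lemma isinv_len0 x : len x = 0%N -> isinv (T x) (T x^-1%g).
Proof.
move=> h; have h' : len x^-1 = 0%N by rewrite lenV.
by split; rewrite Tmul ?mulgV ?mulVg ?T_1 // len1 h h'.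
Qed.

Lemma T_unit x : exists bi, isinv (T x) bi.
Proof.
have [n] := ubnP (len x); elim: n x => // n IH x; rewrite ltnS => hn.
have [x0|x0] := posnP (len x); first by exists (T x^-1%g); apply: isinv_len0.
have [s hs e] := descent_exists x0.
have [|bi hbi] := IH (x * s)%g; first by apply: leq_trans hn; rewrite e.
have <- : T (x * s)%g * T s = T x.
  by rewrite Tmul -?mulgA (simple_reflV hs) ?mulg1 // (len_simple hs) addn1 e.
by exists ((T s - xi) * bi); apply: isinvM => //; apply: isinv_Ts.
Qed.

Definition Ti x : H := projT1 (cid (T_unit x)).

Lemma isinv_T x : isinv (T x) (Ti x). Proof. by rewrite /Ti; case: cid. Qed.

Lemma T_Ti x : T x * Ti x = 1. Proof. by have [] := isinv_T x. Qed.
Lemma Ti_T x : Ti x * T x = 1. Proof. by have [] := isinv_T x. Qed.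

(** For [n = T_s^2 = 1 + xi T_s], which commutes with [T_s], [n h n^-1 - h = xi [T_s, h n^-1]]. *)
Lemma almost_central_Tss s : simple s -> almost_central (T s * T s).
Proof.
move=> hs; have hi := isinvM (isinv_Ts hs) (isinv_Ts hs).
have [n en] : exists n, n = T s * T s by eexists.
have [ni eni] : exists ni, ni = (T s - xi) * (T s - xi) by eexists.
rewrite -en -eni in hi *; exists ni => // h; have [e1 e2] := hi.
have nT : n * T s = T s * n by rewrite en mulrA.
have niT : T s * ni = ni * T s.
  by rewrite -[LHS]mul1r -e2 -mulrA (mulrA n) nT -!mulrA e1 mulr1.
exists (T s * (h * ni) - (h * ni) * T s); first exact: C_comm.
have -> : n * h * ni - h = (n * h - h * n) * ni by rewrite mulrBl -[h * n * ni]mulrA e1 mulr1.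
have -> : n * h - h * n = xi * (T s * h - h * T s).
  rewrite en T_ss // mulrDl mulrDr mul1r mulr1 mulrBr (xi_mulCA HA) -(mulrA xi).
  by rewrite opprD addrACA subrr add0r.
by rewrite -mulrA [(T s * h - _) * _]mulrBl -!mulrA niT.
Qed.

(** Building [y] letter by letter, each drop in length leaves a factor [T_s^2]; products and
    conjugates of almost central units are almost central. *)
Lemma T_TN x y : exists2 n, almost_central n & T x * T y = T (x * y)%g * n.
Proof.
have [n] := ubnP (len y); elim: n y => // n IH y; rewrite ltnS => hn.
have [y0|y0] := posnP (len y).
  exists 1; first exact: almost_central1; rewrite mulr1 Tmul // y0 addn0.
  have h1 := dist_triangle A 1 x (x * y); have h2 := dist_triangle A 1 (x * y) x.
  apply: double_inj; move: h1 h2; rewrite (distC A (x * y)) !(dist_len A x) mulKg y0.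
  by rewrite !dist1 !addn0 => h1 h2; apply/eqP; rewrite eqn_leq h1 h2.
have [s hs e] := descent_exists y0.
have [|k hk ek] := IH (y * s)%g; first by apply: leq_trans hn; rewrite e.
have <- : T (y * s)%g * T s = T y.
  by rewrite Tmul -?mulgA (simple_reflV hs) ?mulg1 // (len_simple hs) addn1 e.
have [e1 e2] := isinv_Ts hs.
have nJ : almost_central ((T s - xi) * k * T s) by apply: almost_centralJ => //; apply/isinvC/isinv_Ts.
have eT : T x * (T (y * s)%g * T s) = T (x * (y * s))%g * T s * ((T s - xi) * k * T s).
  by rewrite mulrA ek !mulrA -(mulrA _ (T s) (T s - xi)) e1 mulr1.
have ex : (x * (y * s) * s = x * y)%g by rewrite -!mulgA (simple_reflV hs) mulg1.
rewrite eT; have s1 := len_simple hs.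
case: (len_mul_simple (x * (y * s)) hs) => l.
  exists ((T s - xi) * k * T s) => //.
  by rewrite (@Tmul (x * (y * s))%g) ?ex // -ex l s1 addn1.
exists (T s * T s * ((T s - xi) * k * T s)); first by apply: almost_centralM => //;
  apply: almost_central_Tss.
rewrite ex in l.
have -> : T (x * (y * s))%g = T (x * y)%g * T s.
  rewrite Tmul; last by rewrite s1 addn1 l mulgA.
  by rewrite mulgA.
by rewrite !mulrA.
Qed.

Definition braid x (b : H) := exists2 n, almost_central n & b = T x * n.

Lemma braid_unit x b : braid x b -> exists bi, isinv b bi.
Proof.
by case=> n [ni h _] ->; exists (ni * Ti x); apply: isinvM => //; apply: isinv_T.
Qed.

Lemma braid_T x : braid x (T x).
Proof. by exists 1; [exact: almost_central1|rewrite mulr1]. Qed.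

Lemma braid_mul x y b c : braid x b -> braid y c -> braid (x * y) (b * c).
Proof.
case=> n hn -> [n' hn' ->]; have [k hk e] := T_TN x y.
exists (k * (Ti y * n * T y) * n').
  apply: almost_centralM => //; apply: almost_centralM => //; apply: almost_centralJ => //;
    exact/isinvC/isinv_T.
by rewrite !mulrA -e -!mulrA (mulrA (T y)) T_Ti mul1r.
Qed.

Lemma braid_inv x b bi : braid x b -> isinv b bi -> braid x^-1 bi.
Proof.
case=> n hn -> hi; have [ni hni _] := hn.
have -> : bi = ni * Ti x.
  by apply: (isinv_uniq hi); apply: isinvM => //; apply: isinv_T.
have [k hk e] := T_TN x x^-1.
rewrite mulgV T_1 mul1r in e; have [ki hki _] := hk.
have eT : Ti x = T x^-1%g * ki.
  by rewrite -[LHS]mulr1 -(proj1 hki) -e !mulrA Ti_T mul1r.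
exists (Ti x^-1 * ni * T x^-1%g * ki).
  apply: almost_centralM => //; last exact: almost_centralV hki.
  by apply: almost_centralJ => //; [apply/isinvC/isinv_T|apply: almost_centralV hni].
by rewrite !mulrA T_Ti mul1r -mulrA eT mulrA.
Qed.

Lemma braid_conj x b bi b' bi' : braid x b -> braid x b' -> isinv b bi -> isinv b' bi' ->
  forall h, xi_comm (b * h * bi - b' * h * bi').
Proof.
case=> n hn -> [n' hn' ->] hi hi' h; have [ni hni c1] := hn; have [ni' hni' c2] := hn'.
have -> : bi = ni * Ti x by apply: (isinv_uniq hi); apply: isinvM => //; apply: isinv_T.
have -> : bi' = ni' * Ti x by apply: (isinv_uniq hi'); apply: isinvM => //; apply: isinv_T.
have -> : T x * n * h * (ni * Ti x) - T x * n' * h * (ni' * Ti x) =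
    T x * ((n * h * ni - h) - (n' * h * ni' - h)) * Ti x.
  by rewrite opprB addrA subrK mulrBr mulrBl !mulrA.
by apply: (xi_comm_conj HA (isinv_T x)); apply: xi_commB.
Qed.

(* The conjugation of [w^z] into [w^z'] lifts to the Hecke algebra, by [T] up to an almost central
   factor. *)
Definition T_conj w z z' := exists2 b, braid (z^-1 * z') b & T (w ^ z)%g * b = b * T (w ^ z')%g.

Lemma T_conj_refl w z : T_conj w z z.
Proof. by exists 1; rewrite ?mulr1 ?mul1r // mulVg -T_1; apply: braid_T. Qed.

Lemma T_conj_sym w z z' : T_conj w z z' -> T_conj w z' z.
Proof.
case=> b hb e; have [bi hi] := braid_unit hb; have [e1 e2] := hi; exists bi.
  by have := braid_inv hb hi; rewrite invgM invgK.
by rewrite -[RHS]mulr1 -e1 -!mulrA (mulrA (T _)) e !mulrA e2 mul1r.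
Qed.

Lemma T_conj_trans w z z' z'' : T_conj w z z' -> T_conj w z' z'' -> T_conj w z z''.
Proof.
case=> b hb e [c hc e']; exists (b * c); last by rewrite mulrA e -mulrA e' mulrA.
by have := braid_mul hb hc; rewrite -mulgA mulVKg.
Qed.

Lemma conj_mulE (w z : G) : (w ^ z = z^-1 * w * z)%g. Proof. by rewrite /conjg mulgA. Qed.

Lemma eqv_T_conj w z z' : eqv A w z z' -> T_conj w z z'.
Proof.
elim=> {z z'} [z z' h1 h2|z z' h1 h2|z z' _|z z' z'' _ h1 _ h2].
- pose x := (z^-1 * z')%g; pose y := (z'^-1 * w * z)%g.
  have exy : (w ^ z = x * y)%g by rewrite /x /y conj_mulE -!mulgA mulVKg.
  have eyx : (w ^ z' = y * x)%g by rewrite /x /y conj_mulE -!mulgA mulVKg.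
  move: h1 h2; rewrite !(dist_len A) invgM -!mulgA (mulgA (w^-1)%g) mulVg mul1g.
  rewrite -!doubleD => /double_inj h1 /double_inj h2.
  have h3 : T x * T y = T (w ^ z)%g.
    by rewrite exy Tmul // -exy conj_mulE -mulgA h1 /y -mulgA.
  have h4 : T y * T x = T (w ^ z')%g.
    by rewrite eyx Tmul // -eyx conj_mulE -mulgA h2 /y -mulgA.
  by exists (T x); [exact: braid_T|rewrite -h3 -h4 mulrA].
- pose x := (z^-1 * z')%g.
  have e1 : (w ^ z * x = z^-1 * w * z')%g by rewrite /x conj_mulE -!mulgA mulVKg.
  have e2 : (x * w ^ z' = z^-1 * w * z')%g by rewrite /x conj_mulE -!mulgA mulVKg.
  move: h1 h2; rewrite !(dist_len A) invgM -!mulgA (mulgA (w^-1)%g) mulVg mul1g.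
  rewrite -!doubleD => /double_inj h1 /double_inj h2.
  exists (T x); first exact: braid_T.
  rewrite !Tmul ?e1 ?e2 //; first by rewrite conj_mulE -!mulgA h2.
  by rewrite conj_mulE -!mulgA h1.
- exact: T_conj_sym.
- exact: T_conj_trans h1 h2.
Qed.

Lemma len_mul_simplel x s : simple s ->
  len (s * x) = (len x).+1 \/ (len (s * x)).+1 = len x.
Proof.
move=> hs; have := len_mul_simple x^-1 hs; have sV : (s^-1 = s)%g.
  by apply: (mulgI s); rewrite mulgV (simple_reflV hs).
by rewrite -{1 2}sV -invgM !lenV.
Qed.

Section Shift.
Variables (a s : G).
Hypothesis hs : simple s.
Let s1 := len_simple hs.
Let ss := simple_reflV hs.

Lemma shift_down : (len (s * a * s) < len a)%N ->
  [/\ T a = T s * T (s * a)%g, T (s * a)%g = T (s * a * s)%g * T s & (len (s * a) < len a)%N].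
Proof.
move=> lt; have sas : (s * (s * a) = a)%g by rewrite mulgA ss mul1g.
have ass : (s * a * s * s = s * a)%g by rewrite -(mulgA (s * a)%g) ss mulg1.
case: (len_mul_simplel a hs) (len_mul_simple (s * a) hs) => e1 [] e2; try lia.
split; last by lia.
- by rewrite Tmul sas // s1 -e1.
- by rewrite Tmul ass // s1 -e2 addn1.
Qed.

Lemma shift_eq : len (s * a * s) = len a ->
  T s * T a = T (s * a * s)%g * T s \/ T a * T s = T s * T (s * a * s)%g.
Proof.
move=> le; have sas : (s * (s * a) = a)%g by rewrite mulgA ss mul1g.
have ass : (s * a * s * s = s * a)%g by rewrite -(mulgA (s * a)%g) ss mulg1.
case: (len_mul_simplel a hs) => e1; [left|right].
  by rewrite !Tmul ?ass // s1 ?le ?e1 // addn1.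
have -> : T a = T s * T (s * a)%g by rewrite Tmul sas // s1 -e1.
by rewrite -mulrA Tmul // s1 le -e1 addn1.
Qed.

End Shift.

Lemma simple_inv s : simple s -> (s^-1 = s)%g.
Proof. by move=> hs; apply: (mulgI s); rewrite mulgV (simple_reflV hs). Qed.

Lemma conjg_simple w z s : simple s -> (w ^ (z * s) = s * (w ^ z) * s)%g.
Proof. by move=> hs; rewrite !conj_mulE invgM (simple_inv hs) -!mulgA. Qed.

(** Steps of equal length lift by [shift_eq]; the first shortening step is returned as the
    alternative. *)
Lemma red_T_conj w z z' : red A w z z' ->
  T_conj w z z' \/ exists z1 s, [/\ T_conj w z z1, simple s, len (w ^ z1) = len (w ^ z) &
    (len (w ^ (z1 * s)) < len (w ^ z1))%N].
Proof.
elim=> {z z'} [z|z s z' hs le r IH]; first by left; apply: T_conj_refl.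
move: le; rewrite leq_eqVlt => /orP[/eqP le|lt]; last first.
  by right; exists z, s; split=> //; apply: T_conj_refl.
have c : T_conj w z (z * s).
  rewrite (conjg_simple _ _ hs) in le.
  have [e|e] := shift_eq hs le; last first.
    by exists (T s); rewrite ?mulKg ?(conjg_simple _ _ hs) //; apply: braid_T.
  apply: T_conj_sym; exists (T s); last by rewrite (conjg_simple _ _ hs) -e.
  by rewrite invgM (simple_inv hs) -mulgA mulVg mulg1; apply: braid_T.
case: IH => [IH|[z1 [t [h1 h2 h3 h4]]]]; first by left; apply: T_conj_trans IH.
by right; exists z1, t; split=> //; [apply: T_conj_trans h1|rewrite h3].
Qed.

Definition min_conj w z := forall z', (len (w ^ z) <= len (w ^ z'))%N.

Lemma min_T_conj w z z' : min_conj w z -> min_conj w z' -> T_conj w z z'.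
Proof.
have [gd [h1 h2]] := conj_reduction A w.
have reach t : min_conj w t -> exists2 t', T_conj w t t' & gd t'.
  move=> ht; have [t' r gt'] := h1 t; exists t' => //.
  have [//|[z1 [s [_ _ e lt]]]] := red_T_conj r.
  by have := ht (z1 * s)%g; rewrite -e leqNgt lt.
move=> /reach[t c gt] /reach[t' c' gt'].
apply: T_conj_trans c _; apply: T_conj_trans (T_conj_sym c').
by apply/eqv_T_conj/h2.
Qed.

Lemma T_conj_C w z z' : T_conj w z z' -> C (T (w ^ z)%g - T (w ^ z')%g).
Proof.
case=> b hb e; have [bi hi] := braid_unit hb.
have -> : T (w ^ z)%g = b * T (w ^ z')%g * bi by rewrite -e -mulrA (proj1 hi) mulr1.
exact: C_conj.
Qed.

(** * Spanning by representatives of minimal length *)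

Variable rep : G -> G.
Hypothesis rep_conj : forall x, exists z, (rep x = x ^ z)%g.
Hypothesis rep_min : forall x z, (len (rep x) <= len (x ^ z))%N.
Hypothesis rep_class : forall x z, rep (x ^ z) = rep x.

Definition spanned (h : H) := exists (l : seq G) (c : G -> H), [/\ uniq l, forall w, Ascalar (c w),
  forall w, w \in l -> rep w = w & C (h - \sum_(w <- l) c w * T w)].

Lemma merge_sum (l l' : seq G) (c c' X : G -> H) : uniq l -> uniq l' ->
  \sum_(w <- undup (l ++ l')) ((if w \in l then c w else 0) + (if w \in l' then c' w else 0)) * X w =
  \sum_(w <- l) c w * X w + \sum_(w <- l') c' w * X w.
Proof.
move=> ul ul'; under eq_bigr do rewrite mulrDl.
have E (k : seq G) (d : G -> H) : uniq k -> {subset k <= undup (l ++ l')} ->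
    \sum_(w <- undup (l ++ l')) (if w \in k then d w else 0) * X w = \sum_(w <- k) d w * X w.
  move=> uk sk; rewrite (sum_extend _ uk (undup_uniq _) sk); apply: eq_bigr => w _.
  by case: ifP => // _; rewrite mul0r.
by rewrite big_split /= !E // => w h; rewrite mem_undup mem_cat h ?orbT.
Qed.

Lemma Ascalar_merge (l l' : seq G) (c c' : G -> H) w : (forall w, Ascalar (c w)) -> (forall w,
  Ascalar (c' w)) ->
  Ascalar ((if w \in l then c w else 0) + (if w \in l' then c' w else 0)).
Proof. by move=> h h'; apply: AscalarD => //; case: ifP => // _; apply: Ascalar0. Qed.

Lemma spanned_C h h' : C (h - h') -> spanned h' -> spanned h.
Proof.
move=> hc [l [c [h1 h2 h3 h4]]]; exists l, c; split=> //.
by rewrite -(subrKA h'); apply: CD.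
Qed.

Lemma spanned0 : spanned 0.
Proof.
exists [::], (fun=> 0); split=> // [_|]; first exact: Ascalar0.
by rewrite big_nil subrr; apply: C0.
Qed.

Lemma spannedD h h' : spanned h -> spanned h' -> spanned (h + h').
Proof.
move=> [l [c [u1 a1 r1 c1]]] [l' [c' [u2 a2 r2 c2]]].
exists (undup (l ++ l')), (fun w => (if w \in l then c w else 0) + (if w \in l' then c' w else 0)).
split; first exact: undup_uniq.
- by move=> w; apply: Ascalar_merge.
- by move=> w; rewrite mem_undup mem_cat => /orP[/r1|/r2].
by rewrite merge_sum // opprD addrACA; apply: CD.
Qed.

Lemma spannedM c h : Ascalar c -> spanned h -> spanned (c * h).
Proof.
move=> hc [l [d [h1 h2 h3 h4]]]; exists l, (fun w => c * d w); split=> //.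
  by move=> w; apply: AscalarM.
under eq_bigr do rewrite -mulrA.
by rewrite -mulr_sumr -mulrBr; apply: CM.
Qed.

Lemma spanned_T w : spanned (T w).
Proof.
have [n] := ubnP (len w); elim: n w => // n IH w; rewrite ltnS => hn.
have [gd [h1 h2]] := conj_reduction A w; have [g r gg] := h1 1%g.
have [c|[z1 [s [c hs e lt]]]] := red_T_conj r.
  (* No shortening occurred, so [w] is linked to a good alcove; so is its representative, by
     minimality. *)
  have [z0 e0] := rep_conj w; have [g' r' gg'] := h1 z0.
  have c' : T_conj w z0 g'.
    have [//|[z1 [s [_ _ e lt]]]] := red_T_conj r'.
    by have := rep_min w (z1 * s)%g; rewrite e0 -e leqNgt lt.
  have cc : T_conj w 1 z0.
    apply: T_conj_trans c _; apply: T_conj_trans (T_conj_sym c').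
    by apply/eqv_T_conj/h2.
  have := T_conj_C cc; rewrite conjg1 -e0 => hc; apply: (spanned_C hc).
  exists [:: rep w], (fun=> 1); split=> // [_|x|].
  - exact: Ascalar1.
  - by rewrite inE => /eqP->; rewrite {1}e0 rep_class.
  - by rewrite big_seq1 mul1r subrr; apply: C0.
have := T_conj_C c; rewrite conjg1 => hc; apply: (spanned_C hc).
rewrite conjg1 in e; rewrite (conjg_simple _ _ hs) in lt.
have [e1 e2 l3] := shift_down hs lt; set a := (w ^ z1)%g in e e1 e2 lt l3 *.
(* Modulo commutators, [T_a = T_s T_{sa}] becomes [T_{sa} T_s = T_{sas} T_s^2 = T_{sas} + xi
   T_{sa}], and both elements are shorter than [a]. *)
apply: (@spanned_C _ (T (s * a)%g * T s)); first by rewrite e1; apply: C_comm.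
rewrite e2 -mulrA T_ss // mulrDr mulr1 (xi_mulCA HA) -e2.
by apply: spannedD; [|apply: spannedM; first exact: Ascalar_xi]; apply: IH; apply: leq_trans hn;
  rewrite -e.
Qed.

Lemma spanned_all h : spanned h.
Proof.
have [s [a ->]] := Tspan h; apply: (big_ind spanned) => [||w _]; [exact: spanned0|exact: spannedD|].
by apply: spannedM; [eexists|exact: spanned_T].
Qed.

Lemma T_repr h : exists (l : seq G) (c : G -> H),
  [/\ uniq l, forall w, Ascalar (c w) & h = \sum_(w <- l) c w * T w].
Proof.
pose P h := exists (l : seq G) (c : G -> H), [/\ uniq l, forall w,
  Ascalar (c w) & h = \sum_(w <- l) c w * T w].
have [s [a ->]] := Tspan h; apply: (big_ind P) => [||w _].
- by exists [::], (fun=> 0); split=> // [_|]; [exact: Ascalar0|rewrite big_nil].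
- move=> _ _ [l [c [u1 a1 ->]]] [l' [c' [u2 a2 ->]]].
  exists (undup (l ++ l')), (fun w => (if w \in l then c w else 0) + (if w \in l' then c' w else 0)).
  by split; [exact: undup_uniq|move=> w; apply: Ascalar_merge|rewrite merge_sum].
- by exists [:: w], (fun=> lev (a w)); split=> // [_|]; [eexists|rewrite big_seq1].
Qed.

Lemma T_free (l : seq G) (c : G -> H) : uniq l -> (forall w, Ascalar (c w)) ->
  \sum_(w <- l) c w * T w = 0 -> forall w, w \in l -> c w = 0.
Proof.
move=> ul hc h w wl; have [a ha] := choice hc.
have e : \sum_(w <- l) lev (a w) * T w = 0 by rewrite -[RHS]h; apply: eq_bigr => u _; rewrite ha.
by rewrite ha (surjective_pairing (a w)) (Tfree ul e wl) (lev0 v vi).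
Qed.

Lemma lev_eq0 a : lev a = 0 -> a.2 = 0.
Proof.
move=> h; apply: (@Tfree [:: 1%g] (fun=> a) isT _ 1%g (mem_head _ _)).
by rewrite big_seq1 h mul0r.
Qed.

Lemma X2sub1_neq0 : 'X^2 - 1 != 0 :> {poly int}.
Proof. by rewrite -size_poly_eq0 size_XnsubC. Qed.

Lemma xi_reg_Ael c : Ascalar c -> xi * c = 0 -> c = 0.
Proof.
case=> [[k p] ->]; rewrite -(lev_xi HA) (levM HA) => /lev_eq0 /eqP.
rewrite mulf_eq0 (negPf X2sub1_neq0) => /eqP ->; exact: lev0.
Qed.

Lemma xi_reg h : xi * h = 0 -> h = 0.
Proof.
have [l [c [u a ->]]] := T_repr h; rewrite mulr_sumr => e.
rewrite big_seq big1 // => w wl; have -> : c w = 0; last by rewrite mul0r.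
apply: xi_reg_Ael => //; apply: (@T_free l (fun w => xi * c w)) => //.
  by move=> u'; apply: AscalarM => //; apply: Ascalar_xi.
by rewrite -[RHS]e; apply: eq_bigr => u' _; rewrite mulrA.
Qed.

Lemma xi_dvd (l : seq G) (c : G -> H) h : uniq l -> (forall w, Ascalar (c w)) ->
  \sum_(w <- l) c w * T w = xi * h -> forall w, w \in l -> exists2 d, Ascalar d & c w = xi * d.
Proof.
move=> ul hc; have [l' [d [ul' hd ->]]] := T_repr h; rewrite mulr_sumr => e w wl.
pose d' u := if u \in l' then d u else 0.
have hd' u : Ascalar (d' u) by rewrite /d'; case: ifP => // _; apply: Ascalar0.
exists (d' w) => //; apply/eqP; rewrite -subr_eq0; apply/eqP.
pose f u := (if u \in l then c u else 0) + (if u \in l' then - (xi * d u) else 0).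
have hf u : Ascalar (f u).
  by apply: (@Ascalar_merge l l' c (fun u => - (xi * d u)) u hc) => u'; apply: AscalarN;
    apply: (AscalarM HA) => //; exact: Ascalar_xi.
have f0 : \sum_(u <- undup (l ++ l')) f u * T u = 0.
  by rewrite merge_sum // e -big_split big1 // => u _ /=; rewrite mulNr mulrA subrr.
have wm : w \in undup (l ++ l') by rewrite mem_undup mem_cat wl.
have := T_free (undup_uniq _) hf f0 wm; rewrite /f wl /d'.
by case: ifP => _; rewrite ?mulr0 ?subr0 ?addr0.
Qed.

(** At [xi = 0] the multiplication is that of the group algebra. *)
Lemma T_xi x y : exists h, T x * T y = T (x * y)%g + xi * h.
Proof.
have [n] := ubnP (len y); elim: n y => // n IH y; rewrite ltnS => hn.
have [y0|y0] := posnP (len y).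
  exists 0; rewrite mulr0 addr0 Tmul // y0 addn0.
  have h1 := dist_triangle A 1 x (x * y); have h2 := dist_triangle A 1 (x * y) x.
  apply: double_inj; move: h1 h2; rewrite (distC A (x * y)) !(dist_len A x) mulKg y0.
  by rewrite !dist1 !addn0 => h1 h2; apply/eqP; rewrite eqn_leq h1 h2.
have [s hs e] := descent_exists y0.
have [|h eh] := IH (y * s)%g; first by apply: leq_trans hn; rewrite e.
have <- : T (y * s)%g * T s = T y.
  by rewrite Tmul -?mulgA (simple_reflV hs) ?mulg1 // (len_simple hs) addn1 e.
have ex : (x * (y * s) * s = x * y)%g by rewrite -!mulgA (simple_reflV hs) mulg1.
rewrite mulrA eh mulrDl -mulrA; case: (T_mul_simple (x * (y * s)) hs); rewrite ex => ->.
  by eexists.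
by rewrite -addrA -mulrDr; eexists.
Qed.

(** * Commutators modulo [xi [H,H]] *)

Lemma class_elt_exists w : exists z, (w = rep w ^ z)%g.
Proof. by have [z e] := rep_conj w; exists z^-1%g; rewrite e conjgK. Qed.

Definition class_elt w : G := projT1 (cid (class_elt_exists w)).

Lemma class_eltP w : (rep w ^ class_elt w = w)%g.
Proof. by rewrite /class_elt; case: cid => z /= <-. Qed.

Definition class_T w := Ti (class_elt w) * T (rep w) * T (class_elt w).

Lemma class_T_xi w : exists h, class_T w = T w + xi * h.
Proof.
have [h1 e1] := T_xi (class_elt w) w; have [h2 e2] := T_xi (rep w) (class_elt w).
have e : (class_elt w * w = rep w * class_elt w)%g by rewrite -{2}(class_eltP w) conj_mulE !mulgA
  mulgV mul1g.
exists (Ti (class_elt w) * (h2 - h1)).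
rewrite /class_T -mulrA e2 -e -[T (class_elt w * w)%g](addrK (xi * h1)) -e1 -addrA.
by rewrite -opprB opprB [- _ + _]addrC -mulrBr mulrDr mulrA Ti_T mul1r (xi_mulCA HA).
Qed.

Lemma class_T_C w : C (class_T w - T (rep w)).
Proof. exact: C_conj (isinvC (isinv_T _)). Qed.

(* Combinations of differences [class_T w - class_T w'] with [w], [w'] conjugate. *)
Definition cancelling h := exists (l : seq G) (c : G -> H), [/\ uniq l, forall w, Ascalar (c w),
  forall r, \sum_(w <- l) c w * (rep w == r)%:R = 0 & h = \sum_(w <- l) c w * class_T w].

Lemma cancelling0 : cancelling 0.
Proof.
by exists [::], (fun=> 0); split=> // [_|r|]; rewrite ?big_nil //; apply: Ascalar0.
Qed.

Lemma cancellingD h h' : cancelling h -> cancelling h' -> cancelling (h + h').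
Proof.
move=> [l [c [u1 a1 z1 ->]]] [l' [c' [u2 a2 z2 ->]]].
exists (undup (l ++ l')), (fun w => (if w \in l then c w else 0) + (if w \in l' then c' w else 0)).
split; [exact: undup_uniq|by move=> w; apply: Ascalar_merge| |by rewrite merge_sum].
by move=> r; rewrite merge_sum // z1 z2 addr0.
Qed.

Lemma cancellingM c h : Ascalar c -> cancelling h -> cancelling (c * h).
Proof.
move=> hc [l [d [u a z ->]]]; exists l, (fun w => c * d w); split=> //.
- by move=> w; apply: AscalarM.
- by move=> r; under eq_bigr do rewrite -mulrA; rewrite -mulr_sumr z mulr0.
- by rewrite mulr_sumr; apply: eq_bigr => w _; rewrite mulrA.
Qed.

Lemma cancelling_diff w w' : rep w = rep w' -> cancelling (class_T w - class_T w').
Proof.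
move=> e; have [->|ne] := eqVneq w w'; first by rewrite subrr; apply: cancelling0.
have ne' : (w' == w) = false by rewrite eq_sym (negPf ne).
exists [:: w; w'], (fun u => if u == w then 1 else -1); split.
- by rewrite /= inE ne.
- by move=> u; case: ifP => _; [|apply: AscalarN]; apply: Ascalar1.
- by move=> r; rewrite big_cons big_seq1 eqxx ne' e mul1r mulN1r subrr.
- by rewrite big_cons big_seq1 eqxx ne' mul1r mulN1r.
Qed.

(** Coefficients sum to zero on each class, so [T (rep w)] can be subtracted from every
    [class_T w]. *)
Lemma cancelling_C h : cancelling h -> C h.
Proof.
move=> [l [c [u a z ->]]].
have -> : \sum_(w <- l) c w * class_T w = \sum_(w <- l) c w * (class_T w - T (rep w)).
  under [RHS]eq_bigr do rewrite mulrBr.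
  rewrite sumrB [X in _ - X](_ : _ = 0) ?subr0 //.
  pose L := undup (map rep l).
  transitivity (\sum_(w <- l) \sum_(r <- L) c w * (rep w == r)%:R * T r).
    rewrite big_seq [RHS]big_seq; apply: eq_bigr => w wl.
    rewrite (bigD1_seq (rep w)) ?undup_uniq ?mem_undup ?map_f //= eqxx mulr1.
    by rewrite big1 ?addr0 // => r; rewrite eq_sym => /negPf->; rewrite mulr0 mul0r.
  rewrite exchange_big big1 // => r _ /=.
  by rewrite -mulr_suml z mul0r.
by apply: C_sum => w _; apply: CM => //; apply: class_T_C.
Qed.

Definition cancelling_mod h := exists2 z, cancelling z & xi_comm (h - z).

Lemma cancelling_modD h h' : cancelling_mod h -> cancelling_mod h' -> cancelling_mod (h + h').
Proof.
move=> [z hz e] [z' hz' e']; exists (z + z'); first exact: cancellingD.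
by rewrite opprD addrACA; apply: xi_commD.
Qed.

Lemma cancelling_modM c h : Ascalar c -> cancelling_mod h -> cancelling_mod (c * h).
Proof.
move=> hc [z hz [d hd e]]; exists (c * z); first exact: cancellingM.
by exists (c * d); [exact: CM|rewrite -mulrBr e (xi_mulCA HA)].
Qed.

Lemma cancelling_mod_sum (I : Type) (l : seq I) (F : I -> H) : (forall i,
  cancelling_mod (F i)) -> cancelling_mod (\sum_(i <- l) F i).
Proof.
move=> h; apply: big_ind => //; [|exact: cancelling_modD].
by exists 0; [exact: cancelling0|rewrite subrr; apply: xi_comm0].
Qed.

(** [1] and [y] both give the minimal element [rep w], so [min_T_conj] links them; its intertwiner
    lifts [y]. *)
Lemma rep_centralizer w y : (rep w ^ y = rep w)%g ->
  exists2 b, braid y b & T (rep w) * b = b * T (rep w).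
Proof.
move=> hy; have min z : (rep w ^ z = rep w)%g -> min_conj (rep w) z.
  move=> hz z'; rewrite hz; have [u e] := rep_conj w; rewrite {2}e -conjgM; exact: rep_min.
have [b hb e] := min_T_conj (min 1%g (conjg1 _)) (min y hy).
by exists b; [move: hb; rewrite invg1 mul1g|rewrite -{1}(conjg1 (rep w)) e hy].
Qed.

(** With [c = class_elt w] and [c' = class_elt w'], [T_x T_c^-1] and [T_c'^-1 b] lift the same
    element, and [b] commutes with [T (rep w)]. Conjugating [T (rep w)] by them gives
    [T_x (class_T w) T_x^-1] and [class_T w'], equal modulo [xi [H,H]] by [braid_conj]. *)
Lemma class_T_conj x w : cancelling_mod (T x * class_T w * Ti x - class_T w).
Proof.
pose w' := (w ^ x^-1)%g.
have rw' : rep w' = rep w by apply: rep_class.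
exists (class_T w' - class_T w); first exact: cancelling_diff.
have -> : T x * class_T w * Ti x - class_T w - (class_T w' - class_T w) =
  T x * class_T w * Ti x - class_T w'.
  by rewrite opprB addrA subrK.
pose y := (class_elt w' * (x * (class_elt w)^-1))%g.
have hy : (rep w ^ y = rep w)%g.
  have e1 : (rep w ^ class_elt w' = w')%g by rewrite -rw' class_eltP.
  have e2 : (w ^ (class_elt w)^-1 = rep w)%g.
    by apply: (canLR (@conjgK _ (class_elt w))); rewrite class_eltP.
  by rewrite /y !conjgM e1 /w' conjgKV e2.
have [b hb eb] := rep_centralizer hy.
have [bi hbi] := braid_unit hb.
have bT u : braid u^-1 (Ti u) by apply: (braid_inv (braid_T u)); apply: isinv_T.
have h1 := braid_mul (braid_T x) (bT (class_elt w)).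
have h2 := braid_mul (bT (class_elt w')) hb.
have ey : ((class_elt w')^-1 * y = x * (class_elt w)^-1)%g by rewrite /y mulKg.
rewrite ey in h2.
have i1 := isinvM (isinv_T x) (isinvC (isinv_T (class_elt w))).
have i2 := isinvM (isinvC (isinv_T (class_elt w'))) hbi.
have := braid_conj h1 h2 i1 i2 (T (rep w)).
rewrite /class_T rw' !mulrA -[Ti (class_elt w') * b * _]mulrA -eb !mulrA -[_ * b * bi]mulrA (proj1
  hbi) mulr1.
by [].
Qed.

Lemma cancelling_mod_conj x k : cancelling_mod (T x * k * Ti x - k).
Proof.
have [l [c [_ a ->]]] := T_repr k.
have -> : T x * (\sum_(w <- l) c w * T w) * Ti x - \sum_(w <- l) c w * T w =
    \sum_(w <- l) c w * (T x * T w * Ti x - T w).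
  rewrite mulr_sumr mulr_suml -sumrB; apply: eq_bigr => w _.
  by rewrite mulrBr !mulrA (Ascalar_central HA (T x) (a w)).
apply: cancelling_mod_sum => w; apply: cancelling_modM => //.
have [h e] := class_T_xi w; have [z hz ez] := class_T_conj x w; exists z => //.
have -> : T w = class_T w - xi * h by rewrite e addrK.
have -> : T x * (class_T w - xi * h) * Ti x - (class_T w - xi * h) - z =
    (T x * class_T w * Ti x - class_T w - z) - xi * (T x * h * Ti x - h).
  rewrite mulrBr mulrBl (xi_mulCA HA) -(mulrA xi) [xi * (_ - h)]mulrBr.
  by rewrite !opprB !addrA [LHS](ACl (1*4*5*3*2)%AC).
apply: xi_commB => //; exists (T x * h * Ti x - h) => //; exact: C_conj (isinv_T _).
Qed.

Lemma C_cancelling_mod h : C h -> cancelling_mod h.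
Proof.
apply: C_ind => [||c x y hc]; first by exists 0; [exact: cancelling0|rewrite subrr; apply: xi_comm0].
  exact: cancelling_modD.
apply: cancelling_modM => //; have [l [d [_ a ->]]] := T_repr x.
rewrite mulr_suml mulr_sumr -sumrB; apply: cancelling_mod_sum => w.
have -> : d w * T w * y - y * (d w * T w) = d w * (T w * y - y * T w).
  by rewrite mulrBr !mulrA (Ascalar_central HA y (a w)).
(* [[T_w, y] = T_w k T_w^-1 - k] with [k = y T_w]. *)
apply: cancelling_modM => //; have := cancelling_mod_conj w (y * T w).
by rewrite !mulrA -[_ * T w * Ti w]mulrA T_Ti mulr1.
Qed.

(** * Independence by repeated division by [xi] *)

Section Independence.
Variable s : seq G.
Hypothesis us : uniq s.
Hypothesis reps : forall w, w \in s -> rep w = w.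

(** Write the relation as [sum c_w e_w + xi c0]. As [e_w = T_w] modulo [xi], freeness gives
    [a - c = xi d]. Summing over the class of [r] kills [c] and leaves [a_r = xi D_r], since [s]
    meets a class at most in its representative. Hence [c = xi c'] with [c'] again cancelling, and
    [xi] divides out of the identity. *)
Lemma xi_step (a : G -> H) : (forall w, Ascalar (a w)) -> C (\sum_(w <- s) a w * T w) ->
  exists a' : G -> H, [/\ forall w, Ascalar (a' w), forall w, w \in s -> a w = xi * a' w &
    C (\sum_(w <- s) a' w * T w)].
Proof.
move=> ha /C_cancelling_mod[z [l [c [ul ac zc ez]]] [c0 hc0 e0]].
have [hh ehh] := choice class_T_xi.
pose f u := (if u \in s then a u else 0) + (if u \in l then - c u else 0).
have hf u : Ascalar (f u) by apply: (@Ascalar_merge s l a (fun u => - c u)) => // w; apply: AscalarN.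
have ft : \sum_(u <- undup (s ++ l)) f u * T u = xi * (c0 + \sum_(w <- l) c w * hh w).
  rewrite merge_sum // mulrDr -e0 ez -addrA; congr (_ + _).
  rewrite mulr_sumr -sumrN -big_split; apply: eq_bigr => w _ /=.
  by rewrite ehh mulrDr (xi_mulCA HA) mulNr opprD subrK.
have hd w : exists d, Ascalar d /\ (w \in undup (s ++ l) -> f w = xi * d).
  case wl: (w \in undup (s ++ l)); last by exists 0; split=> //; apply: Ascalar0.
  by have [d h1 h2] := xi_dvd (undup_uniq _) hf ft wl; exists d.
have [d hd'] := choice hd.
have ad w : Ascalar (d w) by have [] := hd' w.
have ed w : w \in undup (s ++ l) -> f w = xi * d w by have [] := hd' w.
have abool (b : bool) : Ascalar b%:R by case: b; [apply: Ascalar1|apply: Ascalar0].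
pose D r := \sum_(w <- undup (s ++ l)) d w * (rep w == r)%:R.
have aD r : Ascalar (D r) by apply: (Ascalar_sum HA) => w; apply: (AscalarM HA).
have eD r : r \in s -> a r = xi * D r.
  move=> rs; have := merge_sum a (fun u => - c u) (fun w => (rep w == r)%:R) us ul.
  rewrite -/f; under [X in _ = _ + X]eq_bigr do rewrite mulNr.
  rewrite sumrN zc subr0 [RHS](bigD1_seq r) //= (reps rs) eqxx mulr1 [X in _ + X]big_seq_cond [X in
    _ + X]big1 ?addr0; last first.
    by move=> w /andP[ws wr]; rewrite (reps ws) (negPf wr) mulr0.
  move=> <-; rewrite /D mulr_sumr big_seq [RHS]big_seq; apply: eq_bigr => w wl.
  by rewrite -/(f w) ed // mulrA.
pose c' w := (if w \in s then D w else 0) - d w.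
have ac' w : Ascalar (c' w) by apply: AscalarB => //; case: ifP => // _; apply: Ascalar0.
have ec w : w \in l -> c w = xi * c' w.
  move=> wl; have wm : w \in undup (s ++ l) by rewrite mem_undup mem_cat wl orbT.
  have := ed w wm; rewrite /f /c' wl mulrBr => <-.
  by case: ifP => [/eD <-|_]; rewrite ?mulr0 opprD opprK addNKr.
exists D; split=> //.
have Zc : cancelling (\sum_(w <- l) c' w * class_T w).
  exists l, c'; split=> // r; apply: xi_reg; rewrite -[RHS](zc r) mulr_sumr.
  by rewrite big_seq [RHS]big_seq; apply: eq_bigr => w wl; rewrite ec // mulrA.
have -> : \sum_(w <- s) D w * T w = \sum_(w <- l) c' w * class_T w + c0.
  apply/eqP; rewrite -subr_eq0; apply/eqP/xi_reg.
  rewrite mulrBr mulrDr -e0 ez !mulr_sumr.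
  have -> : \sum_(w <- s) xi * (D w * T w) = \sum_(w <- s) a w * T w.
    by rewrite big_seq [RHS]big_seq; apply: eq_bigr => w ws; rewrite mulrA -eD.
  have -> : \sum_(w <- l) xi * (c' w * class_T w) = \sum_(w <- l) c w * class_T w.
    by rewrite big_seq [RHS]big_seq; apply: eq_bigr => w wl; rewrite mulrA -ec.
  by rewrite opprD opprB addKr subrr.
by apply: CD => //; apply: cancelling_C.
Qed.

Lemma xi_power N (a : G -> H) : (forall w, Ascalar (a w)) -> C (\sum_(w <- s) a w * T w) ->
  forall w, w \in s -> exists2 d, Ascalar d & a w = xi ^+ N * d.
Proof.
elim: N a => [|N IH] a ha hC w ws; first by exists (a w); rewrite ?mul1r.
have [a' [ha' e hC']] := xi_step ha hC.
have [d hd ed] := IH a' ha' hC' w ws.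
by exists d => //; rewrite e // ed mulrA exprS.
Qed.

(** [v - v^-1] vanishes at [v = 1], where a nonzero polynomial has a finite multiplicity [e];
    divisibility by the power [e + 1] is then impossible. *)
Lemma xi_divisible a : (forall N, exists2 d, Ascalar d & lev a = xi ^+ N * d) -> a.2 = 0.
Proof.
case: a => k p h /=; apply/eqP; apply: contraT => p0.
have [e [q q1 pe]] := multiplicity_XsubC p 1; rewrite p0 /= in q1.
have [_ [[l r] ->] er] := h e.+1.
have exi N : xi ^+ N = lev (N, ('X^2 - 1) ^+ N).
  elim: N => [|N IH]; first by rewrite levE /= !expr0 pev1 mulr1.
  by rewrite exprS IH -(lev_xi HA) (levM HA) -exprS.
move/eqP: er; rewrite exi (levM HA) -subr_eq0 levN (levD HA) => /eqP/lev_eq0 /= er.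
have {}er : ('X - 1%:P) ^+ e * (q * 'X^(e.+1 + l)) =
    ('X - 1%:P) ^+ e * (('X - 1%:P) * (('X + 1%:P) ^+ e.+1 * r * 'X^k)).
  have -> : ('X - 1%:P) ^+ e * (q * 'X^(e.+1 + l)) = p * 'X^(e.+1 + l) by rewrite pe mulrA (mulrC q).
  move/eqP: er; rewrite mulNr subr_eq0 => /eqP ->.
  have -> : 'X^2 - 1 = ('X - 1%:P) * ('X + 1%:P) :> {poly int} by rewrite -subr_sqr expr1n.
  by rewrite exprMn !mulrA -exprSr.
have {}er := mulfI (expf_neq0 e (negbT (polyXsubC_eq0 1))) er.
have := congr1 (fun g : {poly int} => g.[1]) er.
rewrite !hornerM hornerXsubC subrr mul0r hornerXn expr1n mulr1 => /eqP hq.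
by move: q1; rewrite /root hq.
Qed.

End Independence.

Theorem cocenter_free (s : seq G) (a : G -> laur) : uniq s -> (forall w, w \in s -> rep w = w) ->
  C (\sum_(w <- s) lev (a w) * T w) -> forall w, w \in s -> (a w).2 = 0.
Proof.
move=> us hs hC w ws; apply: xi_divisible => N.
by apply: (xi_power us hs N _ hC ws) => u; eexists.
Qed.

End Hecke.

Lemma int_factor4 (p q : int) : 0 < p -> p * q = 4 -> p = 1 \/ p = 2 \/ p = 4.
Proof.
move=> p0 pq; have q0 : 0 < q by rewrite -(pmulr_rgt0 _ p0) pq.
have p4 : p <= 4 by nia.
have [|[|[|]]] : p = 1 \/ p = 2 \/ p = 3 \/ p = 4 by lia.
- by left.
- by right; left.
- by move=> p3; lia.
- by right; right.
Qed.

(** * The affine Weyl group of a root datum *)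

Section RootDatum.
Variables (n : nat) (Phi : seq (rootpair n)) (f : 'cV[int]_n) (Om : 'M[int]_n -> Prop).
Hypothesis HPhi : is_root_datum Phi.
Hypothesis Hf : regular Phi f.
Hypothesis HOm : diagram_group Phi f Om.
Implicit Types (r s t : rootpair n) (a : 'rV[int]_n) (l : 'cV[int]_n) (g : 'M[int]_n).

Lemma pairingDl a b l : pairing (a + b) l = pairing a l + pairing b l.
Proof. by rewrite /pairing mulmxDl mxE. Qed.
Lemma pairingDr a l l' : pairing a (l + l') = pairing a l + pairing a l'.
Proof. by rewrite /pairing mulmxDr mxE. Qed.
Lemma pairingNl a l : pairing (- a) l = - pairing a l.
Proof. by rewrite /pairing mulNmx mxE. Qed.
Lemma pairingZl k a l : pairing (k *: a) l = k * pairing a l.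
Proof. by rewrite /pairing -scalemxAl mxE. Qed.
Lemma pairingZr k a l : pairing a (k *: l) = k * pairing a l.
Proof. by rewrite /pairing -scalemxAr mxE. Qed.
Lemma pairingM a g l : pairing a (g *m l) = pairing (a *m g) l.
Proof. by rewrite /pairing mulmxA. Qed.

Lemma mulmx_scalar1 a l : a *m l = (pairing a l)%:M.
Proof. by rewrite [LHS]mx11_scalar. Qed.

Lemma reflM_row r a : a *m reflM r = a - pairing a r.2 *: r.1.
Proof. by rewrite mulmxBr mulmx1 mulmxA mulmx_scalar1 mul_scalar_mx. Qed.

Lemma reflM_col r l : reflM r *m l = l - pairing r.1 l *: r.2.
Proof. by rewrite mulmxBl mul1mx -mulmxA mulmx_scalar1 mul_mx_scalar. Qed.

Lemma pairing_coroot r : r \in Phi -> pairing r.1 r.2 = 2.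
Proof. by case: HPhi => -[_ _ h] _; apply: h. Qed.

Lemma reflMK r : r \in Phi -> reflM r *m reflM r = 1%:M.
Proof.
move=> hr; rewrite {1}/reflM mulmxBl mul1mx -mulmxA reflM_row (pairing_coroot hr).
rewrite /reflM mulmxBr -scalemxAr; apply/matrixP => i j; rewrite !mxE; ring.
Qed.

Lemma uniq_coroots : uniq (unzip2 Phi). Proof. by case: HPhi => -[]. Qed.

Lemma coroot_sum (V : nmodType) (F : 'cV[int]_n -> V) r : r \in Phi ->
  \sum_(t <- Phi) F t.2 = \sum_(t <- Phi) F (reflM r *m t.2).
Proof.
move=> hr; rewrite -(big_map snd xpredT F) -(big_map (fun t => reflM r *m t.2) xpredT F).
apply/perm_big; rewrite perm_sym.
have inj : injective (mulmx (reflM r) : 'cV[int]_n -> 'cV[int]_n).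
  by apply: (can_inj (g := mulmx (reflM r))) => l; rewrite mulmxA reflMK // mul1mx.
have e : [seq reflM r *m t.2 | t <- Phi] = map (mulmx (reflM r)) (unzip2 Phi).
  by rewrite /unzip2 -map_comp.
have u : uniq (map (mulmx (reflM r)) (unzip2 Phi)) by rewrite map_inj_uniq ?uniq_coroots.
rewrite e; apply: uniq_perm; rewrite ?uniq_coroots //.
have sub : {subset map (mulmx (reflM r)) (unzip2 Phi) <= unzip2 Phi}.
  by move=> _ /mapP[_ /mapP[s sP ->] ->]; case: HPhi => _ [_ h _]; apply: h.
by have [] := uniq_min_size u sub; rewrite ?size_map.
Qed.

(* This invariant form determines the coroot of a root, which is why reflections permute the pairs
   (root, coroot). *)
Definition coform a : 'cV[int]_n := \sum_(t <- Phi) pairing a t.2 *: t.2.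

Lemma pairing_sum a (F : rootpair n -> 'cV[int]_n) :
  pairing a (\sum_(t <- Phi) F t) = \sum_(t <- Phi) pairing a (F t).
Proof.
elim: Phi => [|t l IH]; first by rewrite !big_nil /pairing mulmx0 mxE.
by rewrite !big_cons pairingDr IH.
Qed.

Lemma coform_refl r a : r \in Phi -> coform (a *m reflM r) = reflM r *m coform a.
Proof.
move=> hr; rewrite /coform (coroot_sum (fun l => pairing (a *m reflM r) l *: l) hr) mulmx_sumr.
apply: eq_bigr => t _.
by rewrite pairingM -mulmxA reflMK // mulmx1 -scalemxAr.
Qed.

(** Each summand is added to its image under the reflection in [r], which negates [<r, t^v>]; only a
    multiple of [r^v] remains. *)
Lemma coform_norm r : r \in Phi ->
  2 *: coform r.1 = pairing r.1 (coform r.1) *: r.2.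
Proof.
move=> hr.
have -> : 2 *: coform r.1 = coform r.1 + coform r.1 by rewrite scaler_nat mulr2n.
rewrite {2}/coform (coroot_sum (fun l => pairing r.1 l *: l) hr) /coform -big_split /=.
rewrite pairing_sum scaler_suml; apply: eq_bigr => t _.
rewrite pairingM reflM_row pairing_coroot // reflM_col pairingZr.
rewrite pairingDl pairingNl pairingZl scalerBr !scalerA addrA -scalerDl.
set x := pairing _ _; have -> : x + (x - 2 * x) = 0 by ring.
by rewrite scale0r add0r -scaleNr; congr (_ *: _); ring.
Qed.

Lemma coform_gt0 r : r \in Phi -> 0 < pairing r.1 (coform r.1).
Proof.
move=> hr; rewrite pairing_sum (big_rem _ hr) /= ltr_wpDr //.
  by apply: sumr_ge0 => t _; rewrite pairingZr -expr2 sqr_ge0.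
by rewrite pairingZr pairing_coroot.
Qed.

Lemma scalev_inj k (l l' : 'cV[int]_n) : k != 0 -> k *: l = k *: l' -> l = l'.
Proof.
move=> k0 /colP h; apply/colP => i; have := h i; rewrite !mxE.
exact: mulfI.
Qed.

Lemma root_refl r s : r \in Phi -> s \in Phi -> (s.1 *m reflM r, reflM r *m s.2) \in Phi.
Proof.
move=> hr hs; have [_ [h _ _]] := HPhi.
have /mapP[t ht e1] := h _ _ hr hs.
suff -> : (s.1 *m reflM r, reflM r *m s.2) = t by [].
rewrite [RHS]surjective_pairing -e1; congr (_, _).
have N : pairing t.1 (coform t.1) = pairing s.1 (coform s.1).
  by rewrite -e1 coform_refl // pairingM -mulmxA reflMK // mulmx1.
apply: (@scalev_inj (pairing t.1 (coform t.1))); first by rewrite gt_eqF ?coform_gt0.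
rewrite -(coform_norm ht) N scalemxAr -(coform_norm hs) -scalemxAr.
by rewrite -e1 coform_refl.
Qed.

Lemma root_neg r : r \in Phi -> (- r.1, - r.2) \in Phi.
Proof.
move=> hr; have := root_refl hr hr; rewrite reflM_row reflM_col pairing_coroot //.
by rewrite !scaler_nat !mulr2n !opprD !addrA !subrr !sub0r.
Qed.

(* The linear parts [g] act on the roots by [s.1 *m g], the inverse of the action on coroots. *)
Definition root_aut g := forall s, s \in Phi -> exists2 t, t \in Phi & t.1 = s.1 *m g /\ g *m t.2 = s.2.

Lemma root_aut1 : root_aut 1%:M.
Proof. by move=> s hs; exists s; rewrite // mulmx1 mul1mx. Qed.

Lemma root_autM g g' : root_aut g -> root_aut g' -> root_aut (g *m g').
Proof.
move=> h h' s /h[t /h'[u hu [eu1 eu2]] [et1 et2]].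
by exists u => //; rewrite eu1 et1 -!mulmxA eu2 et2.
Qed.

Lemma root_aut_refl r : r \in Phi -> root_aut (reflM r).
Proof.
move=> hr s hs; exists (s.1 *m reflM r, reflM r *m s.2); first exact: root_refl.
by rewrite /= mulmxA reflMK // mul1mx.
Qed.

Lemma root_aut_W0 w : inW0 Phi w -> root_aut w.
Proof.
elim=> [|r w' hr _ IH]; first exact: root_aut1.
by apply: root_autM; first exact: root_aut_refl.
Qed.

Lemma Om_inv g : Om g -> exists2 g', Om g' & g *m g' = 1%:M /\ g' *m g = 1%:M.
Proof.
case: HOm => _ _ h _ _ og; have [g' og' e] := h _ og; exists g' => //.
by split=> //; apply: mulmx1C.
Qed.

Lemma Om_root g : Om g -> exists g', [/\ Om g', g *m g' = 1%:M, g' *m g = 1%:M &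
  forall r, r \in Phi -> (r.1 *m g', g *m r.2) \in Phi].
Proof.
move=> og; have [g' og' [e1 e2]] := Om_inv og; exists g'; split=> // r hr.
case: HOm => _ _ _ _ /(_ _ og)[g'' [e3 e4 h _]].
have -> : g' = g'' by rewrite -[g']mulmx1 -e3 mulmxA e2 mul1mx.
exact: h.
Qed.

Lemma root_aut_Om g : Om g -> root_aut g.
Proof.
move=> /Om_inv[g' /Om_root[g'' [_ e1 e2 h]] [e3 e4]] s hs.
have e : g'' = g by rewrite -[g'']mul1mx -e3 -mulmxA e1 mulmx1.
exists (s.1 *m g, g' *m s.2); first by rewrite -e; apply: h.
by rewrite /= mulmxA e3 mul1mx.
Qed.

Lemma inW0_mul w w' : inW0 Phi w -> inW0 Phi w' -> inW0 Phi (w *m w').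
Proof.
move=> h h'; elim: h => [|r u hr _ IH]; first by rewrite mul1mx.
by rewrite -mulmxA; apply: W0_mul.
Qed.

Lemma inW0_refl r : r \in Phi -> inW0 Phi (reflM r).
Proof. by move=> hr; rewrite -[reflM r]mulmx1; apply: W0_mul => //; apply: W0_one. Qed.

Lemma inW0_inv w : inW0 Phi w -> exists2 w', inW0 Phi w' & w *m w' = 1%:M.
Proof.
elim=> [|r u hr _ [u' hu' e]]; first by exists 1%:M; rewrite ?mul1mx //; apply: W0_one.
exists (u' *m reflM r); first by apply: inW0_mul => //; apply: inW0_refl.
by rewrite mulmxA -(mulmxA (reflM r)) e mulmx1 reflMK.
Qed.

Lemma inW0_conj g w : Om g -> inW0 Phi w -> exists2 w', inW0 Phi w' & g *m w = w' *m g.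
Proof.
move=> og; have [g' [_ e1 e2 h]] := Om_root og.
elim=> [|r u hr _ [u' hu' e]]; first by exists 1%:M; rewrite ?mul1mx ?mulmx1 //; apply: W0_one.
exists (reflM (r.1 *m g', g *m r.2) *m u'); first by apply: W0_mul => //; apply: h.
rewrite -mulmxA -e !mulmxA; congr (_ *m _).
rewrite /reflM /= mulmxBr mulmxBl mulmx1 mul1mx -!mulmxA; congr (_ - _).
by rewrite e2 mulmx1.
Qed.

Definition linear_part g := exists w sg, [/\ inW0 Phi w, Om sg & g = w *m sg].

Lemma linear_part1 : linear_part 1%:M.
Proof. by exists 1%:M, 1%:M; split; [exact: W0_one|case: HOm|rewrite mulmx1]. Qed.

Lemma linear_partM g g' : linear_part g -> linear_part g' -> linear_part (g *m g').
Proof.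
move=> [w [s [hw os ->]]] [w' [s' [hw' os' ->]]].
have [u hu e] := inW0_conj os hw'.
exists (w *m u), (s *m s'); split; first exact: inW0_mul.
  by case: HOm => _ h _ _ _; apply: h.
by rewrite -!mulmxA; congr (_ *m _); rewrite !mulmxA e.
Qed.

Lemma linear_partV g : linear_part g -> linear_part (invmx g) /\ g \in unitmx.
Proof.
move=> [w [s [hw os ->]]].
have [w' hw' ew] := inW0_inv hw; have [s' os' [es _]] := Om_inv os.
have e : w *m s *m (s' *m w') = 1%:M by rewrite mulmxA -(mulmxA w) es mulmx1 ew.
have [u _] := mulmx1_unit e; split=> //.
have -> : invmx (w *m s) = s' *m w' by rewrite -[RHS](mulKmx u) e mulmx1.
by have [u' hu' ->] := inW0_conj os' hw'; exists u', s'.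
Qed.

Lemma root_aut_linear g : linear_part g -> root_aut g.
Proof.
by move=> [w [s [hw os ->]]]; apply: root_autM; [exact: root_aut_W0|exact: root_aut_Om].
Qed.

Lemma linear_part_refl r : r \in Phi -> linear_part (reflM r).
Proof.
by exists (reflM r), 1%:M; split; [exact: inW0_refl|case: HOm|rewrite mulmx1].
Qed.

(** * The extended group and its action on root values *)

Definition extended_weyl : Type := {x : elt n | `[< inWt Phi Om x >]}.
HB.instance Definition _ := Choice.on extended_weyl.

Lemma ew_proof x : linear_part x.2 -> `[< inWt Phi Om x >]. Proof. by move=> h; apply/asboolP. Qed.
Definition ew_elt (l : 'cV[int]_n) g (h : linear_part g) : extended_weyl :=
  exist _ (l, g) (ew_proof (x := (l, g)) h).

Lemma ew_lin (x : extended_weyl) : linear_part (val x).2.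
Proof. by have /asboolP := valP x. Qed.

Definition ew_one := ew_elt 0 linear_part1.
Definition ew_mul (x y : extended_weyl) :=
  ew_elt ((val x).1 + (val x).2 *m (val y).1) (linear_partM (ew_lin x) (ew_lin y)).
Definition ew_inv (x : extended_weyl) :=
  ew_elt (- (invmx (val x).2 *m (val x).1)) (linear_partV (ew_lin x)).1.

Lemma ew_mulA : associative ew_mul.
Proof.
move=> x y z; apply: val_inj; rewrite /= mulmxA; congr (_, _).
by rewrite mulmxDr mulmxA addrA.
Qed.

Lemma ew_mul1 : left_id ew_one ew_mul.
Proof. by move=> x; apply: val_inj; rewrite /= !mul1mx add0r -surjective_pairing. Qed.

Lemma ew_mulr1 : right_id ew_one ew_mul.
Proof. by move=> x; apply: val_inj; rewrite /= mulmx0 mulmx1 addr0 -surjective_pairing. Qed.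

Lemma ew_mulV : left_inverse ew_one ew_inv ew_mul.
Proof.
move=> x; apply: val_inj; rewrite /= addNr mulVmx //.
by have [] := linear_partV (ew_lin x).
Qed.

Lemma ew_mulrV : right_inverse ew_one ew_inv ew_mul.
Proof.
move=> x; have [_ u] := linear_partV (ew_lin x).
by apply: val_inj; rewrite /= mulmxN mulmxA mulmxV // mul1mx subrr.
Qed.

Definition ew_group : groupType := HB.pack extended_weyl
  (isGroup.Build extended_weyl ew_mulA ew_mul1 ew_mulr1 ew_mulV ew_mulrV).

Local Notation m := (size Phi).
Local Notation R := realalg.
Implicit Types (i j : 'I_m) (z : ew_group).

Definition root i : rootpair n := tnth (in_tuple Phi) i.

Lemma root_in i : root i \in Phi. Proof. exact: mem_tnth. Qed.

Lemma root_surj t : t \in Phi -> exists i, root i = t.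
Proof. by move=> h; have /tnthP[i ->] : t \in in_tuple Phi by []; exists i. Qed.

Lemma root1_inj i j : (root i).1 = (root j).1 -> i = j.
Proof.
case: HPhi => -[u _ _] _.
have e k : (root k).1 = nth 0 (unzip1 Phi) k.
  by rewrite (nth_map (root k)) ?ltn_ord // {1}/root (tnth_nth (root k)).
rewrite !e => /eqP; rewrite nth_uniq ?size_map ?ltn_ord // => /eqP.
exact: ord_inj.
Qed.

Definition root_index i a := odflt i [pick j | (root j).1 == a].

Lemma root_indexE i t : t \in Phi -> root (root_index i t.1) = t.
Proof.
move=> /root_surj[j <-]; rewrite /root_index; case: pickP => [k /eqP/root1_inj -> //|/(_ j)].
by rewrite eqxx.
Qed.

Definition root_act z i := root_index i ((root i).1 *m (val z).2).
Definition root_opp i := root_index i (- (root i).1).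
Definition transl z i := pairing (root i).1 (val z).1.

Lemma root_opp1 i : (root (root_opp i)).1 = - (root i).1.
Proof. by rewrite /root_opp (root_indexE i (root_neg (root_in i))). Qed.

Lemma root_actP z i : (root (root_act z i)).1 = (root i).1 *m (val z).2 /\
  (val z).2 *m (root (root_act z i)).2 = (root i).2.
Proof.
have [t ht [e1 e2]] := root_aut_linear (ew_lin z) (root_in i).
by rewrite /root_act -e1 (root_indexE i ht).
Qed.

Lemma root_act1 z i : (root (root_act z i)).1 = (root i).1 *m (val z).2.
Proof. by have [] := root_actP z i. Qed.

Definition aff_refl i (k : int) : ew_group :=
  ew_elt (k *: (root i).2) (linear_part_refl (root_in i)).

Definition rp i (w : 'cV[R]_n) : R := (map_mx intr (root i).1 *m w) 0 0.

(** Only root values are kept, so directions killed by all roots disappear. *)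
Definition vec (c : R) (w : 'cV[R]_n) : 'rV[R]_m.+1 :=
  \row_q if unlift ord0 q is Some i then rp i w else c.

Lemma wt_vec c w : wt (vec c w) = c.
Proof. by rewrite /wt mxE unlift_none. Qed.

Lemma co_vec c w i : co (vec c w) i = rp i w.
Proof. by rewrite /co mxE liftK. Qed.

Definition vecmx : 'M[R]_(n.+1, m.+1) := \matrix_(p, q)
  if unlift ord0 q is Some i then
    if unlift ord0 p is Some j then ((root i).1 0 j)%:~R else 0
  else (p == ord0)%:R.

Lemma mul_vecmx (u : 'rV[R]_n.+1) : u *m vecmx = vec (u 0 ord0) (\col_j u 0 (lift ord0 j)).
Proof.
apply/rowP => q; rewrite !mxE big_ord_recl !mxE unlift_none.
case: unliftP => [i ->|->].
  rewrite mulr0 add0r /rp mxE; apply: eq_bigr => j _.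
  by rewrite !mxE !liftK mulrC.
by rewrite eqxx mulr1 big1 ?addr0 // => j _; rewrite mxE unlift_none mulr0.
Qed.

Definition vecspace : 'M[R]_m.+1 := <<vecmx>>%MS.

Lemma vecspaceP (y : 'rV[R]_m.+1) : (y <= vecspace)%MS <-> exists c w, y = vec c w.
Proof.
rewrite genmxE; split=> [/submxP[u ->]|[c [w ->]]].
  by rewrite mul_vecmx; eexists; eexists.
apply/submxP; exists (\row_p if unlift ord0 p is Some j then w j 0 else c).
rewrite mul_vecmx mxE unlift_none; congr vec.
by apply/colP => j; rewrite !mxE liftK.
Qed.

Lemma rpD i w w' : rp i (w + w') = rp i w + rp i w'.
Proof. by rewrite /rp mulmxDr mxE. Qed.

Lemma rpZ i c w : rp i (c *: w) = c * rp i w.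
Proof. by rewrite /rp -scalemxAr mxE. Qed.

Lemma rp_int i l : rp i (map_mx intr l) = (pairing (root i).1 l)%:~R.
Proof. by rewrite /rp -map_mxM mxE. Qed.

Lemma rp_act z i w : rp (root_act z i) w = rp i (map_mx intr (val z).2 *m w).
Proof. by rewrite /rp root_act1 map_mxM mulmxA. Qed.

Lemma rp_opp i w : rp (root_opp i) w = - rp i w.
Proof. by rewrite /rp root_opp1 map_mxN mulNmx mxE. Qed.

Local Notation ps := (fun i => pos f (root i).1).

Lemma ax_sg1 i : root_act 1%g i = i.
Proof. by apply: root1_inj; rewrite root_act1 /= mulmx1. Qed.

Lemma ax_tr1 i : transl 1%g i = 0.
Proof. by rewrite /transl /pairing /= mulmx0 mxE. Qed.

Lemma ax_sgM x y i : root_act (x * y)%g i = root_act y (root_act x i).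
Proof. by apply: root1_inj; rewrite !root_act1 /= mulmxA. Qed.

Lemma ax_trM x y i : transl (x * y)%g i = transl x i + transl y (root_act x i).
Proof. by rewrite /transl root_act1 /= pairingDr pairingM. Qed.

Lemma ax_ngK : involutive root_opp.
Proof. by move=> i; apply: root1_inj; rewrite !root_opp1 opprK. Qed.

Lemma ax_ps_ng i : ps (root_opp i) = ~~ ps i.
Proof.
rewrite /pos root_opp1 pairingNl oppr_gt0 -leNgt le_eqVlt.
by rewrite (negPf (Hf (root_in i))).
Qed.

Lemma ax_sg_ng z i : root_act z (root_opp i) = root_opp (root_act z i).
Proof. by apply: root1_inj; rewrite root_act1 !root_opp1 root_act1 mulNmx. Qed.

Lemma ax_tr_ng z i : transl z (root_opp i) = - transl z i.
Proof. by rewrite /transl root_opp1 pairingNl. Qed.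

Lemma ax_Vh_ng (y : 'rV[R]_m.+1) i : (y <= vecspace)%MS -> co y (root_opp i) = - co y i.
Proof. by move=> /vecspaceP[c [w ->]]; rewrite !co_vec rp_opp. Qed.

Lemma ax_Vh_act z (y : 'rV[R]_m.+1) : (y <= vecspace)%MS ->
  (y *m amx R (root_act z) (transl z) <= vecspace)%MS.
Proof.
move=> /vecspaceP[c [w ->]]; apply/vecspaceP.
exists c, (map_mx intr (val z).2 *m w + c *: map_mx intr (val z).1).
apply: point_eq => [|i]; first by rewrite wt_amx !wt_vec.
by rewrite co_amx !co_vec wt_vec rpD rpZ rp_int rp_act mulrC.
Qed.

Lemma ax_sg_rf i k : root_act (aff_refl i k) i = root_opp i.
Proof.
apply: root1_inj; rewrite root_act1 root_opp1 /= reflM_row pairing_coroot ?root_in //.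
by rewrite scaler_nat mulr2n opprD addrA subrr sub0r.
Qed.

Lemma ax_tr_rf i k : transl (aff_refl i k) i = k + k.
Proof. by rewrite /transl /= pairingZr pairing_coroot ?root_in //; ring. Qed.

Lemma ax_rf_fix i k (y : 'rV[R]_m.+1) : (y <= vecspace)%MS -> fn i k y = 0 ->
  y *m amx R (root_act (aff_refl i k)) (transl (aff_refl i k)) = y.
Proof.
move=> /vecspaceP[c [w ->]]; rewrite /fn co_vec wt_vec => /eqP; rewrite subr_eq0 => /eqP e.
apply: point_eq => [|j]; first by rewrite wt_amx.
rewrite co_amx !co_vec wt_vec rp_act /= /transl /= pairingZr.
have -> : map_mx intr (reflM (root i)) *m w = w - rp i w *: map_mx intr (root i).2.
  rewrite /reflM map_mxB map_mx1 map_mxM mulmxBl mul1mx -mulmxA.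
  rewrite [X in _ *m X](mx11_scalar (map_mx intr (root i).1 *m w)).
  by rewrite mul_mx_scalar.
by rewrite rpD -scaleNr rpZ rp_int e rmorphM /=; ring.
Qed.

Lemma ax_rfJ i k z : (aff_refl i k * z = z * aff_refl (root_act z i) (k - transl z i))%g.
Proof.
have [e1 e2] := root_actP z i.
apply: val_inj => /=; congr (_, _); last first.
  by rewrite /reflM mulmxBl mulmxBr mul1mx mulmx1 e1 -!mulmxA; congr (_ - _); rewrite !mulmxA e2.
rewrite -scalemxAr e2 reflM_col scalerBl /transl.
by rewrite addrCA.
Qed.

Lemma ax_rfV i k : (aff_refl i k * aff_refl i k = 1)%g.
Proof.
apply: val_inj => /=; rewrite reflMK ?root_in //; congr (_, _).
rewrite -scalemxAr reflM_col pairing_coroot ?root_in // scaler_nat mulr2n opprD addrA subrr.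
by rewrite sub0r scalerN subrr.
Qed.

(** Dividing the regular vector [f] by this integer brings its root values strictly between -1 and
    1, hence into the fundamental alcove. *)
Definition alcove_scale : int := 1 + \sum_i `|pairing (root i).1 f|.

Lemma alcove_scale_gt0 : 0 < alcove_scale.
Proof. by rewrite ltr_wpDr // sumr_ge0. Qed.

Lemma alcove_scale_gt i : `|pairing (root i).1 f| < alcove_scale.
Proof.
rewrite /alcove_scale (bigD1 i) //= addrCA ltrDl ltr_wpDr //; exact: sumr_ge0.
Qed.

Definition base_point := vec 1 (alcove_scale%:~R^-1 *: map_mx intr f).

Lemma ax_c0_gt0 i : 0 < fn i (if ps i then 0 else -1) base_point.
Proof.
have N0 : 0 < alcove_scale%:~R :> R by rewrite ltr0z alcove_scale_gt0.
rewrite /fn wt_vec co_vec mulr1 rpZ rp_int; case: ifP => [h|_].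
  by rewrite subr0 mulr_gt0 ?invr_gt0 // ltr0z.
rewrite -(pmulr_rgt0 _ N0) mulrBr mulVKf ?gt_eqF // -rmorphM -rmorphB ltr0z.
have := alcove_scale_gt i; rewrite ltr_norml => /andP[h _]; lia.
Qed.

Lemma vec0_space w : (vec 0 w <= vecspace)%MS.
Proof. by apply/vecspaceP; exists 0, w. Qed.

Lemma row_pairing a b : (forall l, pairing a l = pairing b l) -> a = b.
Proof.
move=> h; apply/rowP => j; have := h (delta_mx j 0).
by rewrite /pairing -!colE !mxE.
Qed.

(* For proportional roots the product [<b,a^v> <a,b^v>] equals [4], so that one is [1/2], [1] or
   [2] times the other; reducedness excludes the ratio [2]. *)
Lemma ax_nonproportional i j (a : R) : 0 < a ->
  (forall y : 'rV[R]_m.+1, (y <= vecspace)%MS -> wt y = 0 -> co y j = a * co y i) -> i = j.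
Proof.
move=> a0 h.
have e l : (pairing (root j).1 l)%:~R = a * (pairing (root i).1 l)%:~R.
  by have := h _ (vec0_space (map_mx intr l)) (wt_vec _ _); rewrite !co_vec !rp_int.
set p := pairing (root j).1 (root i).2; set q := pairing (root i).1 (root j).2.
have ep : p%:~R = a * 2 by rewrite e pairing_coroot ?root_in.
have eq : 2 = a * q%:~R by rewrite -e pairing_coroot ?root_in.
have p0 : 0 < p by rewrite -(ltr0z R) ep mulr_gt0.
have pq : p * q = 4.
  apply: (@intr_inj R); rewrite rmorphM /= ep mulrAC -eq; ring.
have e2 l : 2 * pairing (root j).1 l = p * pairing (root i).1 l.
  apply: (@intr_inj R); rewrite !rmorphM /= e ep; ring.
have red k (k' : 'I_m) : (root k).1 + (root k).1 = (root k').1 -> False.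
  case: HPhi => _ [_ _ hr] ekl; have := hr _ (root_in k).
  by rewrite ekl map_f ?root_in.
have hp := int_factor4 p0 pq.
case: hp => [p1|[p1|p1]].
- case: (red j i); apply: row_pairing => l.
  have := e2 l; rewrite p1 pairingDl; lia.
- apply: root1_inj; apply: row_pairing => l; have := e2 l; rewrite p1; lia.
- case: (red i j); apply: row_pairing => l.
  have := e2 l; rewrite p1 pairingDl; lia.
Qed.

Lemma ax_root_neq0 i : exists y : 'rV[R]_m.+1, [/\ (y <= vecspace)%MS, wt y = 0 & co y i != 0].
Proof.
exists (vec 0 (map_mx intr (root i).2)).
split; [exact: vec0_space|exact: wt_vec|].
by rewrite co_vec rp_int pairing_coroot ?root_in // intr_eq0.
Qed.

Lemma base_point_space : (base_point <= vecspace)%MS.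
Proof. by apply/vecspaceP; exists 1; eexists. Qed.

Definition root_system : affine_system R m ew_group :=
  AffineSystem ax_sg1 ax_tr1 ax_sgM ax_trM ax_ngK ax_ps_ng ax_sg_ng ax_tr_ng ax_Vh_ng ax_Vh_act
    ax_sg_rf ax_tr_rf ax_rf_fix ax_rfJ ax_rfV base_point_space (wt_vec _ _) ax_c0_gt0
    ax_nonproportional ax_root_neq0.

Lemma alen_len (z : ew_group) : alen Phi f (val z) = len root_system z.
Proof.
rewrite /alen big_tnth /len; apply: eq_bigr => i _.
by rewrite /strip /= root_act1 /transl /root; case: ifP.
Qed.

Lemma simple_root_system (s : ew_group) : simple_refl root_system s -> is_simple_refl Phi f (val s).
Proof.
move=> [i [k [-> h]]]; exists (root i), k; split=> //; first exact: root_in.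
by rewrite -h alen_len.
Qed.

Lemma wconjP (x z : ew_group) : wconj Phi Om (val x) (val (x ^ z)%g).
Proof.
exists (val (z^-1)%g); split; first by apply/asboolP/(valP (z^-1)%g).
have e (u w : ew_group) : emul (val u) (val w) = val (u * w)%g by [].
by rewrite !e conj_mulE -!mulgA mulgV mulg1.
Qed.

Lemma wconj_conj (x y : ew_group) : wconj Phi Om (val x) (val y) -> exists z, (y = x ^ z)%g.
Proof.
move=> [z [/asboolP hz e]].
pose z' : ew_group := exist _ z hz.
have {}e : (z' * x = y * z')%g by apply: val_inj.
by exists (z'^-1)%g; rewrite conj_mulE invgK e -mulgA mulgV mulg1.
Qed.

End RootDatum.

(** * Transfer to the elements and the algebra of the statement *)

Theorem theorem6p10 (n : nat) (Phi : seq (rootpair n)) (f : 'cV[int]_n)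
    (Om : 'M[int]_n -> Prop)
    (HPhi : is_root_datum Phi) (Hf : regular Phi f)
    (HOm : diagram_group Phi f Om)
    (rep : elt n -> elt n)
    (Hrep_in : forall x, inWt Phi Om x -> inWt Phi Om (rep x))
    (Hrep_conj : forall x, inWt Phi Om x -> wconj Phi Om x (rep x))
    (Hrep_min : forall x y, inWt Phi Om x -> inWt Phi Om y -> wconj Phi Om x y ->
                  (alen Phi f (rep x) <= alen Phi f y)%N)
    (Hrep_class : forall x y, inWt Phi Om x -> inWt Phi Om y -> wconj Phi Om x y ->
                  rep x = rep y)
    (H : nzRingType) (v vi : H) (HA : A_alg v vi) (T : elt n -> H)
    (HT : is_IH Phi f Om v vi T) :
  (* the classes of the T_{w_O} span the cocenter over A *)
  (forall h : H, exists (s : seq (elt n)) (a : elt n -> laur),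
      (forall w, w \in s -> inWt Phi Om w /\ rep w = w) /\
      comm_span v vi (h - \sum_(w <- s) lev v vi (a w) * T w)) /\
  (* and are A-linearly independent modulo [H,H] (hence the coefficients
     f_{w,O} are unique) *)
  (forall (s : seq (elt n)) (a : elt n -> laur), uniq s ->
      (forall w, w \in s -> inWt Phi Om w /\ rep w = w) ->
      comm_span v vi (\sum_(w <- s) lev v vi (a w) * T w) ->
      forall w, w \in s -> (a w).2 = 0).
Proof.
pose G := ew_group HPhi HOm; pose A := root_system HPhi Hf HOm.
have inG (z : G) : inWt Phi Om (val z) by apply/asboolP/(valP z).
pose gsub (w : elt n) : G := insubd (ew_one HOm) w.
have gsubK w : inWt Phi Om w -> val (gsub w) = w by move=> /asboolP h; apply: insubdK.
have valGK (z : G) : gsub (val z) = z by apply: val_inj; apply: gsubK.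
pose T' (z : G) := T (val z).
pose rep' (z : G) := gsub (rep (val z)).
have rep'E z : val (rep' z) = rep (val z) by apply: gsubK; apply: Hrep_in.
case: HT => Tspan Tfree Tmul Tquad.
have lift_sum (s : seq (elt n)) (c : elt n -> H) : (forall w, w \in s -> inWt Phi Om w) ->
    \sum_(w <- s) c w * T w = \sum_(z <- map gsub s) c (val z) * T' z.
  move=> hs; rewrite big_map big_seq [RHS]big_seq; apply: eq_bigr => w ws.
  by rewrite /T' gsubK //; apply: hs.
have val_sum (s : seq G) (a : G -> laur) :
    \sum_(z <- s) lev v vi (a z) * T' z =
    \sum_(w <- map val s) lev v vi (a (gsub w)) * T w.
  by rewrite big_map; apply: eq_bigr => z _; rewrite valGK.
have Tspan' h : exists (s : seq G) (a : G -> laur), h = \sum_(w <- s) lev v vi (a w) * T' w.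
  have [s [a [hs ->]]] := Tspan h; exists (map gsub s), (a \o val).
  exact: (lift_sum s (fun w => lev v vi (a w))).
have Tfree' (s : seq G) (a : G -> laur) : uniq s ->
    \sum_(w <- s) lev v vi (a w) * T' w = 0 -> forall w, w \in s -> (a w).2 = 0.
  move=> us; rewrite val_sum => e w ws; rewrite -[w]valGK.
  apply: (Tfree _ (fun x => a (gsub x)) _ _ e); last exact: map_f.
    by rewrite map_inj_uniq //; apply: val_inj.
  by move=> _ /mapP[z _ ->].
have Tmul' (x y : G) : len A (x * y)%g = (len A x + len A y)%N -> T' x * T' y = T' (x * y)%g.
  by move=> e; apply: Tmul => //; rewrite -!(alen_len Hf) in e.
have Tquad' (s : G) : simple_refl A s -> (T' s - v) * (T' s + vi) = 0.
  by move=> hs; apply: Tquad; apply: simple_root_system hs.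
have rep_conj' (x : G) : exists z, rep' x = (x ^ z)%g.
  by apply: wconj_conj; rewrite rep'E; apply: Hrep_conj.
have rep_min' (x z : G) : (len A (rep' x) <= len A (x ^ z)%g)%N.
  rewrite -!(alen_len Hf) rep'E; apply: Hrep_min => //; exact: wconjP.
have rep_class' (x z : G) : rep' (x ^ z)%g = rep' x.
  apply: val_inj; rewrite !rep'E; apply/esym/Hrep_class => //; exact: wconjP.
split.
  move=> h; have [l [c [_ hc hl hC]]] := spanned_all HA Tspan' Tmul' Tquad' rep_conj' rep_min'
    rep_class' h.
  have [a ea] := choice hc.
  exists (map val l), (fun w => a (gsub w)); split.
    by move=> _ /mapP[z zl ->]; split; rewrite // -rep'E hl.
  by rewrite -val_sum; under eq_bigr do rewrite -ea.
move=> s a us hs hC w ws.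
have hin x : x \in s -> inWt Phi Om x by move=> /hs[].
rewrite (lift_sum s (fun w => lev v vi (a w)) hin) in hC.
rewrite -(gsubK _ (hin _ ws)).
apply: (@cocenter_free _ _ _ A _ _ _ HA T' Tspan' Tfree' Tmul' Tquad' rep' rep_conj' rep_min'
  rep_class' (map gsub s) (fun z => a (val z)) _ _ hC); last exact: map_f.
  rewrite map_inj_in_uniq // => x y xs ys e.
  by rewrite -(gsubK _ (hin _ xs)) e gsubK //; apply: hin.
move=> _ /mapP[x xs ->]; apply: val_inj; rewrite rep'E gsubK; last exact: hin.
by have [] := hs _ xs.
Qed.
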